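(* Let $(\lambda_k,u_k)$, $k\in\mathbb N$, be the eigenpair approximations produced by Adaptive Algorithm $C$ (described in the context), let $f_1=\bar f_1/\|K\bar f_1\|_{a,\Omega}$, $w_1=Kf_1$, and let $\alpha$ be a fixed number with $\hat\alpha<\alpha<1$. When $H$ is small enough, there exist constants $C_{\rm con}^u$ and $C_{\rm con}^\lambda$ such that for all $k\in\mathbb N$ $$\|u_k-Eu_k\|_{a,\Omega}^2\le C_{\rm con}^u\,\alpha^{2(k-1)},\qquad |\lambda_k-\hat\lambda^1|\le C_{\rm con}^\lambda\,\alpha^{2(k-1)},$$ where $$C_{\rm con}^u=3\Big(\|w_1-R_1w_1\|_{a,\Omega}^2+\gamma\,\eta^2(f_1;\mathcal T_1)\Big),\qquad C_{\rm con}^\lambda=8\hat\lambda^1C_{\rm con}^u.$$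
   Context: PROBLEM. $\Omega\subset\mathbb R^d$ ($d\ge1$) is a bounded polytopic domain with Lipschitz boundary, $V=H_0^1(\Omega)$, $(\cdot,\cdot)$ is the $L^2(\Omega)$ inner product. $A=(a_{ij})_{d\times d}$ is a symmetric positive definite matrix with $a_{ij}\in W^{1,\infty}(\Omega)$, $0\le\varphi\in L^\infty(\Omega)$, $Lu=-\nabla\cdot(A\nabla u)+\varphi u$, $a(u,v)=\int_\Omega(A\nabla u\cdot\nabla v+\varphi uv)\,d\Omega$, $\|w\|_{a,\Omega}=\sqrt{a(w,w)}$, and $c_a,C_a>0$ satisfy $c_a\|w\|_{1,\Omega}\le\|w\|_{a,\Omega}\le C_a\|w\|_{1,\Omega}$ on $V$. Eigenvalue problem: $(\lambda,u)\in\mathbb R\times V$, $\|u\|_{a,\Omega}=1$, $a(u,v)=\lambda(u,v)$ for all $v\in V$; eigenvalues $0<\hat\lambda^1<\hat\lambda^2\le\cdots$, eigenfunctions $\hat u^i$ with $a(\hat u^i,\hat u^j)=\delta_{ij}$. $M(\hat\lambda^1)$ is the eigenspace of $\hat\lambda^1$ and $E:V\to M(\hat\lambda^1)$ is the $a$-orthogonal projection. $K:L^2(\Omega)\to V$ is defined by $a(Kw,v)=(w,v)$ for all $v\in V$ (so $L^{-1}f=Kf$). Only the first eigenpair is considered; it is assumed that $\hat u^1$ is not a piecewise polynomial. FINITE ELEMENTS AND ESTIMATOR. All meshes are conforming, nested and shape regular: $h_T/\rho_T\le\gamma^*$ for all elements $T$ ($h_T$ diameter, $\rho_T$ diameter of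 the largest inscribed ball). $V_k\subset V$ is the space of continuous piecewise polynomials of fixed degree $m\ge1$ on $\mathcal T_k$ vanishing on $\partial\Omega$; $R_k:V\to V_k$ is the Galerkin projection, $a(v-R_kv,v_k)=0$ for all $v_k\in V_k$. $\mathcal E_k$ is the set of interior faces. For $f\in L^2(\Omega)$, $v_k\in V_k$: $\mathcal R_T(f,v_k)=f+\nabla\cdot(A\nabla v_k)-\varphi v_k$ in $T$; $\mathcal J_E(v_k)=-A\nabla v_k^+\cdot\nu^+-A\nabla v_k^-\cdot\nu^-$ on $E\in\mathcal E_k$, $E$ being the common side of $T^\pm$ with outward normals $\nu^\pm$; $\eta_k^2(f,v_k;T)=h_T^2\|\mathcal R_T(f,v_k)\|_{0,T}^2+\sum_{E\in\mathcal E_k,E\subset\partial T}h_E\|\mathcal J_E(v_k)\|_{0,E}^2$; $\eta_k(f,v_k;\mathcal T')=(\sum_{T\in\mathcal T'}\eta_k^2(f,v_k;T))^{1/2}$ for $\mathcal T'\subset\mathcal T_k$; $\eta(f;\mathcal T_k):=\eta_k(f,R_kKf;\mathcal T_k)$. Oscillation: ${\rm osc}(g;\mathcal T_k)=(\sum_{T\in\mathcal T_k}\|h_T(g-P_Tg)\|_{0,T}^2)^{1/2}$, $P_T$ the $L^2(T)$-projection onto polynomials of some fixed degree (such that ${\rm osc}(f-Lv_k;\mathcal T_k)={\rm osc}(Lv_k;\mathcal T_k)$ for $f,v_k\in V_k$); $Lv_k$ is understood elementwise. ADAPTIVE ALGORITHM C. Modules: ESOLVE$(W)$ returns the first eigenpair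 $(\mu,w)\in\mathbb R\times W$ with $\|w\|_{a,\Omega}=1$, $a(w,v)=\mu(w,v)$ for all $v\in W$. LSOLVE$(f,W)$ returns $w\in W$ with $a(w,v)=(f,v)$ for all $v\in W$. MARK at level $k$ with parameter $\theta_1$ returns a minimal subset $\mathcal M_k\subset\mathcal T_k$ with $\eta_k(\bar f_k,\bar u_k;\mathcal M_k)\ge\theta_1\eta_k(\bar f_k,\bar u_k;\mathcal T_k)$. REFINE$(\mathcal M_k,\mathcal T_k)$ returns a conforming refinement $\mathcal T_{k+1}$ of $\mathcal T_k$ (by iterative or recursive bisection, with the minimal refinement condition) in which at least all elements of $\mathcal M_k$ are refined, together with $V_{k+1}$. Initialization: given $\theta_1,\theta_2\in(0,1)$ and a coarse mesh $\mathcal T_H$ of mesh size $H$ with finite element space $V_H$, refine $\mathcal T_H$ regularly to get $\mathcal T_1$ and $V_1$ (possibly $\mathcal T_1=\mathcal T_H$). $(\lambda_1,u_1)=$ESOLVE$(V_1)$; set $\bar f_2^{(0)}=\bar f_1=\tilde u_1=u_1$, $\bar u_1=u_1/\lambda_1$, $n_1=1$, $k=2$, $\ell=1$, $j=0$, and the number $\eta_1=\eta_1(\bar f_1,\bar u_1;\mathcal T_1)$. Iterate: (1) MARK on $\mathcal T_{k-1}$ gives $\mathcal M_{k-1}$. (2) $(\mathcal T_k,V_k)=$REFINE$(\mathcal M_{k-1},\mathcal T_{k-1})$. (3) $\bar u_k^{(j)}=$LSOLVE$(\bar f_k^{(j)},V_k)$, $u_k^{(j)}=\bar u_k^{(j)}/\|\bar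 u_k^{(j)}\|_{a,\Omega}$, $\lambda_k^{(j)}=a(u_k^{(j)},u_k^{(j)})/(u_k^{(j)},u_k^{(j)})$. (4) Compute $\eta_k(\bar f_k^{(j)},\bar u_k^{(j)};T)$, $T\in\mathcal T_k$. (5) If $\eta_k(\bar f_k^{(j)},\bar u_k^{(j)};\mathcal T_k)\le\theta_2^{j+1}\eta_\ell$, then $(\tilde\lambda_k^{(j)},\tilde u_k^{(j)})=$ESOLVE$(V_H+{\rm span}\{u_k^{(j)}\})$, set $\bar f_k^{(j+1)}=\tilde u_k^{(j)}$, $j:=j+1$, go to (3); else set $\bar f_k=\bar f_k^{(j)}$, $\bar u_k=\bar u_k^{(j)}$, $u_k=u_k^{(j)}$, $\lambda_k=\lambda_k^{(j)}$. (6) If $j>0$, then $(\tilde\lambda_k,\tilde u_k)=$ESOLVE$(V_H+{\rm span}\{u_k\})$, $\bar f_{k+1}^{(0)}=\tilde u_k$, $\eta_{\ell+1}=\eta_k(\bar f_k^{(j)},\bar u_k^{(j)};\mathcal T_k)$, $n_{\ell+1}=k$, $\ell:=\ell+1$, $j:=0$; else $\bar f_{k+1}^{(0)}=u_k$. (7) $k:=k+1$, go to (1). Standing assumption: $\theta_1\in(0,\theta_* )$, where $\theta_*$ is the constant of Cascon–Kreuzer–Nochetto–Siebert with the property: if $f\in L^2(\Omega)$, $\mathcal T_{k,*}$ is a refinement of $\mathcal T_k$ (Galerkin projection $R_{k,*}$) and $\|(I-R_{k,*})Kf\|_{a,\Omega}^2+{\rm osc}^2(f-LR_{k,*}Kf;\mathcal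 T_{k,*})\le\tilde\xi_0^2(\|(I-R_k)Kf\|_{a,\Omega}^2+{\rm osc}^2(f-LR_kKf;\mathcal T_k))$ with $\tilde\xi_0^2\in(0,\frac12)$, then $\eta_k^2(f,R_kKf;\mathcal T_k\setminus(\mathcal T_{k,*}\cap\mathcal T_k))\ge\theta_*^2(1-2\tilde\xi_0^2)\,\eta_k^2(f,R_kKf;\mathcal T_k)$. KNOWN QUANTITIES AND CONSTANTS. For a finite dimensional $W\subset V$: $\eta_a(W)=\sup_{f\in L^2(\Omega),\|f\|_{0,\Omega}=1}\inf_{v\in W}\|L^{-1}f-v\|_{a,\Omega}$, $\delta_W(\hat\lambda^1)=\sup_{v\in M(\hat\lambda^1),\|v\|_{a,\Omega}=1}\inf_{w\in W}\|v-w\|_{a,\Omega}$; both tend to $0$ for $W=V_H$ as $H\to0$. The following are known mesh-independent constants with the stated properties. - $C_{ea},C_{e0}$: for $W=V_1$ or $W=V_H+{\rm span}\{u\}$ with $u=u_{n_\ell}^{(j)}$ or $u=u_{n_\ell}$ ($\ell\ge2$), and $w$ the function returned by ESOLVE$(W)$, $\|w-Ew\|_{a,\Omega}\le C_{ea}\delta_W(\hat\lambda^1)$ (hence, for the second type of $W$, $\le C_{ea}\min\{\delta_{V_H}(\hat\lambda^1),\|\hat u^1-u\|_{a,\Omega}\}$) and $\|w-Ew\|_{0,\Omega}\le C_{e0}\eta_a(W)\|w-Ew\|_{a,\Omega}$ (with $\eta_a(W)\le\eta_a(V_H)$). - $C_{an}$: $\|(I-R_k)v\|_{0,\Omega}\le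 C_{an}\eta_a(V_k)\|(I-R_k)v\|_{a,\Omega}$ for $v\in V$. - $C_{\rm up},C_{\rm low}$: for $f\in L^2(\Omega)$, $\|(I-R_k)Kf\|_{a,\Omega}\le C_{\rm up}\eta(f;\mathcal T_k)$ and $C_{\rm low}\eta(f;\mathcal T_k)\le\|(I-R_k)Kf\|_{a,\Omega}+{\rm osc}(f-LR_kKf;\mathcal T_k)$. - $C_{oa}$: ${\rm osc}(Lv_k;\mathcal T_k)\le C_{oa}\|v_k\|_{a,\Omega}$ for $v_k\in V_k$. - $\gamma>0$, $\hat\alpha\in(0,1)$ (depending on $\gamma^*,A,\varphi,\theta_1$): for all $k$, $\|(I-R_{k+1})K\bar f_k\|_{a,\Omega}^2+\gamma\eta^2(\bar f_k;\mathcal T_{k+1})\le\hat\alpha^2(\|(I-R_k)K\bar f_k\|_{a,\Omega}^2+\gamma\eta^2(\bar f_k;\mathcal T_k))$. ''$H$ small enough'' means: there is $H_0>0$ such that the assertion holds whenever $0<H\le H_0$. *)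

(* Defs.v *)
Set Warnings "-notation-overridden,-ambiguous-paths,-notation-incompatible-prefix".
Set Warnings "-redundant-canonical-projection".
From HB Require Import structures.
From mathcomp Require Import all_boot all_order all_algebra finmap.
From mathcomp Require Import all_classical all_reals all_analysis.
Import Order.TTheory GRing.Theory Num.Theory.
Import numFieldNormedType.Exports.
Set Implicit Arguments.
Unset Strict Implicit.
Unset Printing Implicit Defensive.
Local Open Scope classical_set_scope.
Local Open Scope ring_scope.

(* R^n is the type 'rV[R]_n with the sigma-algebra generated by the           *)
(* coordinates, i.e. the Borel one.                                           *)
Section row_measurable.
Variables (R : realType) (n : nat).
Let coord (i : 'I_n) (x : 'rV[R]_n) : measurableTypeR R := x 0 i.
Let row_set0 : g_sigma_preimage coord set0.
Proof. exact: sigma_algebra0. Qed.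
Let row_setC A : g_sigma_preimage coord A -> g_sigma_preimage coord (~` A).
Proof. exact: sigma_algebraC. Qed.
Let row_bigcup (F : (set _)^nat) : (forall i, g_sigma_preimage coord (F i)) ->
  g_sigma_preimage coord (\bigcup_i (F i)).
Proof. exact: sigma_algebra_bigcup. Qed.
HB.instance Definition _ := @isMeasurable.Build
  (measure_tuple_display default_measure_display) 'rV[R]_n
  (g_sigma_preimage coord) row_set0 row_setC row_bigcup.

Lemma measurable_coord (i : 'I_n) :
  measurable_fun [set: 'rV[R]_n] (coord i).
Proof.
move=> _ Y mY; rewrite setTI; apply: sub_sigma_algebra => /=.
rewrite -bigcup_seq/=; exists i => /=; first by rewrite mem_index_enum.
by exists Y => //; rewrite setTI.
Qed.

Lemma measurable_fun_coord d (T : measurableType d) (f : T -> 'rV[R]_n) :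
  (forall i, measurable_fun [set: T] (coord i \o f)) ->
  measurable_fun [set: T] f.
Proof.
move=> mf _ A mA; rewrite setTI.
have : g_sigma_preimage (fun i => coord i \o f) `<=` @measurable _ T.
  apply: smallest_sub; first exact: sigma_algebra_measurable.
  rewrite -bigcup_seq => B [i _ [C mC <-]]; exact: (mf i measurableT C mC).
apply; rewrite g_sigma_preimage_comp; exists A => //.
by rewrite setTI.
Qed.
End row_measurable.

Section lebesgue_row.
Variable R : realType.

Definition rcons0 n (p : measurableTypeR R * 'rV[R]_n) : 'rV[R]_(1 + n) :=
  row_mx (const_mx p.1) p.2.
Definition runcons n (x : 'rV[R]_(1 + n)) : measurableTypeR R * 'rV[R]_n :=
  (x 0 (lshift n 0), rsubmx x).

Lemma rcons0K n : cancel (@rcons0 n) (@runcons n).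
Proof.
by move=> [a v]; rewrite /runcons /rcons0 row_mxEl mxE row_mxKr. Qed.

Lemma measurable_rcons0 n : measurable_fun setT (@rcons0 n).
Proof.
apply: measurable_fun_coord => i.
case: (splitP i) => j ij.
- rewrite (_ : _ \o _ = fst); first exact: measurable_fst.
  apply/funext => p /=; rewrite /rcons0.
  by rewrite (_ : i = lshift n j) ?row_mxEl ?mxE//; exact/val_inj.
- rewrite (_ : _ \o _ = (fun x : 'rV[R]_n => x 0 j) \o snd).
    apply: measurableT_comp => //. exact: measurable_coord.
  apply/funext => p /=; rewrite /rcons0.
  by rewrite (_ : i = rshift 1 j) ?row_mxEr//; exact/val_inj.
Qed.

Lemma measurable_runcons n : measurable_fun setT (@runcons n).
Proof.
apply/measurable_fun_pairP; split; first exact: measurable_coord.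
apply: measurable_fun_coord => i.
rewrite (_ : _ \o _ = fun x : 'rV[R]_(1 + n) => x 0 (rshift 1 i)).
  exact: measurable_coord.
by apply/funext => x /=; rewrite mxE.
Qed.

Section step.
Variables (n : nat) (mu : {sigma_finite_measure set 'rV[R]_n -> \bar R}).
Definition leb_step : set 'rV[R]_(1 + n) -> \bar R :=
  pushforward (lebesgue_measure \x mu)%E (@rcons0 n).
HB.instance Definition _ := Measure.copy leb_step
  (measure_function_pushforward__canonical__measure_function_Measure
     (lebesgue_measure \x mu)%E (@measurable_rcons0 n)).
Lemma sigma_finite_step : sigma_finite setT leb_step.
Proof.
have /sigma_finiteP[F [TF ndF Foo]] := @sigma_finiteT _ _ _ (@lebesgue_measure R).
have /sigma_finiteP[G [TG ndG Goo]] := sigma_finiteT mu.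
exists (fun k => @runcons n @^-1` (F k `*` G k)) => [|k].
  rewrite -preimage_bigcup -[LHS](@preimage_setT _ _ (@runcons n)).
  congr (_ @^-1` _); rewrite -setXTT TF TG predeqE => -[x y]; split.
    move=> [/= [i _ Fnx] [j _ Gky]]; exists (maxn i j) => //; split.
    - by move: x Fnx; exact/subsetPset/ndF/leq_maxl.
    - by move: y Gky; exact/subsetPset/ndG/leq_maxr.
  by move=> [i _ []/= ? ?]; split; exists i.
have [mF Fk] := Foo k; have [mG Gk] := Goo k; split.
  rewrite -[X in measurable X]setTI; apply: measurable_runcons => //.
  exact: measurableX.
rewrite /leb_step /pushforward (_ : _ @^-1` _ = F k `*` G k).
  by rewrite product_measure1E// lte_mul_pinfty// ge0_fin_numE.
by rewrite -comp_preimage (_ : _ \o _ = id) ?preimage_id//; apply/funext/rcons0K.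
Qed.
HB.instance Definition _ := Measure_isSigmaFinite.Build _ _ _ leb_step
  sigma_finite_step.
End step.

(* Lebesgue measure on R^n; see leb_box below *)
Fixpoint leb n : {sigma_finite_measure set 'rV[R]_n -> \bar R} :=
  if n is k.+1 then leb_step (leb k) else dirac (0 : 'rV[R]_0).

Lemma rcons00 n p : (@rcons0 n p : 'rV[R]_n.+1) 0 ord0 = p.1.
Proof.
have -> : ord0 = lshift n (0 : 'I_1) :> 'I_(1 + n) by exact/val_inj.
exact: etrans (row_mxEl _ _ _ _) (mxE _ _ _ _).
Qed.

Lemma rcons0S n p i : (@rcons0 n p : 'rV[R]_n.+1) 0 (lift ord0 i) = p.2 0 i.
Proof.
have -> : lift ord0 i = rshift 1 i :> 'I_(1 + n) by exact/val_inj.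
exact: row_mxEr.
Qed.

Lemma leb_box n (a b : 'rV[R]_n) : (forall i, a 0 i <= b 0 i) ->
  leb n [set x : 'rV[R]_n | forall i, x 0 i \in `[a 0 i, b 0 i]] =
  (\prod_(i < n) (b 0 i - a 0 i))%:E.
Proof.
elim: n a b => [|n IH] a b ab.
  by rewrite big_ord0 /= diracE mem_set//= => -[].
pose a' : 'rV[R]_n := \row_i a 0 (lift ord0 i).
pose b' : 'rV[R]_n := \row_i b 0 (lift ord0 i).
transitivity ((lebesgue_measure \x leb n)%E (`[a 0 0, b 0 0]%classic `*`
   [set x : 'rV[R]_n | forall i, x 0 i \in `[a' 0 i, b' 0 i]])).
  congr ((lebesgue_measure \x leb n)%E _).
  apply/seteqP; split => [[x v] H|[x v] [/= xab vab] i]; first split.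
  - by have := H ord0; rewrite rcons00.
  - by move=> i; have := H (lift ord0 i); rewrite rcons0S !mxE.
  - case: (unliftP ord0 i) => [j ->|->]; last by rewrite rcons00.
    by rewrite rcons0S; have := vab j; rewrite !mxE.
rewrite product_measure1E//.
  rewrite IH; last by move=> i; rewrite !mxE.
  transitivity ((b 0 0 - a 0 0)%:E * (\prod_(i < n) (b' 0 i - a' 0 i))%:E)%E.
    congr (_ * _)%E.
    apply: etrans (lebesgue_measure_itv `[a 0 0, b 0 0]) _; rewrite /= lte_fin.
    have := ab 0; rewrite le_eqVlt => /predU1P[->|->]; last by rewrite -EFinD.
    by rewrite ltxx subrr.
  rewrite big_ord_recl -EFinM; congr (_ * _)%:E.
  by apply: eq_bigr => i _; rewrite !mxE.
rewrite [X in measurable X](_ : _ = \bigcap_(i in [set: 'I_n])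
  ((fun x : 'rV[R]_n => x 0 i : measurableTypeR R) @^-1` `[a' 0 i, b' 0 i]%classic)).
  apply: fin_bigcap_measurable => // i _.
  by rewrite -[X in measurable X]setTI; exact: measurable_coord.
by apply/seteqP; split => x /= xi i => [_|]; exact: xi.
Qed.
End lebesgue_row.

Section geometry.
Variables (R : realType) (d : nat).
Notation vec := 'rV[R]_d.

Definition dotv (x y : vec) : R := \sum_i x 0 i * y 0 i.
Definition enorm (x : vec) : R := Num.sqrt (dotv x x).
Definition diam (X : set vec) : R :=
  sup [set enorm (p.1 - p.2) | p in X `*` X].

(* A simplex is given by its set of vertices, a mesh by its set of simplices.  *)
Definition simplex := {fset vec}.
Definition mesh := {fset simplex}.
Implicit Types (S F : simplex) (T : mesh).

Definition conv S : set vec :=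
  [set x | exists c : vec -> R, [/\ forall v, v \in S -> 0 <= c v,
     \sum_(v <- S) c v = 1 & x = \sum_(v <- S) c v *: v]].

Definition affinely_independent S := forall c : vec -> R,
  \sum_(v <- S) c v = 0 -> \sum_(v <- S) c v *: v = 0 ->
  forall v, v \in S -> c v = 0.

Definition is_simplex S := #|` S| = d.+1 /\ affinely_independent S.

(* rhoS S is the diameter of the largest ball contained in S. *)
Definition hS S : R := diam (conv S).
Definition rhoS S : R :=
  sup [set 2 * r | r in [set r : R | 0 <= r /\
    exists x, [set y | enorm (y - x) <= r] `<=` conv S]].

Definition mesh_size T : R := \big[Num.max/0]_(S <- T) hS S.

Definition conforming_mesh (Om : set vec) T :=
  [/\ forall S, S \in T -> is_simplex S,
      forall S S', S \in T -> S' \in T ->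
        conv S `&` conv S' = conv (S `&` S')%fset &
      closure Om = [set x | exists2 S, S \in T & conv S x]].

Definition nested T T' := forall S', S' \in T' ->
  exists2 S, S \in T & conv S' `<=` conv S.

Definition bisect S S1 S2 := exists v w, [/\ v \in S, w \in S, v != w,
  S1 = ((2^-1 *: (v + w)) |` (S `\ v))%fset &
  S2 = ((2^-1 *: (v + w)) |` (S `\ w))%fset].

Inductive bisections T : mesh -> Prop :=
| Bisect0 : bisections T T
| BisectS T' S S1 S2 : bisections T T' -> S \in T' -> bisect S S1 S2 ->
    bisections T (S1 |` (S2 |` (T' `\ S)))%fset.

(* The interior faces contained in the boundary of S are the S `&` S' for S' *)
(* adjacent to S, since two elements of a conforming mesh with d common       *)
(* vertices are the two sides of the face spanned by these vertices.          *)
Definition adjacent S S' := (S' != S) && (#|` (S `&` S')%fset| == d).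

Definition outward_normal S F : vec :=
  xget 0 [set nu | [/\ enorm nu = 1,
    forall x y, x \in F -> y \in F -> dotv (x - y) nu = 0 &
    forall x y, x \in F -> y \in S -> y \notin F -> dotv (y - x) nu < 0]].

Definition unit_simplex n : set 'rV[R]_n :=
  [set t | (forall i, 0 <= t 0 i) /\ \sum_i t 0 i <= 1].

(* Integral over the (d-1)-dimensional simplex with vertices v_0,...,v_{d-1}, *)
(* parametrized by t |-> v_0 + t G over the unit simplex of R^(d-1), where    *)
(* the rows of G are the v_{i+1} - v_0; the surface element is                *)
(* sqrt (det (G G^T)).  When d = 1 this is the value at the point v_0.        *)
Definition face_integral F (g : vec -> R) : R :=
  let v i := nth 0 (F : seq vec) i in
  let G : 'M[R]_(d.-1, d) := \matrix_(i < d.-1) (v i.+1 - v 0%N) in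
  Num.sqrt (\det (G *m G^T)) *
  \int[leb R d.-1]_(t in @unit_simplex d.-1) g (v 0%N + t *m G).

(* For the open set Om: near each boundary point, Om is one side of the graph *)
(* of a Lipschitz function over the hyperplane orthogonal to e.               *)
Definition lipschitz_boundary (Om : set vec) :=
  forall x0, (closure Om `\` Om) x0 ->
  exists r e (gam : vec -> R) L, [/\ 0 < r, enorm e = 1,
    forall y z, `|gam y - gam z| <= L * enorm (y - z) &
    forall y, enorm (y - x0) < r ->
      (Om y <-> gam (y - dotv y e *: e) < dotv y e)].

Definition polytopic (Om : set vec) := exists T : mesh,
  (forall S, S \in T -> is_simplex S) /\
  closure Om = [set x | exists2 S, S \in T & conv S x].

Definition poly_fun m : set (vec -> R) :=
  [set p | exists c : {ffun 'I_d -> 'I_m.+1} -> R,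
    p = fun x : vec => \sum_(a : {ffun 'I_d -> 'I_m.+1} | (\sum_i a i <= m)%N)
                   c a * \prod_i x 0 i ^+ a i].

End geometry.

Section function_spaces.
Variables (R : realType) (d : nat).
Notation vec := 'rV[R]_d.
Variable Om : set vec.

Definition partial (i : 'I_d) (f : vec -> R) (x : vec) : R :=
  derive1 (fun t : R => f (x + t *: delta_mx 0 i)) 0.
Definition grad (f : vec -> R) (x : vec) : vec := \row_i partial i f x.

Definition smooth (f : vec -> R) := forall s : seq 'I_d,
  continuous (foldr partial f s) /\
  forall i x, derivable (fun t : R => foldr partial f s (x + t *: delta_mx 0 i))
                        0 1.

Definition test_function : set (vec -> R) :=
  [set f : vec -> R | [/\ smooth f, compact (closure [set x | f x != 0]) &
               closure [set x | f x != 0] `<=` Om]].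

Definition ip (D : set vec) (f g : vec -> R) : R :=
  \int[leb R d]_(x in D) (f x * g x).
Definition norm2 (D : set vec) (f : vec -> R) : R := Num.sqrt (ip D f f).
Definition L2 (D : set vec) : set (vec -> R) :=
  [set f : vec -> R | measurable_fun D f /\
           (leb R d).-integrable D (fun x => (f x ^+ 2)%:E)].

Definition ess_bounded (f : vec -> R) := measurable_fun Om f /\
  exists M, {ae leb R d, forall x, Om x -> `|f x| <= M}.

Definition weak_gradient (f : vec -> R) (g : vec -> vec) :=
  forall psi, test_function psi -> forall i,
  \int[leb R d]_(x in Om) (f x * partial i psi x) =
  - \int[leb R d]_(x in Om) (g x 0 i * psi x).

(* A Sobolev function is represented by the pair (u, weak gradient of u);    *)
(* pairs are not identified when they agree almost everywhere on Om.         *)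
Definition sob := ((vec -> R^o) * (vec -> vec))%type.
HB.instance Definition _ := GRing.Lmodule.on sob.

Definition H1 : set sob :=
  [set w : sob | [/\ L2 Om w.1, forall i, L2 Om (fun x => w.2 x 0 i) &
               weak_gradient w.1 w.2]].
Definition norm1 (w : sob) : R :=
  Num.sqrt (ip Om w.1 w.1 +
            \sum_i ip Om (fun x => w.2 x 0 i) (fun x => w.2 x 0 i)).
Definition H10 : set sob :=
  [set w : sob | H1 w /\ forall e : R, 0 < e -> exists2 psi, test_function psi &
                     norm1 (w - (psi, grad psi)) < e].

End function_spaces.

(* The boundary value problem.  coefdA i j is the weak gradient of the entry *)
(* a_ij of the matrix coefA.                                                 *)
Record pde (R : realType) (d : nat) := Pde {
  dom : set 'rV[R]_d;
  coefA : 'rV[R]_d -> 'M[R]_d;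
  coefdA : 'I_d -> 'I_d -> 'rV[R]_d -> 'rV[R]_d;
  coefphi : 'rV[R]_d -> R }.

Section problem.
Variables (R : realType) (d : nat) (P : pde R d).
Notation vec := 'rV[R]_d.
Notation sob := (sob R d).
Notation mesh := (mesh R d).
Notation simplex := (simplex R d).
Notation Om := (dom P).
Notation A := (coefA P).
Notation dA := (coefdA P).
Notation phi := (coefphi P).

(* The entries of A are in W^{1,oo}(Om); A denotes their continuous          *)
(* representative, which extends to closure Om since Om is Lipschitz.        *)
Record pde_ok : Prop := {
  dom_open : open Om;
  dom_connected : connected Om;
  dom_nonempty : Om !=set0;
  dom_bounded : exists r : R, forall x, Om x -> enorm x <= r;
  dom_polytopic : polytopic Om;
  dom_lipschitz : lipschitz_boundary Om;
  A_sym : forall x, Om x -> (A x)^T = A x;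
  A_pos : forall x (v : vec), Om x -> v != 0 -> 0 < dotv (v *m A x) v;
  A_continuous : forall i j, {within closure Om, continuous (fun x => A x i j)};
  A_bounded : forall i j, ess_bounded Om (fun x => A x i j);
  dA_gradient : forall i j, weak_gradient Om (fun x => A x i j) (dA i j);
  dA_bounded : forall i j l, ess_bounded Om (fun x => dA i j x 0 l);
  phi_ge0 : {ae leb R d, forall x, Om x -> 0 <= phi x};
  phi_bounded : ess_bounded Om phi }.

Definition V : set sob := H10 Om.
Definition form (u v : sob) : R :=
  \int[leb R d]_(x in Om)
    (dotv (u.2 x *m (A x)^T) (v.2 x) + phi x * u.1 x * v.1 x).
Definition norma (w : sob) : R := Num.sqrt (form w w).
Definition ip0 (u v : sob) : R := ip Om u.1 v.1.
Definition norm0 (w : sob) : R := norm2 Om w.1.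

Section finite_elements.
Variable m : nat.

Definition fe_space (T : mesh) : set sob :=
  [set w : sob | [/\ V w, continuous (w.1 : vec -> R),
     forall x, ~ Om x -> w.1 x = 0 &
     forall S, S \in T -> exists2 p, poly_fun m p &
       forall x, conv S x -> w.1 x = p x]].

(* The polynomial that coincides with v on S; it provides the derivatives of *)
(* v on the closed simplex S.                                                *)
Definition local_poly (v : vec -> R) (S : simplex) : vec -> R :=
  xget (cst 0) [set p | poly_fun m p /\ forall x, conv S x -> v x = p x].

(* S without its points on the boundary of Om, a null set where functions on *)
(* Om carry no information                                                   *)
Definition elt (S : simplex) : set vec := conv S `&` Om.

Definition Lelt (v : vec -> R) (S : simplex) (x : vec) : R :=
  let p := local_poly v S in
  - (\sum_i \sum_j (dA i j x 0 i * partial j p x +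
                    A x i j * partial i (partial j p) x)) + phi x * v x.

Definition residual (f v : vec -> R) (S : simplex) (x : vec) : R :=
  f x - Lelt v S x.

Definition jump (v : vec -> R) (S S' : simplex) (x : vec) : R :=
  - dotv (grad (local_poly v S) x *m (A x)^T)
         (outward_normal S (S `&` S')%fset)
  - dotv (grad (local_poly v S') x *m (A x)^T)
         (outward_normal S' (S `&` S')%fset).

Definition indicator2 (T : mesh) (f v : vec -> R) (S : simplex) : R :=
  hS S ^+ 2 * norm2 (elt S) (residual f v S) ^+ 2 +
  \sum_(S' <- T | adjacent S S') hS (S `&` S')%fset *
     face_integral (S `&` S')%fset (fun x => jump v S S' x ^+ 2).

(* eta_k (f, v; T') for T' a subset of T = T_k *)
Definition estimator (T T' : mesh) (f v : vec -> R) : R :=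
  Num.sqrt (\sum_(S <- T') indicator2 T f v S).

Section oscillation.
Variable q : nat.
Definition L2_proj (S : simplex) (g : vec -> R) : vec -> R :=
  xget (cst 0) [set p | poly_fun q p /\
    forall r, poly_fun q r -> ip (elt S) (g \- p) r = 0].
Definition osc (T : mesh) (g : simplex -> vec -> R) : R :=
  Num.sqrt (\sum_(S <- T)
    norm2 (elt S) (fun x => hS S * (g S x - L2_proj S (g S) x)) ^+ 2).
End oscillation.

End finite_elements.

Definition galerkin m (G : mesh -> sob -> sob) (T : mesh) := forall v, V v ->
  fe_space m T (G T v) /\ forall w, fe_space m T w -> form (v - G T v) w = 0.

Definition solution_operator (K : (vec -> R) -> sob) := forall f, L2 Om f ->
  V (K f) /\ forall v, V v -> form (K f) v = ip Om f v.1.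

(* lam i and uh i are the (i+1)-st eigenvalue and eigenfunction. *)
Record eigensystem (lam : nat -> R) (uh : nat -> sob) : Prop := {
  lam_gt0 : 0 < lam 0%N;
  lam_simple : lam 0%N < lam 1%N;
  lam_nondecreasing : forall i, lam i.+1 <= lam i.+2;
  uh_V : forall i, V (uh i);
  uh_orthonormal : forall i j, form (uh i) (uh j) = (i == j)%:R;
  uh_eigen : forall i v, V v -> form (uh i) v = lam i * ip0 (uh i) v;
  uh_complete : forall w, V w -> forall e : R, 0 < e ->
    exists n (c : nat -> R), norma (w - \sum_(i < n) c i *: uh i) < e }.

Definition eigenspace_of (mu : R) : set sob :=
  [set u : sob | V u /\ forall v, V v -> form u v = mu * ip0 u v].

Definition eigen_projection (mu : R) (E : sob -> sob) := forall v, V v ->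
  eigenspace_of mu (E v) /\
  forall w, eigenspace_of mu w -> form (v - E v) w = 0.

Definition piecewise_polynomial (u : vec -> R) :=
  exists (T : mesh) n, conforming_mesh Om T /\
  forall S, S \in T -> exists2 p, poly_fun n p &
    {ae leb R d, forall x, elt S x -> u x = p x}.

Definition eta_a (K : (vec -> R) -> sob) (W : set sob) : R :=
  sup [set inf [set norma (K f - v) | v in W] |
        f in [set f : vec -> R | L2 Om f /\ norm2 Om f = 1]].
Definition delta (mu : R) (W : set sob) : R :=
  sup [set inf [set norma (v - w) | w in W] |
        v in [set v : sob | eigenspace_of mu v /\ norma v = 1]].

Definition admissible (gs : R) (T : mesh) := conforming_mesh Om T /\
  forall S, S \in T -> hS S / rhoS S <= gs.

Definition refine_spec (gs : R) (REFINE : mesh -> mesh -> mesh -> Prop) :=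
  forall M T T' : mesh, admissible gs T -> (M `<=` T)%fset -> REFINE M T T' ->
  [/\ conforming_mesh Om T', bisections T T' & forall S, S \in M -> S \notin T'].

Definition esolve (W : set sob) (mu : R) (w : sob) :=
  [/\ W w, norma w = 1, forall v, W v -> form w v = mu * ip0 w v &
      forall mu' w', W w' -> norma w' = 1 ->
        (forall v, W v -> form w' v = mu' * ip0 w' v) -> mu <= mu'].

Definition lsolve (f : vec -> R) (W : set sob) (w : sob) :=
  W w /\ forall v, W v -> form w v = ip Om f v.1.

Definition mark m (theta : R) (f v : vec -> R) (T M : mesh) :=
  let enough M' := theta * estimator m T T f v <= estimator m T M' f v in
  [/\ (M `<=` T)%fset, enough M &
      forall M' : mesh, (M' `<=` T)%fset -> enough M' -> (#|` M| <= #|` M'|)%N].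

Definition add_span (W : set sob) (u : sob) : set sob :=
  [set w : sob | exists2 v, W v & exists c : R, w = v + c *: u].

(* The values computed by an execution: k is the level, j the index of the   *)
(* inner loop, l the index of the stage.  k and l start at 1, and the         *)
(* doubly indexed values are used for k >= 2 and j <= Jk k only.              *)
Record run := Run {
  meshH : mesh;
  Tk : nat -> mesh;
  Mk : nat -> mesh;
  Jk : nat -> nat;               (* value of j when the inner loop is left *)
  fj : nat -> nat -> sob;        (* \bar f_k^{(j)} *)
  ubarj : nat -> nat -> sob;     (* \bar u_k^{(j)} *)
  uj : nat -> nat -> sob;        (* u_k^{(j)} *)
  lamj : nat -> nat -> R;        (* \lambda_k^{(j)} *)
  utj : nat -> nat -> sob;       (* \tilde u_k^{(j)} *)
  lamtj : nat -> nat -> R;       (* \tilde\lambda_k^{(j)} *)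
  fk : nat -> sob;               (* \bar f_k *)
  ubark : nat -> sob;            (* \bar u_k *)
  uk : nat -> sob;
  lamk : nat -> R;
  utk : nat -> sob;              (* \tilde u_k *)
  lamtk : nat -> R;              (* \tilde\lambda_k *)
  ell : nat -> nat;              (* value of l when level k starts *)
  nl : nat -> nat;               (* n_l *)
  etal : nat -> R                (* the number \eta_l *) }.

Section algorithm.
Variables (m : nat) (gs theta1 theta2 : R).
Variable REFINE : mesh -> mesh -> mesh -> Prop.

Record algorithmC (r : run) : Prop := {
  alg_meshH : admissible gs (meshH r);
  alg_mesh : forall k, (1 <= k)%N -> admissible gs (Tk r k);
  alg_T1 : nested (meshH r) (Tk r 1);
  alg_u1 : esolve (fe_space m (Tk r 1)) (lamk r 1) (uk r 1);
  alg_f1 : fk r 1 = uk r 1;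
  alg_ubar1 : ubark r 1 = (lamk r 1)^-1 *: uk r 1;
  alg_ut1 : utk r 1 = uk r 1;
  alg_f2 : fj r 2 0 = uk r 1;
  alg_n1 : nl r 1 = 1%N;
  alg_ell2 : ell r 2 = 1%N;
  alg_eta1 : etal r 1 =
    estimator m (Tk r 1) (Tk r 1) (fk r 1).1 (ubark r 1).1;
  alg_mark : forall k, (2 <= k)%N ->
    mark m theta1 (fk r k.-1).1 (ubark r k.-1).1 (Tk r k.-1) (Mk r k.-1);
  alg_refine : forall k, (2 <= k)%N -> REFINE (Mk r k.-1) (Tk r k.-1) (Tk r k);
  alg_lsolve : forall k j, (2 <= k)%N -> (j <= Jk r k)%N ->
    [/\ lsolve (fj r k j).1 (fe_space m (Tk r k)) (ubarj r k j),
        uj r k j = (norma (ubarj r k j))^-1 *: ubarj r k j &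
        lamj r k j = form (uj r k j) (uj r k j) / ip0 (uj r k j) (uj r k j)];
  alg_continue : forall k j, (2 <= k)%N -> (j < Jk r k)%N ->
    [/\ estimator m (Tk r k) (Tk r k) (fj r k j).1 (ubarj r k j).1
          <= theta2 ^+ j.+1 * etal r (ell r k),
        esolve (add_span (fe_space m (meshH r)) (uj r k j))
          (lamtj r k j) (utj r k j) &
        fj r k j.+1 = utj r k j];
  alg_exit : forall k, (2 <= k)%N ->
    theta2 ^+ (Jk r k).+1 * etal r (ell r k) <
    estimator m (Tk r k) (Tk r k) (fj r k (Jk r k)).1 (ubarj r k (Jk r k)).1;
  alg_level : forall k, (2 <= k)%N ->
    [/\ fk r k = fj r k (Jk r k), ubark r k = ubarj r k (Jk r k),
        uk r k = uj r k (Jk r k) & lamk r k = lamj r k (Jk r k)];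
  alg_new_stage : forall k, (2 <= k)%N -> (0 < Jk r k)%N ->
    [/\ esolve (add_span (fe_space m (meshH r)) (uk r k))
          (lamtk r k) (utk r k),
        fj r k.+1 0 = utk r k,
        ell r k.+1 = (ell r k).+1,
        nl r (ell r k).+1 = k &
        etal r (ell r k).+1 =
          estimator m (Tk r k) (Tk r k) (fk r k).1 (ubark r k).1];
  alg_same_stage : forall k, (2 <= k)%N -> Jk r k = 0%N ->
    fj r k.+1 0 = uk r k /\ ell r k.+1 = ell r k }.

(* The spaces to which ESOLVE is applied: V_1, and, at the levels k = n_l    *)
(* (l >= 2), i.e. those with Jk r k > 0, the spaces V_H + span{u} with       *)
(* u = u_{n_l}^{(j)} or u = u_{n_l}.                                         *)
Definition esolve_space (r : run) (W : set sob) :=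
  [\/ W = fe_space m (Tk r 1),
      exists k j, [/\ (2 <= k)%N, (j < Jk r k)%N &
        W = add_span (fe_space m (meshH r)) (uj r k j)] |
      exists k, [/\ (2 <= k)%N, (0 < Jk r k)%N &
        W = add_span (fe_space m (meshH r)) (uk r k)]].

End algorithm.

End problem.

(* Main.v *)
Require Import Defs.
Set Warnings "-notation-overridden,-ambiguous-paths,-notation-incompatible-prefix".
Set Warnings "-redundant-canonical-projection".
From HB Require Import structures.
From mathcomp Require Import all_boot all_order all_algebra finmap.
From mathcomp Require Import all_classical all_reals all_analysis.
From mathcomp Require Import measurable_realfun ring lra.
Import Order.TTheory GRing.Theory Num.Theory.
Import numFieldNormedType.Exports.
Local Open Scope classical_set_scope.
Local Open Scope ring_scope.
(** Let z be the first eigenfunction with a(z, z) = 1, and split f in V as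
    f = c z + rest with c = a(f, z).  The algorithm is an inexact inverse
    iteration: from the data f it computes the Galerkin solution u of
    a(u, .) = (f, .), normalizes it, and now and then replaces it by the
    solution of an eigenvalue problem on V_H + span u.  All errors below are
    divided by |c|, which makes them insensitive to normalizations and to the
    sign of the computed eigenfunctions.

    The exact solution K f of the source problem is (c / lam) z plus the
    solution for the rest, and K is bounded from L2 to the energy space.  So
    the energy error of u is at most lam times the discretization error
    |K f - u| plus a multiple of the L2 norm of the rest of f (step_rel_rest_a).
    These two terms are handled separately.

    - The discretization error is part of the quasi-error
      Q_k(f)^2 = |K f - R_k K f|^2 + gam eta_k(f)^2, which is multiplied by
      ahat when the mesh is refined and f is kept.  It is a seminorm in f
      (quasi_err_lin), and on V_k it is bounded by the L2 norm of f, because the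
      estimator is efficient and the oscillation of a finite element function
      is controlled by its energy (quasi_err_inv).  After division by |c|, old
      and new data differ by their rests only.  If these are a small multiple of
      the quasi-error, the factor ahat grows to alpha at most
      (contraction_step).

    - The rests are small in L2.  The rest of the solution w of an eigenvalue
      problem on V_H + span u is at most eta_a(V_H) times the energy error of u,
      up to a constant (out_rel), and a source problem multiplies the rest by
      about lam / lam2 < 1 and adds eta_a(V_H) times the discretization error
      (solve_rel).  Hence a rest of size tau eta_l at the beginning of a stage
      keeps this size during the stage.  A stage lasts until the estimator drops
      below theta2 eta_l, so that tau eta_l stays a small multiple of the
      estimator; and every further drop by theta2 triggers an eigenvalue problem,
      which makes the rest drop by theta2 as well (inner_inv).

    Together these facts form the invariant run_inv, and iterate_rest_decay
    follows from it.  The mesh size H enters through eta_a(V_H) and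
    delta(V_H) alone, and small_parameters_exist says how small they must be.
    The eigenvalue error is quadratic in the energy error (rayleigh_error).

    The iteration is studied in a vector space with two semi-inner products.
    To apply the result one needs that H^1_0 is a vector space on which the energy
    and mass forms are semi-inner products, the spectral gap
    (spectral_gap), and that the estimator is a seminorm in the data
    (estimator_lin).  The latter rests on uniqueness: a polynomial is determined
    by its values on a simplex (polyf_eq0_simplex), and the pointwise values of a
    Galerkin solution are determined by its data (galerkin_fun_unique). *)

Set Implicit Arguments.
Unset Strict Implicit.
Unset Printing Implicit Defensive.

(** * Squares of seminorms and semi-inner products *)

Section young.
Variable R : realType.
Implicit Types p q r t x y z : R.

(** Young inequality for squares, in all weights t at once.  This form passes
    to weighted sums, and optimizing t at the end gives the triangle
    inequality of the square roots: Minkowski inequality for a quantity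
    assembled from many squared seminorms. *)
Definition young p q r := forall t, 0 < t -> r <= (1 + t) * p + (1 + t^-1) * q.

Lemma young_sqr x y z : 0 <= z <= x + y -> young (x ^+ 2) (y ^+ 2) (z ^+ 2).
Proof.
move=> /andP[z0 zxy] t t0.
have xy0 : 0 <= x + y by exact: le_trans zxy.
apply: (@le_trans _ _ ((x + y) ^+ 2)); first by rewrite ler_sqr ?nnegrE.
have : 0 <= t^-1 * (t * x - y) ^+ 2 by rewrite mulr_ge0 ?sqr_ge0// invr_ge0 ltW.
have -> : t^-1 * (t * x - y) ^+ 2 = t * x ^+ 2 - 2 * x * y + t^-1 * y ^+ 2.
  by field; rewrite gt_eqF.
lra.
Qed.

Lemma youngD p q r p' q' r' :
  young p q r -> young p' q' r' -> young (p + p') (q + q') (r + r').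
Proof. by move=> h h' t t0; have := h t t0; have := h' t t0; lra. Qed.

Lemma youngM c p q r : 0 <= c -> young p q r -> young (c * p) (c * q) (c * r).
Proof.
move=> c0 h t t0; rewrite (mulrCA _ c p) (mulrCA _ c q) -mulrDr.
exact: ler_wpM2l (h t t0).
Qed.

Lemma young_sum (I : eqType) (s : seq I) (Q : pred I) (p q r : I -> R) :
  (forall i, i \in s -> Q i -> young (p i) (q i) (r i)) ->
  young (\sum_(i <- s | Q i) p i) (\sum_(i <- s | Q i) q i)
        (\sum_(i <- s | Q i) r i).
Proof.
elim: s => [|i s IH] h; first by rewrite !big_nil => t _; rewrite !mulr0 addr0.
have hs j : j \in s -> Q j -> young (p j) (q j) (r j).
  by move=> js; apply: h; rewrite in_cons js orbT.
rewrite !big_cons; case: ifP => [Qi|_]; last exact: IH.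
by apply: youngD; [apply: h; rewrite ?mem_head|exact: IH].
Qed.

(** The best weight is t = sqrt q / sqrt p.  If p or q vanishes, t tends to an
    end of the half-line instead, whence the two limiting arguments. *)
Lemma young_sqrt p q r : 0 <= p -> 0 <= q -> young p q r ->
  Num.sqrt r <= Num.sqrt p + Num.sqrt q.
Proof.
move=> p0 q0 h.
have pq0 : 0 <= Num.sqrt p + Num.sqrt q by rewrite addr_ge0 ?sqrtr_ge0.
suff rpq : r <= (Num.sqrt p + Num.sqrt q) ^+ 2.
  by apply: le_trans (ler_wsqrtr rpq) _; rewrite sqrtr_sqr ger0_norm.
move: p0 q0; rewrite [0 <= p]le_eqVlt [0 <= q]le_eqVlt => /predU1P[p0|p0] /predU1P[q0|q0].
- by have := h 1 ltr01; rewrite -p0 -q0 sqrtr0 !mulr0 !addr0 expr0n.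
- rewrite -p0 sqrtr0 add0r (sqr_sqrtr (ltW q0)); apply/ler_addgt0Pr => e e0.
  have := h (q / e) (divr_gt0 q0 e0); rewrite -p0 mulr0 add0r invf_div.
  by rewrite mulrDl mul1r divfK ?gt_eqF.
- rewrite -q0 sqrtr0 addr0 (sqr_sqrtr (ltW p0)); apply/ler_addgt0Pr => e e0.
  have := h (e / p) (divr_gt0 e0 p0); rewrite -q0 mulr0 addr0.
  by rewrite mulrDl mul1r divfK ?gt_eqF.
- have sp : 0 < Num.sqrt p by rewrite sqrtr_gt0.
  have sq : 0 < Num.sqrt q by rewrite sqrtr_gt0.
  have := h (Num.sqrt q / Num.sqrt p) (divr_gt0 sq sp).
  rewrite -{2}(sqr_sqrtr (ltW p0)) -{3}(sqr_sqrtr (ltW q0)).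
  suff -> : (Num.sqrt p + Num.sqrt q) ^+ 2 =
    (1 + Num.sqrt q / Num.sqrt p) * Num.sqrt p ^+ 2 +
    (1 + (Num.sqrt q / Num.sqrt p)^-1) * Num.sqrt q ^+ 2 by [].
  by field; rewrite !gt_eqF.
Qed.

End young.

Section semi_inner_product.
Variables (R : realType) (X : lmodType R).
Implicit Types (V : set X) (a : X -> X -> R) (u v w : X) (c : R).

Definition linear_subspace V :=
  V 0 /\ forall c u v, V u -> V v -> V (c *: u + v).

(** A Sobolev function is a pair that may be changed on a null set without
    changing any integral, so the forms are only semidefinite and identities
    between functions hold up to null vectors. *)
Record semi_inner V a : Prop := {
  semi_inner_sub : linear_subspace V;
  semi_inner_lin : forall c u v w, V u -> V v -> V w ->
    a (c *: u + v) w = c * a u w + a v w;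
  semi_innerC : forall u v, V u -> V v -> a u v = a v u;
  semi_inner_ge0 : forall u, V u -> 0 <= a u u }.

Definition snorm a u := Num.sqrt (a u u).

Lemma subspaceD V u v : linear_subspace V -> V u -> V v -> V (u + v).
Proof. by move=> [_ h] Vu Vv; rewrite -[u]scale1r; exact: h. Qed.
Lemma subspaceZ V c u : linear_subspace V -> V u -> V (c *: u).
Proof. by move=> [V0 h] Vu; rewrite -[_ *: _]addr0; exact: h. Qed.
Lemma subspaceB V u v : linear_subspace V -> V u -> V v -> V (u - v).
Proof.
move=> sV Vu Vv; apply: subspaceD => //; rewrite -scaleN1r; exact: subspaceZ.
Qed.
Lemma subspace_sum V (I : Type) (s : seq I) (Q : pred I) (f : I -> X) :
  linear_subspace V -> (forall i, Q i -> V (f i)) -> V (\sum_(i <- s | Q i) f i).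
Proof.
move=> sV Vf; elim/big_ind: _ => //; first by case: sV.
by move=> x y; exact: subspaceD.
Qed.

Variables (V : set X) (a : X -> X -> R) (aV : semi_inner V a).
Let sV := semi_inner_sub aV.

Lemma sipDl u v w : V u -> V v -> V w -> a (u + v) w = a u w + a v w.
Proof.
by move=> *; rewrite -[u]scale1r (semi_inner_lin aV)// mul1r scale1r. Qed.

Lemma sip0l v : V v -> a 0 v = 0.
Proof.
move=> Vv; have V0 := sV.1.
by have := sipDl V0 V0 Vv; rewrite addr0 => /eqP; rewrite -subr_eq0 opprD addrA
  subrr sub0r oppr_eq0 => /eqP.
Qed.

Lemma sipZl c u v : V u -> V v -> a (c *: u) v = c * a u v.
Proof.
move=> Vu Vv; have V0 := sV.1.
by rewrite -[c *: u]addr0 (semi_inner_lin aV)// sip0l// addr0. Qed.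

Lemma sipBl u v w : V u -> V v -> V w -> a (u - v) w = a u w - a v w.
Proof.
move=> Vu Vv Vw; rewrite -scaleN1r sipDl ?sipZl ?mulN1r//; exact: subspaceZ.
Qed.

Lemma sipDr u v w : V u -> V v -> V w -> a w (u + v) = a w u + a w v.
Proof.
move=> Vu Vv Vw; have ? := subspaceD sV Vu Vv.
by rewrite (semi_innerC aV Vw)// sipDl// !(semi_innerC aV Vw).
Qed.

Lemma sipZr c u v : V u -> V v -> a v (c *: u) = c * a v u.
Proof.
move=> Vu Vv; have ? := subspaceZ c sV Vu.
by rewrite (semi_innerC aV Vv)// sipZl// (semi_innerC aV Vv).
Qed.

Lemma sipBr u v w : V u -> V v -> V w -> a w (u - v) = a w u - a w v.
Proof.
move=> Vu Vv Vw; have ? := subspaceB sV Vu Vv.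
by rewrite (semi_innerC aV Vw)// sipBl// !(semi_innerC aV Vw).
Qed.

Lemma sip_sqrZD c u v : V u -> V v ->
  a (c *: u + v) (c *: u + v) = c ^+ 2 * a u u + 2 * c * a u v + a v v.
Proof.
move=> Vu Vv; have Vcu := subspaceZ c sV Vu; have Vs := subspaceD sV Vcu Vv.
rewrite sipDl// !sipDr// !sipZl// !sipZr// (semi_innerC aV Vv Vu); ring.
Qed.

Lemma snorm_ge0 u : 0 <= snorm a u. Proof. exact: sqrtr_ge0. Qed.

Lemma snorm_sqr u : V u -> snorm a u ^+ 2 = a u u.
Proof. by move=> Vu; rewrite sqr_sqrtr// (semi_inner_ge0 aV). Qed.

Lemma snormZ c u : V u -> snorm a (c *: u) = `|c| * snorm a u.
Proof.
move=> Vu; have ? := subspaceZ c sV Vu.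
by rewrite /snorm sipZl// sipZr// mulrA -expr2 sqrtrM ?sqr_ge0// sqrtr_sqr.
Qed.

Lemma snorm0 : snorm a 0 = 0.
Proof. by rewrite /snorm sip0l ?sqrtr0//; case: sV. Qed.

Lemma sip_cauchy_schwarz u v : V u -> V v -> `|a u v| <= snorm a u * snorm a v.
Proof.
move=> Vu Vv.
have quad t : 0 <= a u u - 2 * t * a u v + t ^+ 2 * a v v.
  have Vtv := subspaceZ t sV Vv.
  have := semi_inner_ge0 aV (subspaceB sV Vu Vtv).
  have Vutv := subspaceB sV Vu Vtv.
  by rewrite sipBl// !sipBr// !sipZl// !sipZr// (semi_innerC aV Vv Vu); lra.
rewrite -[leLHS]ger0_norm// -[leRHS]ger0_norm; last by rewrite mulr_ge0 ?snorm_ge0.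
rewrite -ler_sqr ?nnegrE// !real_normK ?num_real// exprMn !snorm_sqr//.
have [avv0|avv0] := eqVneq (a v v) 0.
  have [->|auv0] := eqVneq (a u v) 0; first by rewrite expr0n avv0 mulr0.
  have := quad ((a u u + 1) / (2 * a u v)); rewrite avv0 mulr0 addr0.
  have -> : 2 * ((a u u + 1) / (2 * a u v)) * a u v = a u u + 1 by field.
  lra.
have avvp : 0 < a v v by rewrite lt0r avv0 (semi_inner_ge0 aV).
have := quad (a u v / a v v).
have -> : a u u - 2 * (a u v / a v v) * a u v + (a u v / a v v) ^+ 2 * a v v =
  (a u u * a v v - a u v ^+ 2) / a v v by field.
by rewrite pmulr_lge0 ?invr_gt0// subr_ge0.
Qed.

Lemma snormD u v : V u -> V v -> snorm a (u + v) <= snorm a u + snorm a v.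
Proof.
move=> Vu Vv; have Vuv := subspaceD sV Vu Vv.
rewrite -[leLHS]ger0_norm ?snorm_ge0// -[leRHS]ger0_norm; last first.
  by rewrite addr_ge0 ?snorm_ge0.
rewrite -ler_sqr ?nnegrE// !real_normK ?num_real// sqrrD !snorm_sqr//.
rewrite sipDl// !sipDr// (semi_innerC aV Vv Vu).
have := ler_norm (a u v); have := sip_cauchy_schwarz Vu Vv; lra.
Qed.

Lemma snormN u : V u -> snorm a (- u) = snorm a u.
Proof. by move=> Vu; rewrite -scaleN1r snormZ// normrN1 mul1r. Qed.

Lemma snormB u v : V u -> V v -> snorm a (u - v) <= snorm a u + snorm a v.
Proof.
move=> Vu Vv; rewrite -[snorm a v]snormN//; apply: snormD => //.
by rewrite -scaleN1r; exact: subspaceZ.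
Qed.

(** The tool for replacing a vector by another one that agrees with it up to a
    null vector. *)
Lemma snorm_add_null u v : V u -> V v -> snorm a v = 0 ->
  snorm a (u + v) = snorm a u.
Proof.
move=> Vu Vv v0; apply/eqP; rewrite eq_le; apply/andP; split.
  by apply: le_trans (snormD Vu Vv) _; rewrite v0 addr0.
have Vuv := subspaceD sV Vu Vv.
have -> : snorm a u = snorm a (u + v - v) by rewrite addrK.
by apply: le_trans (snormB Vuv Vv) _; rewrite v0 addr0.
Qed.

End semi_inner_product.

(** * One step of inverse iteration *)

(** The form a is the energy, b the L2 product, and K the solution operator.
    The second eigenvalue lam2 is present through its Rayleigh quotient on the
    a-orthogonal complement of z. *)
Record spectral_setting (R : realType) (X : lmodType R) (V : set X)
    (a b : X -> X -> R) (z : X) (lam lam2 : R) (K : X -> X) : Prop := {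
  spec_form : semi_inner V a;
  spec_mass : semi_inner V b;
  spec_eigvec : V z;
  spec_unit : a z z = 1;
  spec_eigen : forall v, V v -> a z v = lam * b z v;
  spec_gt0 : 0 < lam;
  spec_lt : lam < lam2;
  spec_gap : forall v, V v -> a v z = 0 -> lam2 * b v v <= a v v;
  spec_sol : forall f, V f -> V (K f);
  spec_solE : forall f v, V f -> V v -> a (K f) v = b f v }.

Section inverse_iteration.
Variables (R : realType) (X : lmodType R) (V : set X) (a b : X -> X -> R).
Variables (z : X) (lam lam2 : R) (K : X -> X).

Definition eig_coef f := a f z.
Definition eig_rest f := f - eig_coef f *: z.
(** Division by the coefficient makes this size of the component off z
    invariant under scaling. *)
Definition rel_rest f := snorm b (eig_rest f) / `|eig_coef f|.
(** The norm of the embedding of the energy space into L2, and by duality of K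
    from L2 into the energy space. *)
Definition embed_norm : R := (Num.sqrt lam)^-1.
Definition galerkin_sol (W : set X) f u := W u /\ forall v, W v -> a u v = b f v.

Hypothesis S : spectral_setting V a b z lam lam2 K.
Let aV := spec_form S.
Let bV := spec_mass S.
Let Vz := spec_eigvec S.
Let az := spec_unit S.
Let z_eigen := spec_eigen S.
Let lam_gt0 := spec_gt0 S.
Let lam_lt := spec_lt S.
Let gap := spec_gap S.
Let VK := spec_sol S.
Let KE := spec_solE S.

Local Notation na := (snorm a).
Local Notation nb := (snorm b).
Let sV := semi_inner_sub aV.
Implicit Types (f g u v w y : X).

Local Notation cf := eig_coef.
Local Notation pe := eig_rest.
Lemma embed_norm_gt0 : 0 < embed_norm. Proof. by rewrite invr_gt0 sqrtr_gt0. Qed.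
Lemma embed_norm_sqr : embed_norm ^+ 2 = lam^-1.
Proof. by rewrite exprVn sqr_sqrtr// ltW. Qed.
Lemma lam2_gt0 : 0 < lam2. Proof. exact: lt_trans lam_lt. Qed.

Lemma V_pe f : V f -> V (pe f).
Proof. by move=> Vf; apply: subspaceB => //; exact: subspaceZ. Qed.

Lemma bz v : V v -> b v z = cf v / lam.
Proof.
move=> Vv; rewrite /cf (semi_innerC aV)// z_eigen// (semi_innerC bV)//.
by rewrite mulrAC divff ?mul1r// gt_eqF.
Qed.

Lemma cfz : cf z = 1. Proof. exact: az. Qed.

Lemma cfZ c f : V f -> cf (c *: f) = c * cf f.
Proof. by move=> Vf; rewrite /cf (sipZl aV). Qed.

Lemma cfB f g : V f -> V g -> cf (f - g) = cf f - cf g.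
Proof. by move=> Vf Vg; rewrite /cf (sipBl aV). Qed.

Lemma cf_pe f : V f -> cf (pe f) = 0.
Proof.
move=> Vf; rewrite /pe cfB//; last exact: subspaceZ.
by rewrite cfZ// cfz mulr1 subrr.
Qed.

Lemma peZ c f : V f -> pe (c *: f) = c *: pe f.
Proof. by move=> Vf; rewrite /pe cfZ// scalerBr scalerA. Qed.

Lemma peB f g : V f -> V g -> pe (f - g) = pe f - pe g.
Proof. by move=> Vf Vg; rewrite /pe cfB// scalerBl opprD addrACA -opprD. Qed.

Lemma na_split f : V f -> na f ^+ 2 = cf f ^+ 2 + na (pe f) ^+ 2.
Proof.
move=> Vf; have Vp := V_pe Vf; have Vcz := subspaceZ (cf f) sV Vz.
rewrite !(snorm_sqr aV)//.
have {1 2}-> : f = cf f *: z + pe f by rewrite addrC subrK.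
rewrite (sip_sqrZD aV)// az (semi_innerC aV Vz Vp) -[a (pe f) z]/(cf (pe f)) cf_pe//.
ring.
Qed.

Lemma nb_split f : V f -> nb f ^+ 2 = cf f ^+ 2 / lam + nb (pe f) ^+ 2.
Proof.
move=> Vf; have Vp := V_pe Vf; have Vcz := subspaceZ (cf f) sV Vz.
rewrite !(snorm_sqr bV)//.
have {1 2}-> : f = cf f *: z + pe f by rewrite addrC subrK.
rewrite (sip_sqrZD bV)// (semi_innerC bV Vz Vp) !bz// cf_pe// cfz.
ring.
Qed.

Lemma na_pe_le f : V f -> na (pe f) <= na f.
Proof.
move=> Vf; rewrite -ler_sqr ?nnegrE ?snorm_ge0// (na_split Vf).
by rewrite lerDr sqr_ge0.
Qed.

Lemma nb_pe_le f : V f -> nb (pe f) <= nb f.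
Proof.
move=> Vf; rewrite -ler_sqr ?nnegrE ?snorm_ge0// (nb_split Vf).
by rewrite lerDr divr_ge0 ?sqr_ge0 ?ltW.
Qed.

Lemma cf_le f : V f -> `|cf f| <= na f.
Proof.
move=> Vf; rewrite -ler_sqr ?nnegrE ?snorm_ge0// (na_split Vf).
by rewrite real_normK ?num_real// lerDl sqr_ge0.
Qed.

Lemma gap_pe f : V f -> lam2 * nb (pe f) ^+ 2 <= na (pe f) ^+ 2.
Proof.
move=> Vf; have Vp := V_pe Vf; rewrite (snorm_sqr aV)// (snorm_sqr bV)//.
by apply: gap => //; exact: cf_pe.
Qed.

Lemma lam_nb_le f : V f -> lam * nb f ^+ 2 <= na f ^+ 2.
Proof.
move=> Vf; rewrite (na_split Vf) (nb_split Vf) mulrDr mulrCA divff ?gt_eqF//.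
rewrite mulr1 lerD2l; apply: le_trans (gap_pe Vf).
by rewrite ler_wpM2r ?sqr_ge0// ltW.
Qed.

Lemma nb_le f : V f -> nb f <= embed_norm * na f.
Proof.
move=> Vf; have e0 := ltW embed_norm_gt0.
rewrite -ler_sqr ?nnegrE ?mulr_ge0 ?snorm_ge0// exprMn embed_norm_sqr.
by rewrite mulrC ler_pdivlMr// mulrC lam_nb_le.
Qed.

Lemma nbz : nb z = embed_norm.
Proof. by rewrite /snorm bz// cfz mul1r sqrtrV// ltW. Qed.

Lemma naz : na z = 1. Proof. by rewrite /snorm az sqrtr1. Qed.

Lemma K_rest f : V f -> K f - (cf f / lam) *: z = pe (K f).
Proof. by move=> Vf; rewrite /pe [cf (K f)]KE// bz. Qed.

Lemma cf_K f : V f -> cf (K f) = cf f / lam.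
Proof. by move=> Vf; rewrite /cf KE// bz. Qed.

(** K maps the complement of z into itself, so the rest of K f solves the
    source problem for the rest of f; test that problem with its own solution.
    *)
Lemma pe_K_form f : V f -> na (pe (K f)) ^+ 2 <= nb (pe f) * nb (pe (K f)).
Proof.
move=> Vf; have VKf := VK Vf; have Vp := V_pe Vf; have Vy := V_pe VKf.
have Vcz := subspaceZ (cf (K f)) sV Vz; have Vcz' := subspaceZ (cf f) sV Vz.
have cy : a z (pe (K f)) = 0.
  by rewrite (semi_innerC aV)// [LHS]cf_pe.
have by0 : b z (pe (K f)) = 0.
  by rewrite (semi_innerC bV)// bz// cf_pe// mul0r.
have -> : na (pe (K f)) ^+ 2 = b (pe f) (pe (K f)).
  rewrite (snorm_sqr aV)// {1}/pe (sipBl aV)// (sipZl aV)// cy mulr0 subr0 KE//.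
  by rewrite [in RHS]/pe (sipBl bV)// (sipZl bV)// by0 mulr0 subr0.
exact: le_trans (ler_norm _) (sip_cauchy_schwarz bV Vp Vy).
Qed.

Lemma na_pe_K f : V f -> na (pe (K f)) <= embed_norm * nb (pe f).
Proof.
move=> Vf; have h := pe_K_form Vf; have Vy := V_pe (VK Vf).
have [->|y0] := eqVneq (na (pe (K f))) 0.
  by rewrite mulr_ge0 ?snorm_ge0 ?ltW ?embed_norm_gt0.
have yp : 0 < na (pe (K f)) by rewrite lt0r y0 snorm_ge0.
rewrite -(ler_pM2r yp) -expr2 (le_trans h)// [leRHS]mulrAC [leRHS]mulrC.
by rewrite ler_wpM2l ?snorm_ge0// nb_le.
Qed.

(** The factor is 1 / lam2, while the coefficient on z is multiplied by 1 /
    lam: this is why inverse iteration turns towards z. *)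
Lemma nb_pe_K f : V f -> nb (pe (K f)) <= nb (pe f) / lam2.
Proof.
move=> Vf; have h := pe_K_form Vf; have Vy := V_pe (VK Vf).
have [->|y0] := eqVneq (nb (pe (K f))) 0.
  by rewrite divr_ge0 ?snorm_ge0 ?ltW ?lam2_gt0.
have yp : 0 < nb (pe (K f)) by rewrite lt0r y0 snorm_ge0.
rewrite ler_pdivlMr ?lam2_gt0// -(ler_pM2r yp) (le_trans _ h)//.
rewrite mulrAC -expr2 mulrC; exact: gap_pe (VK Vf).
Qed.

Lemma na_K f : V f -> na (K f) <= embed_norm * nb f.
Proof.
move=> Vf; have VKf := VK Vf.
have [->|y0] := eqVneq (na (K f)) 0.
  by rewrite mulr_ge0 ?snorm_ge0 ?ltW ?embed_norm_gt0.
have yp : 0 < na (K f) by rewrite lt0r y0 snorm_ge0.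
rewrite -(ler_pM2r yp) -expr2 (snorm_sqr aV)// KE// mulrAC mulrC.
apply: le_trans (ler_norm _) (le_trans (sip_cauchy_schwarz bV Vf VKf) _).
by rewrite ler_wpM2l ?snorm_ge0// nb_le.
Qed.

Lemma na_K_le f : V f -> cf f != 0 ->
  na (K f) <= `|cf f| * (lam^-1 + embed_norm * rel_rest f).
Proof.
move=> Vf c0.
have VKf := VK Vf.
have {1}-> : K f = cf (K f) *: z + pe (K f) by rewrite addrC subrK.
apply: le_trans (snormD aV _ _) _; [exact: subspaceZ|exact: V_pe|].
rewrite (snormZ aV)// naz mulr1 cf_K// normrM.
rewrite (gtr0_norm (_ : 0 < lam^-1)) ?invr_gt0// mulrDr lerD2l.
rewrite (le_trans (na_pe_K Vf))// mulrCA /rel_rest [ `|_| * _]mulrC divfK//.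
by rewrite normr_eq0.
Qed.

Section one_step.
Variables (W : set X).
Hypotheses (WV : W `<=` V) (sW : linear_subspace W).

Lemma galerkin_orth f u v : V f -> galerkin_sol W f u -> W v -> a (K f - u) v = 0.
Proof.
move=> Vf [Wu uE] Wv.
by rewrite (sipBl aV) ?KE ?uE ?subrr//; [exact: WV|exact: VK|exact: WV|exact: WV].
Qed.

Lemma galerkin_pythagoras f u w : V f -> galerkin_sol W f u -> W w ->
  na (K f - w) ^+ 2 = na (K f - u) ^+ 2 + na (u - w) ^+ 2.
Proof.
move=> Vf uP Ww; have [Wu _] := uP.
have Wuw := subspaceB sW Wu Ww; have Vu := WV Wu; have Vw := WV Ww.
have Vuw := WV Wuw; have VKf := VK Vf; have VKu := subspaceB sV VKf Vu.
rewrite !(snorm_sqr aV)//; last exact: subspaceB.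
have {1 2}-> : K f - w = 1 *: (K f - u) + (u - w).
  by rewrite scale1r addrA subrK.
by rewrite (sip_sqrZD aV)// (galerkin_orth Vf uP Wuw) mulr0 addr0 expr1n mul1r.
Qed.

Lemma galerkin_best f u w : V f -> galerkin_sol W f u -> W w ->
  na (K f - u) <= na (K f - w).
Proof.
move=> Vf uP Ww; rewrite -ler_sqr ?nnegrE ?snorm_ge0//.
by rewrite (galerkin_pythagoras Vf uP Ww) lerDl sqr_ge0.
Qed.

Lemma galerkin_unique f u w : V f -> galerkin_sol W f u -> galerkin_sol W f w ->
  na (K f - u) = na (K f - w).
Proof.
by move=> Vf uP wP; apply/eqP; rewrite eq_le !galerkin_best//; [case: uP|case: wP].
Qed.

Variables (f U : X) (eps : R).
Hypotheses (Vf : V f) (UP : galerkin_sol W f U).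
Hypothesis duality : nb (K f - U) <= eps * na (K f - U).
Local Notation err := (na (K f - U)).
Let VU : V U := WV UP.1.
Let VKf := VK Vf.
Let VKU : V (K f - U) := subspaceB sV VKf VU.

(** Since z is an eigenvector, the coefficient of K f - U is lam times an L2
    product with z, and in L2 the discretization error carries the small
    factor eps. *)
Lemma step_coef : `|lam * cf U - cf f| <= lam ^+ 2 * embed_norm * (eps * err).
Proof.
have -> : lam * cf U - cf f = - (lam ^+ 2 * b (K f - U) z).
  rewrite bz// cfB// cf_K//.
  by field; rewrite gt_eqF.
rewrite normrN normrM ger0_norm ?sqr_ge0// -mulrA ler_wpM2l ?sqr_ge0//.
apply: le_trans (sip_cauchy_schwarz bV VKU Vz) _.
by rewrite nbz mulrC ler_wpM2l// ltW// embed_norm_gt0.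
Qed.

Let peU : pe U = pe (K f) - pe (K f - U).
Proof. by rewrite peB// subKr. Qed.

Lemma step_rest_b : nb (pe U) <= nb (pe f) / lam2 + eps * err.
Proof.
rewrite peU; apply: le_trans (snormB bV (V_pe VKf) (V_pe VKU)) _.
rewrite lerD ?nb_pe_K//; exact: le_trans (nb_pe_le VKU) _.
Qed.

Lemma step_rest_a : na (pe U) <= embed_norm * nb (pe f) + err.
Proof.
rewrite peU; apply: le_trans (snormB aV (V_pe VKf) (V_pe VKU)) _.
by rewrite lerD ?na_pe_K ?na_pe_le.
Qed.

Hypothesis cf0 : cf f != 0.

(** The multiple lam / cf f brings the coefficient of U on z close to 1. *)
Lemma step_angle : na (z - (lam / cf f) *: U) <= lam * (err / `|cf f| + embed_norm * rel_rest f).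
Proof.
have cl : cf f / lam != 0 by rewrite mulf_neq0// invr_eq0 gt_eqF.
have -> : z - (lam / cf f) *: U = (lam / cf f) *: ((K f - U) - pe (K f)).
  have -> : K f - U - pe (K f) = (cf f / lam) *: z - U.
    by rewrite -K_rest// opprB addrC addrA subrK.
  rewrite scalerBr scalerA (_ : lam / cf f * (cf f / lam) = 1) ?scale1r//.
  by field; rewrite cf0 gt_eqF.
have VpK := V_pe VKf.
rewrite (snormZ aV); last exact: subspaceB.
rewrite normrM normrV ?unitfE// (gtr0_norm lam_gt0) -mulrA (ler_wpM2l (ltW lam_gt0))//.
rewrite [leLHS]mulrC ler_pdivrMr ?normr_gt0// mulrDl divfK ?normr_eq0//.
rewrite /rel_rest mulrA divfK ?normr_eq0//.
apply: le_trans (snormB aV VKU VpK) _; rewrite lerD2l; exact: na_pe_K.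
Qed.

(** K f is close to a multiple of z, so an approximation w of z alone bounds
    the discretization error. *)
Lemma step_err del w : W w -> na (z - w) <= del ->
  err / `|cf f| <= embed_norm * rel_rest f + del / lam.
Proof.
move=> Ww zw; rewrite ler_pdivrMr ?normr_gt0//.
have Wcw := subspaceZ (cf f / lam) sW Ww.
apply: le_trans (galerkin_best Vf UP Wcw) _.
have Vw := WV Ww; have Vzw := subspaceB sV Vz Vw.
have Vczw := subspaceZ (cf f / lam) sV Vzw.
have -> : K f - (cf f / lam) *: w = pe (K f) + (cf f / lam) *: (z - w).
  by rewrite -K_rest// scalerBr addrA subrK.
apply: le_trans (snormD aV (V_pe VKf) Vczw) _.
rewrite mulrDl /rel_rest mulrA divfK ?normr_eq0// lerD ?na_pe_K//.
rewrite (snormZ aV)// normrM (gtr0_norm (_ : 0 < lam^-1)) ?invr_gt0//.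
rewrite [leRHS]mulrC -[leLHS]mulrA ler_wpM2l// [leLHS]mulrC.
by apply: ler_wpM2r => //; rewrite invr_ge0 ltW.
Qed.

Variable q : R.
Hypotheses (q_lt1 : q < 1).
Hypothesis small_q : lam ^+ 2 * embed_norm * (eps * (err / `|cf f|)) <= q.

Lemma step_coef_ge : `|cf f| * (1 - q) <= lam * `|cf U|.
Proof.
have cp : 0 < `|cf f| by rewrite normr_gt0.
have : `|lam * cf U - cf f| <= q * `|cf f|.
  apply: le_trans step_coef _; rewrite -ler_pdivrMr//; apply: le_trans small_q.
  by rewrite !mulrA.
have : `|cf f| <= `|lam * cf U| + `|lam * cf U - cf f|.
  by rewrite -{1}[cf f](subKr (lam * cf U)); exact: ler_normB.
rewrite normrM (gtr0_norm lam_gt0); lra.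
Qed.

Lemma step_coef_neq0 : cf U != 0.
Proof.
rewrite -normr_gt0 -(pmulr_rgt0 _ lam_gt0); apply: lt_le_trans step_coef_ge.
by rewrite mulr_gt0 ?normr_gt0// subr_gt0.
Qed.

Let step_div (x y : R) : 0 <= x -> x <= `|cf f| * y -> x / `|cf U| <= lam * y / (1 - q).
Proof.
move=> x0 xy; have q1 : 0 < 1 - q by rewrite subr_gt0.
have cp : 0 < `|cf f| by rewrite normr_gt0.
have cU : 0 < `|cf U| by rewrite normr_gt0 step_coef_neq0.
rewrite ler_pdivrMr// mulrAC ler_pdivlMr//.
have y0 : 0 <= y by rewrite -(pmulr_rge0 _ cp) (le_trans x0).
apply: (@le_trans _ _ (`|cf f| * y * (1 - q))); first by rewrite ler_wpM2r// ltW.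
have := ler_wpM2r y0 step_coef_ge; lra.
Qed.

(** The rest is contracted by the ratio of the two eigenvalues, and the
    discretization error enters with the small factor eps.  Dividing by the
    coefficient of U costs 1 - q. *)
Lemma step_rel_rest : rel_rest U <=
  (lam / lam2 * rel_rest f + lam * (eps * (err / `|cf f|))) / (1 - q).
Proof.
have cn : `|cf f| != 0 by rewrite normr_eq0.
rewrite -[lam / lam2 * _]mulrA -mulrDr; apply: step_div; first exact: snorm_ge0.
apply: le_trans step_rest_b _.
suff -> : `|cf f| * (lam2^-1 * rel_rest f + eps * (err / `|cf f|)) =
  nb (pe f) / lam2 + eps * err by [].
by rewrite /rel_rest; field; rewrite cn gt_eqF// lam2_gt0.
Qed.

Lemma step_rel_rest_a : na (pe U) / `|cf U| <=
  lam * (err / `|cf f| + embed_norm * rel_rest f) / (1 - q).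
Proof.
have cn : `|cf f| != 0 by rewrite normr_eq0.
apply: step_div; first exact: snorm_ge0.
apply: le_trans step_rest_a _.
suff -> : `|cf f| * (err / `|cf f| + embed_norm * rel_rest f) =
  embed_norm * nb (pe f) + err by [].
by rewrite /rel_rest; field.
Qed.

End one_step.

Lemma rel_restZ c f : V f -> c != 0 -> rel_rest (c *: f) = rel_rest f.
Proof.
move=> Vf c0; rewrite /rel_rest peZ// (snormZ bV _ (V_pe Vf)) cfZ// normrM.
by rewrite -mulf_div divff ?normr_eq0// mul1r.
Qed.

(** By the gap an eigenvector y for lam has a null rest, so the projection
    onto the eigenspace keeps the multiple of z up to a null vector. *)
Lemma eig_projection y v : V y -> (forall w, V w -> a y w = lam * b y w) ->
  V v -> a (v - y) z = 0 ->
  na (v - y) = na (pe v) /\ nb (v - y) = nb (pe v).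
Proof.
move=> Vy yP Vv vy.
have cvy : cf y = cf v.
  by apply/eqP; rewrite eq_sym -subr_eq0 /cf -(sipBl aV)// vy.
have Vp := V_pe Vy; have Vpv := V_pe Vv.
have Vcz := subspaceZ (cf y) sV Vz.
have eig_pe p : V p -> a (pe y) p = lam * b (pe y) p.
  move=> Vp'; rewrite /eig_rest (sipBl aV)// (sipBl bV)// (sipZl aV)// (sipZl bV)//.
  by rewrite yP// z_eigen//; ring.
have pyE := eig_pe _ Vp.
have bp0 : b (pe y) (pe y) = 0.
  have := gap Vp (cf_pe Vy); rewrite pyE => h.
  have b0 := semi_inner_ge0 bV Vp.
  apply/eqP; rewrite eq_le b0 andbT.
  have : (lam2 - lam) * b (pe y) (pe y) <= 0 by lra.
  by rewrite pmulr_rle0// subr_gt0.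
have nbp : nb (pe y) = 0 by rewrite /snorm bp0 sqrtr0.
have nap : na (pe y) = 0 by rewrite /snorm pyE bp0 mulr0 sqrtr0.
have -> : v - y = pe v + - pe y.
  by rewrite /eig_rest cvy opprB addrA subrK.
have Vpn : V (- pe y) by rewrite -scaleN1r; exact: subspaceZ.
split.
  by apply: (snorm_add_null aV) => //; rewrite (snormN aV).
by apply: (snorm_add_null bV) => //; rewrite (snormN bV).
Qed.

Lemma unit_coef_ge f : V f -> na f = 1 -> na (pe f) <= 2^-1 -> 2^-1 <= `|cf f|.
Proof.
move=> Vf f1 pf; rewrite leNgt; apply/negP => cf2.
have := na_split Vf; rewrite f1 -(real_normK (num_real (cf f))).
have : `|cf f| ^+ 2 < 2^-1 ^+ 2 by rewrite ltr_sqr ?nnegrE ?invr_ge0.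
have : na (pe f) ^+ 2 <= 2^-1 ^+ 2 by rewrite ler_sqr ?nnegrE ?invr_ge0 ?snorm_ge0.
rewrite expr1n; lra.
Qed.

Lemma unit_mass_gt0 u : V u -> na u = 1 -> na (pe u) <= 6^-1 -> 0 < b u u.
Proof.
move=> Vu u1 x6; rewrite -(snorm_sqr bV)// (nb_split Vu).
have cp : 0 < `|cf u|.
  have x2 : na (pe u) <= 2^-1 by apply: le_trans x6 _; lra.
  by apply: lt_le_trans (unit_coef_ge Vu u1 x2); rewrite invr_gt0.
apply: ltr_pwDl; last exact: sqr_ge0.
by rewrite divr_gt0// exprn_even_gt0//= -normr_gt0.
Qed.

(** As a(u, u) = 1, the number b(u, u) determines mu, and lam b(u, u) = 1 - x
    + lam y with x and y the squared norms of the rest and 0 <= lam y <= x. *)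
Lemma rayleigh_error u mu : V u -> na u = 1 -> na (pe u) <= 6^-1 ->
  mu * b u u = 1 -> 0 <= mu - lam <= 8 * lam * na (pe u) ^+ 2.
Proof.
move=> Vu u1 x6 muE.
have x0 := snorm_ge0 a (pe u); have y0 := sqr_ge0 (nb (pe u)).
have xs : na (pe u) ^+ 2 <= 36^-1.
  have -> : 36^-1 = 6^-1 ^+ 2 :> R by rewrite exprVn -natrX.
  by rewrite ler_sqr ?nnegrE ?invr_ge0.
have hgap := gap_pe Vu; have ha := na_split Vu; have hb := nb_split Vu.
rewrite u1 expr1n in ha; rewrite (snorm_sqr bV)// in hb.
set x := na (pe u) ^+ 2 in xs hgap ha *; set y := nb (pe u) ^+ 2 in y0 hgap hb.
have xge : 0 <= x by exact: sqr_ge0.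
have yx : lam * y <= x.
  by apply: le_trans hgap; rewrite ler_wpM2r// ltW.
have lB : lam * b u u = 1 - x + lam * y.
  by rewrite hb mulrDr mulrCA divff ?gt_eqF// mulr1; lra.
have B0 : 0 < b u u by rewrite -(pmulr_rgt0 _ lam_gt0) lB; have := mulr_ge0 (ltW lam_gt0) y0; lra.
have mu0 : 0 < mu by rewrite -(pmulr_lgt0 _ B0) muE.
have lmu : lam = mu * (1 - x + lam * y) by rewrite -lB mulrCA muE mulr1.
have h1 : 0 <= mu * (x - lam * y) by rewrite mulr_ge0 ?subr_ge0// ltW.
have h2 := mulr_ge0 (ltW mu0) (mulr_ge0 (ltW lam_gt0) y0).
have h3 : 0 <= mu * (36^-1 - x) by rewrite mulr_ge0 ?subr_ge0// ltW.
have mu2 : mu <= 8 * lam by lra.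
have h4 := ler_wpM2r xge mu2.
by apply/andP; split; lra.
Qed.

End inverse_iteration.

(** * Galerkin levels and the quasi-error *)

(** Rk is the Galerkin solution operator of the level and eta the estimator as
    a function of the data.  The number eps collects the duality estimates and
    del bounds the distance from z to the spaces; both become small with the
    coarse mesh size. *)
Record level_setting (R : realType) (X : lmodType R) (V : set X)
    (a b : X -> X -> R) (z : X) (K : X -> X) (W : nat -> set X)
    (Rk : nat -> X -> X) (eta : nat -> X -> R) (Cup Clow Coa eps del : R) : Prop := {
  lev_sub : forall k, (0 < k)%N -> W k `<=` V;
  lev_lin : forall k, (0 < k)%N -> linear_subspace (W k);
  lev_nested : forall k, (0 < k)%N -> W k `<=` W k.+1;
  lev_sol : forall k f, (0 < k)%N -> V f -> galerkin_sol a b (W k) f (Rk k f);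
  lev_dual : forall k f, (0 < k)%N -> V f ->
    snorm b (K f - Rk k f) <= eps * snorm a (K f - Rk k f);
  lev_dense : forall k, (0 < k)%N -> exists2 w, W k w & snorm a (z - w) <= del;
  lev_eta_ge0 : forall k f, 0 <= eta k f;
  lev_eta_lin : forall k c f g, (0 < k)%N -> V f -> V g ->
    eta k (c *: f + g) <= `|c| * eta k f + eta k g;
  lev_up : forall k f, (0 < k)%N -> V f ->
    snorm a (K f - Rk k f) <= Cup * eta k f;
  lev_low : forall k f, (0 < k)%N -> W k f ->
    Clow * eta k f <= snorm a (K f - Rk k f) + Coa * snorm a (Rk k f) }.

Section levels.
Variables (R : realType) (X : lmodType R) (V : set X) (a b : X -> X -> R).
Variables (z : X) (lam lam2 : R) (K : X -> X).
Hypothesis S : spectral_setting V a b z lam lam2 K.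
Variables (W : nat -> set X) (Rk : nat -> X -> X) (eta : nat -> X -> R).
Variables (Cup Clow Coa eps del : R).
Hypothesis L : level_setting V a b z K W Rk eta Cup Clow Coa eps del.
Hypotheses (Cup_gt0 : 0 < Cup) (Clow_gt0 : 0 < Clow) (Coa_gt0 : 0 < Coa).
Hypotheses (eps_ge0 : 0 <= eps) (del_ge0 : 0 <= del).
Variable gam : R.
Hypothesis gam_gt0 : 0 < gam.

Local Notation na := (snorm a).
Local Notation nb := (snorm b).
Local Notation cf := (eig_coef a z).
Local Notation pe := (eig_rest a z).
Local Notation rel_rest := (rel_rest a b z).
Local Notation embed_norm := (embed_norm lam).
Local Notation sol k f u := (galerkin_sol a b (W k) f u).
Let aV := spec_form S.
Let bV := spec_mass S.
Let Vz := spec_eigvec S.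
Let lam_gt0 := spec_gt0 S.
Let lam_lt := spec_lt S.
Let VK := spec_sol S.
Let KE := spec_solE S.
Let sV := semi_inner_sub aV.
Let emb0 := embed_norm_gt0 S.
Implicit Types (f g u v w : X) (k : nat) (c : R).

Definition lev_err k f := na (K f - Rk k f).

Section one_level.
Variable k : nat.
Hypothesis k_gt0 : (0 < k)%N.
Let WV := lev_sub L k_gt0.
Let sW := lev_lin L k_gt0.
Let VR f : V f -> V (Rk k f).
Proof. by move=> Vf; apply: WV; case: (lev_sol L k_gt0 Vf). Qed.

Lemma sol_err f u : V f -> sol k f u -> na (K f - u) = lev_err k f.
Proof.
by move=> Vf uP; apply: (galerkin_unique S WV sW) => //; exact: (lev_sol L).
Qed.

(** By Pythagoras all Galerkin solutions for the same data differ by null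
    vectors. *)
Lemma sol_dual f u : V f -> sol k f u -> nb (K f - u) <= eps * na (K f - u).
Proof.
move=> Vf uP; have rP := lev_sol L k_gt0 Vf; have [Wu _] := uP.
have Vu := WV Wu; have Vr := VR Vf; have VKf := VK Vf.
have VKr := subspaceB sV VKf Vr; have Vru := subspaceB sV Vr Vu.
have ru0 : na (Rk k f - u) = 0.
  have := galerkin_pythagoras S WV sW Vf rP Wu.
  rewrite (sol_err Vf uP) /lev_err => /eqP.
  rewrite -[X in X == _]addr0 (inj_eq (addrI _)) eq_sym sqrf_eq0. by move=> /eqP.
have bru0 : nb (Rk k f - u) = 0.
  apply/eqP; rewrite eq_le snorm_ge0 andbT.
  by apply: le_trans (nb_le S Vru) _; rewrite ru0 mulr0.
have -> : K f - u = (K f - Rk k f) + (Rk k f - u) by rewrite addrA subrK.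
rewrite (snorm_add_null aV VKr Vru ru0).
apply: le_trans (snormD bV VKr Vru) _; rewrite bru0 addr0; exact: (lev_dual L).
Qed.

Lemma lev_err_lin c f g : V f -> V g ->
  lev_err k (c *: f + g) <= `|c| * lev_err k f + lev_err k g.
Proof.
move=> Vf Vg; have [Wf fP] := lev_sol L k_gt0 Vf.
have [Wg gP] := lev_sol L k_gt0 Vg.
have [_ sVl] := sV; have Vfg := sVl c _ _ Vf Vg.
have Vrf := WV Wf; have Vrg := WV Wg; have VKf := VK Vf; have VKg := VK Vg.
have Vr := sVl c _ _ Vrf Vrg; have Vc := sVl c _ _ VKf VKg; have VKfg := VK Vfg.
have rP : sol k (c *: f + g) (c *: Rk k f + Rk k g).
  split=> [|v Wv]; first by case: sW => _; exact.
  have Vv := WV Wv.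
  by rewrite (semi_inner_lin aV)// (semi_inner_lin bV)// fP// gP.
rewrite -(sol_err Vfg rP).
have VKr := subspaceB sV Vc Vr; have Vnull := subspaceB sV VKfg Vc.
have null : na (K (c *: f + g) - (c *: K f + K g)) = 0.
  rewrite /snorm (sipBl aV)// KE// (semi_inner_lin aV)// !KE//.
  by rewrite (semi_inner_lin bV)// subrr sqrtr0.
have -> : K (c *: f + g) - (c *: Rk k f + Rk k g) =
   (c *: K f + K g - (c *: Rk k f + Rk k g)) +
   (K (c *: f + g) - (c *: K f + K g)) by rewrite [RHS]addrC addrA subrK.
rewrite (snorm_add_null aV)//.
have -> : c *: K f + K g - (c *: Rk k f + Rk k g) =
  c *: (K f - Rk k f) + (K g - Rk k g) by rewrite opprD addrACA scalerBr.
have Vdf := subspaceB sV VKf Vrf; have Vdg := subspaceB sV VKg Vrg.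
apply: le_trans (snormD aV (subspaceZ c sV Vdf) Vdg) _.
by rewrite (snormZ aV).
Qed.

Lemma lev_err_le f : V f -> lev_err k f <= na (K f).
Proof.
move=> Vf; have rP := lev_sol L k_gt0 Vf.
have := galerkin_best S WV sW Vf rP sW.1; by rewrite subr0.
Qed.

Lemma lev_sol_le f : V f -> na (Rk k f) <= na (K f).
Proof.
move=> Vf; have rP := lev_sol L k_gt0 Vf.
rewrite -ler_sqr ?nnegrE ?snorm_ge0//.
have := galerkin_pythagoras S WV sW Vf rP sW.1; rewrite !subr0 => ->.
by rewrite lerDr sqr_ge0.
Qed.

(** The quantity contracted by marking and refining when the data are kept. *)
Definition quasi_err f := Num.sqrt (lev_err k f ^+ 2 + gam * eta k f ^+ 2).

Let gam_sqr_ge0 (x : R) : 0 <= gam * x ^+ 2.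
Proof. by rewrite mulr_ge0 ?(ltW gam_gt0)// sqr_ge0. Qed.

Let sqrD_ge0 (x y : R) : 0 <= x ^+ 2 + gam * y ^+ 2.
Proof. by rewrite addr_ge0// sqr_ge0. Qed.

Lemma quasi_err_sqr f : quasi_err f ^+ 2 = lev_err k f ^+ 2 + gam * eta k f ^+ 2.
Proof. by rewrite sqr_sqrtr. Qed.

Lemma quasi_err_ge0 f : 0 <= quasi_err f. Proof. exact: sqrtr_ge0. Qed.

Lemma lev_err_quasi f : lev_err k f <= quasi_err f.
Proof.
rewrite -ler_sqr ?nnegrE ?snorm_ge0 ?quasi_err_ge0// quasi_err_sqr.
by rewrite lerDl.
Qed.

Lemma eta_quasi f : Num.sqrt gam * eta k f <= quasi_err f.
Proof.
have e0 := lev_eta_ge0 L k f.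
rewrite -ler_sqr ?nnegrE ?mulr_ge0 ?sqrtr_ge0 ?quasi_err_ge0// quasi_err_sqr.
by rewrite exprMn (sqr_sqrtr (ltW gam_gt0)) lerDr sqr_ge0.
Qed.

Lemma quasi_err_le_add f : quasi_err f <= lev_err k f + Num.sqrt gam * eta k f.
Proof.
have e0 := lev_eta_ge0 L k f; have l0 : 0 <= lev_err k f by exact: snorm_ge0.
have s0 : 0 <= Num.sqrt gam * eta k f by rewrite mulr_ge0 ?sqrtr_ge0.
rewrite -ler_sqr ?nnegrE ?addr_ge0 ?quasi_err_ge0// quasi_err_sqr sqrrD.
rewrite [(Num.sqrt gam * _) ^+ 2]exprMn (sqr_sqrtr (ltW gam_gt0)).
by rewrite lerD2r lerDl mulrn_wge0// mulr_ge0.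
Qed.

Lemma quasi_err_eta f : V f ->
  quasi_err f <= Num.sqrt (Cup ^+ 2 + gam) * eta k f.
Proof.
move=> Vf; have e0 := lev_eta_ge0 L k f.
have cup_sqr : Num.sqrt (Cup ^+ 2 + gam) ^+ 2 = Cup ^+ 2 + gam.
  by rewrite sqr_sqrtr// addr_ge0 ?sqr_ge0// ltW.
rewrite -ler_sqr ?nnegrE ?mulr_ge0 ?sqrtr_ge0 ?quasi_err_ge0// quasi_err_sqr.
rewrite exprMn cup_sqr mulrDl lerD2r.
rewrite -exprMn ler_sqr ?nnegrE ?snorm_ge0 ?mulr_ge0 ?(ltW Cup_gt0)//.
exact: (lev_up L).
Qed.

(** Minkowski inequality in the plane, with the weight gam. *)
Lemma quasi_err_lin c f g : V f -> V g ->
  quasi_err (c *: f + g) <= `|c| * quasi_err f + quasi_err g.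
Proof.
move=> Vf Vg.
have scale : `|c| * quasi_err f =
    Num.sqrt ((`|c| * lev_err k f) ^+ 2 + gam * (`|c| * eta k f) ^+ 2).
  rewrite -[LHS]ger0_norm ?mulr_ge0 ?quasi_err_ge0// -sqrtr_sqr.
  by rewrite [in LHS]exprMn quasi_err_sqr; congr Num.sqrt; ring.
rewrite scale /quasi_err; apply: young_sqrt.
- exact: sqrD_ge0.
- exact: sqrD_ge0.
apply: youngD; first by apply: young_sqr; rewrite snorm_ge0 lev_err_lin.
apply: youngM; first exact: ltW.
by apply: young_sqr; rewrite (lev_eta_ge0 L) (lev_eta_lin L).
Qed.

Definition inv_const := embed_norm * (1 + Num.sqrt gam * ((1 + Coa) / Clow)).

(** For finite element data the lower bound of the estimator has an
    oscillation term that sees the discrete solution only, and this is bounded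
    by its energy, hence by the L2 norm of the data. *)
Lemma quasi_err_inv f : W k f -> quasi_err f <= inv_const * nb f.
Proof.
move=> Wf; have Vf := WV Wf; apply: le_trans (quasi_err_le_add f) _.
have h1 := lev_err_le Vf; have h2 := lev_sol_le Vf; have h3 := na_K S Vf.
have h4 : eta k f <= (1 + Coa) / Clow * na (K f).
  rewrite mulrAC ler_pdivlMr// mulrC mulrDl mul1r.
  by apply: le_trans (lev_low L k_gt0 Wf) _; rewrite lerD// ler_wpM2l// ltW.
apply: (@le_trans _ _ (na (K f) + Num.sqrt gam * ((1 + Coa) / Clow * na (K f)))).
  by rewrite lerD// ler_wpM2l ?sqrtr_ge0.
have -> : inv_const * nb f =
  (1 + Num.sqrt gam * ((1 + Coa) / Clow)) * (embed_norm * nb f).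
  by rewrite /inv_const; ring.
rewrite mulrA -[X in X + _]mul1r -mulrDl ler_wpM2l// addr_ge0 ?mulr_ge0//.
- by rewrite addr_ge0// ltW.
- by rewrite invr_ge0 ltW.
Qed.

End one_level.
End levels.

(** * The invariant of an adaptive run *)

(** The properties of the solution w of an eigenvalue problem on a subspace
    containing u.  The third and fourth bounds come from the distance of z to
    the subspace, which is at most the distance of z to any multiple of u; the
    last one is the duality gain in L2. *)
Definition eig_output (R : realType) (X : lmodType R) (a b : X -> X -> R) (z : X)
    (W : nat -> set X) (Cea eps del : R) (k : nat) (u w : X) :=
  [/\ W k w, snorm a w = 1, snorm a (eig_rest a z w) <= Cea * del,
      forall c, snorm a (eig_rest a z w) <= Cea * snorm a (z - c *: u) &
      snorm b (eig_rest a z w) <= eps * snorm a (eig_rest a z w)].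

(** The number q bounds the relative defect of a coefficient after one step,
    kap bounds the rests, and tau bounds the rests measured by the estimator
    at the start of the stage.  The conditions ending in _step make the bounds
    kap and tau stable under a source problem, those ending in _out under an
    eigenvalue problem. *)
Record small_parameters (R : realType) (lam lam2 Cup Clow Coa Cea gam theta2 ahat alpha : R)
    (eps del q kap tau : R) : Prop := {
  small_eps : 0 <= eps;
  small_del : 0 <= del <= 20^-1;
  small_q : 0 < q <= 10^-1;
  small_kap : 0 < kap /\ lam * embed_norm lam * kap <= 20^-1;
  small_tau : 0 < tau;
  small_out : Cea * del <= 2^-1;
  small_coef : lam * embed_norm lam * eps <= q;
  small_kap_step : lam / lam2 / (1 - q) * kap + eps <= kap;
  small_eps_kap : eps <= kap;
  small_tau_step : lam / lam2 / (1 - q) * tau +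
    2 * lam * eps * (2 * Num.sqrt (Cup ^+ 2 + gam)) <= tau;
  small_tau_out :
    2 * eps * Cea * lam * (2 * Cup + embed_norm lam * (tau / theta2)) <= tau / 2;
  small_contr : inv_const lam Clow Coa gam * (tau / theta2 / Num.sqrt gam) *
    (1 + alpha) <= alpha - ahat;
  small_final : embed_norm lam * (tau / theta2 / Num.sqrt gam) <= 4^-1 }.

(** The sequences fk and Uk hold the data and Galerkin solution with which
    level k ends, ff and Ub those of its inner iterations, which are counted
    by J; el is the index of the stage and et the estimator at its start.
    Level 1 ends with the first discrete eigenfunction. *)
Record adaptive_run (R : realType) (X : lmodType R)
    (a b : X -> X -> R) (z : X) (K : X -> X) (W : nat -> set X)
    (Rk : nat -> X -> X) (eta : nat -> X -> R) (Cea eps del gam theta2 ahat : R)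
    (fk Uk : nat -> X) (ff Ub : nat -> nat -> X) (J el : nat -> nat) (et : nat -> R)
    : Prop := {
  run_sol : forall k, (0 < k)%N -> galerkin_sol a b (W k) (fk k) (Uk k);
  run_first : eig_output a b z W Cea eps del 1 (Uk 1%N) (fk 1%N);
  run_el2 : el 2%N = 1%N;
  run_et1 : et 1%N = eta 1%N (fk 1%N);
  run_ff2 : ff 2%N 0%N = fk 1%N;
  run_inner_sol : forall k j, (1 < k)%N -> (j <= J k)%N ->
    galerkin_sol a b (W k) (ff k j) (Ub k j);
  run_inner : forall k j, (1 < k)%N -> (j < J k)%N ->
    eta k (ff k j) <= theta2 ^+ j.+1 * et (el k) /\
    eig_output a b z W Cea eps del k (Ub k j) (ff k j.+1);
  run_exit : forall k, (1 < k)%N ->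
    [/\ theta2 ^+ (J k).+1 * et (el k) < eta k (ff k (J k)),
        fk k = ff k (J k) & Uk k = Ub k (J k)];
  run_new : forall k, (1 < k)%N -> (0 < J k)%N ->
    eig_output a b z W Cea eps del k (Uk k) (ff k.+1 0%N) /\
    et (el k.+1) = eta k (fk k);
  run_same : forall k, (1 < k)%N -> J k = 0%N ->
    ff k.+1 0%N = (snorm a (Uk k))^-1 *: Uk k /\ el k.+1 = el k;
  run_contr : forall k, (0 < k)%N ->
    quasi_err a K Rk eta gam k.+1 (fk k) <= ahat * quasi_err a K Rk eta gam k (fk k) }.

Section run.
Variables (R : realType) (X : lmodType R) (V : set X) (a b : X -> X -> R).
Variables (z : X) (lam lam2 : R) (K : X -> X).
Hypothesis S : spectral_setting V a b z lam lam2 K.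
Variables (W : nat -> set X) (Rk : nat -> X -> X) (eta : nat -> X -> R).
Variables (Cup Clow Coa Cea eps del : R).
Hypothesis L : level_setting V a b z K W Rk eta Cup Clow Coa eps del.
Hypotheses (Cup_gt0 : 0 < Cup) (Clow_gt0 : 0 < Clow) (Coa_gt0 : 0 < Coa).
Hypothesis (Cea_gt0 : 0 < Cea).
Variables (gam theta2 ahat alpha q kap tau : R).
Hypotheses (gam_gt0 : 0 < gam) (theta2_01 : 0 < theta2 < 1).
Hypotheses (ahat_01 : 0 < ahat < 1) (alpha_bnd : ahat < alpha < 1).
Hypothesis P : small_parameters lam lam2 Cup Clow Coa Cea gam theta2 ahat alpha
  eps del q kap tau.

Local Notation na := (snorm a).
Local Notation nb := (snorm b).
Local Notation cf := (eig_coef a z).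
Local Notation pe := (eig_rest a z).
Local Notation rel := (rel_rest a b z).
Local Notation embed_norm := (embed_norm lam).
Local Notation sol k f u := (galerkin_sol a b (W k) f u).
Local Notation out := (eig_output a b z W Cea eps del).
Local Notation Q := (quasi_err a K Rk eta gam).
Local Notation err := (lev_err a K Rk).
Local Notation sgam := (Num.sqrt gam).
Let aV := spec_form S.
Let bV := spec_mass S.
Let Vz := spec_eigvec S.
Let lam_gt0 := spec_gt0 S.
Let lam2_gt0 := lam2_gt0 S.
Let sV := semi_inner_sub aV.
Let emb0 := embed_norm_gt0 S.
Let eps0 := small_eps P.
Let eta0 := lev_eta_ge0 L.
Let sgam0 : 0 < sgam. Proof. by rewrite sqrtr_gt0. Qed.
Let q0 : 0 < q. Proof. by have /andP[] := small_q P. Qed.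
Let q10 : q <= 10^-1. Proof. by have /andP[] := small_q P. Qed.
Let q1 : q < 1. Proof. have := q10; lra. Qed.
Let al0 : 0 <= alpha.
Proof. by case/andP: alpha_bnd; case/andP: ahat_01; lra. Qed.
Let al1 : alpha <= 1. Proof. by case/andP: alpha_bnd => _ /ltW. Qed.
Let kap0 := (small_kap P).1.
Let tau0 := small_tau P.
Let th0 : 0 < theta2. Proof. by case/andP: theta2_01. Qed.
Let th1 : theta2 < 1. Proof. by case/andP: theta2_01. Qed.

Definition rel_err k f := err k f / `|cf f|.
Definition rel_quasi k f := Q k f / `|cf f|.
(** For such data a Galerkin step is a small perturbation of an exact step of
    inverse iteration. *)
Definition aligned f := [/\ V f, na f = 1, 2^-1 <= `|cf f| & rel f <= kap].

Lemma aligned_coef f : aligned f -> cf f != 0.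
Proof. by move=> [_ _ cf2 _]; rewrite -normr_gt0 (lt_le_trans _ cf2)// invr_gt0. Qed.

Lemma rel_ge0 f : 0 <= rel f.
Proof. by rewrite divr_ge0 ?snorm_ge0. Qed.

Lemma rel_err_ge0 k f : 0 <= rel_err k f.
Proof. by rewrite divr_ge0 ?snorm_ge0. Qed.

Lemma rel_quasi_ge0 k f : 0 <= rel_quasi k f.
Proof. by rewrite divr_ge0 ?sqrtr_ge0. Qed.

Lemma div_coef_le f x : 2^-1 <= `|cf f| -> 0 <= x -> x / `|cf f| <= 2 * x.
Proof.
move=> cf2 x0; rewrite ler_pdivrMr; last by rewrite (lt_le_trans _ cf2)// invr_gt0.
by rewrite mulrAC -[leLHS]mul1r ler_wpM2r//; lra.
Qed.

Lemma out_unit k u w : (0 < k)%N -> out k u w -> aligned w.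
Proof.
move=> k0 [Ww w1 wa _ wb]; have Vw := lev_sub L k0 Ww.
have pw := le_trans wa (small_out P).
have cf2 := unit_coef_ge S Vw w1 pw.
split=> //; apply: le_trans (div_coef_le cf2 (snorm_ge0 _ _)) _.
have := small_eps_kap P; have := ler_wpM2l eps0 pw; lra.
Qed.

(** An eigenvalue problem on a space containing u is at least as accurate as u
    in the energy norm, and gains the factor eps in L2. *)
Lemma out_rel k f u w : (0 < k)%N -> V f -> cf f != 0 -> sol k f u -> out k u w ->
  rel w <= 2 * eps * Cea * lam * (rel_err k f + embed_norm * rel f).
Proof.
move=> k0 Vf cf0 uP wP; have [_ _ cf2 _] := out_unit k0 wP.
case: wP => [_ _ _ wa wb].
apply: le_trans (div_coef_le cf2 (snorm_ge0 _ _)) _.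
rewrite -!mulrA ler_pM2l//; apply: le_trans wb _; apply: ler_wpM2l => //.
apply: le_trans (wa (lam / cf f)) _; apply: ler_wpM2l; first exact: ltW.
have := step_angle S (lev_sub L k0) Vf uP cf0.
by rewrite (sol_err S L k0 Vf uP).
Qed.

Lemma rel_err_small k f : (0 < k)%N -> aligned f -> lam * rel_err k f <= 10^-1.
Proof.
move=> k0 fP; have [Vf _ _ fk] := fP; have [w Ww zw] := lev_dense L k0.
have := step_err S (lev_sub L k0) (lev_lin L k0) Vf (lev_sol L k0 Vf)
  (aligned_coef fP) Ww zw.
rewrite -/(lev_err a K Rk k f) -/(rel_err k f) => /(ler_wpM2l (ltW lam_gt0)).
rewrite mulrDr [lam * (del / lam)]mulrCA divff ?gt_eqF// mulr1 mulrA.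
have le0 : 0 <= lam * embed_norm by rewrite mulr_ge0// ltW.
have := ler_wpM2l le0 fk; have := (small_kap P).2.
have /andP[_] := small_del P; lra.
Qed.

Let coef_small k f : (0 < k)%N -> aligned f ->
  lam ^+ 2 * embed_norm * (eps * rel_err k f) <= q.
Proof.
move=> k0 fP; have le0 : 0 <= lam * embed_norm * eps by rewrite !mulr_ge0// ltW.
have := ler_wpM2l le0 (rel_err_small k0 fP); have := small_coef P.
have -> : lam ^+ 2 * embed_norm * (eps * rel_err k f) =
  lam * embed_norm * eps * (lam * rel_err k f) by ring.
lra.
Qed.

Lemma solve_neq0 k f u : (0 < k)%N -> aligned f -> sol k f u -> cf u != 0.
Proof.
move=> k0 fP uP; have [Vf _ _ _] := fP.
apply: (step_coef_neq0 S (lev_sub L k0) Vf uP (sol_dual S L k0 Vf uP)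
  (aligned_coef fP) (q := q)); first exact: q1.
by rewrite (sol_err S L k0 Vf uP); exact: coef_small.
Qed.

Lemma solve_rel k f u : (0 < k)%N -> aligned f -> sol k f u ->
  rel u <= lam / lam2 / (1 - q) * rel f + 2 * lam * eps * rel_err k f.
Proof.
move=> k0 fP uP; have [Vf _ _ _] := fP.
apply: le_trans (step_rel_rest S (lev_sub L k0) Vf uP (sol_dual S L k0 Vf uP)
  (aligned_coef fP) (q := q) _ _) _; first exact: q1.
  by rewrite (sol_err S L k0 Vf uP); exact: coef_small.
rewrite (sol_err S L k0 Vf uP) -/(rel_err k f) mulrDl.
have -> : lam / lam2 * rel f / (1 - q) = lam / lam2 / (1 - q) * rel f by ring.
have q10' := q10; have q1' := q1; have q0' := q0.
rewrite lerD2l ler_pdivrMr; last by lra.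
have e0 : 0 <= lam * (eps * rel_err k f).
  by rewrite mulr_ge0 ?(ltW lam_gt0)// mulr_ge0// rel_err_ge0.
have : 0 <= (1 - 2 * q) * (lam * (eps * rel_err k f)) by rewrite mulr_ge0//; lra.
lra.
Qed.

Lemma solve_rest k f u : (0 < k)%N -> aligned f -> sol k f u ->
  na (pe ((na u)^-1 *: u)) <= lam * (rel_err k f + embed_norm * rel f) / (1 - q).
Proof.
move=> k0 fP uP; have [Vf _ _ _] := fP; have [Wu _] := uP.
have Vu := lev_sub L k0 Wu.
have : na (pe u) / `|cf u| <= lam * (rel_err k f + embed_norm * rel f) / (1 - q).
  rewrite /rel_err -(sol_err S L k0 Vf uP).
  apply: (step_rel_rest_a S (lev_sub L k0) Vf uP (sol_dual S L k0 Vf uP)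
    (aligned_coef fP)); first exact: q1.
  by rewrite (sol_err S L k0 Vf uP); exact: coef_small.
apply: le_trans.
have cu : 0 < `|cf u| by rewrite normr_gt0 (solve_neq0 k0 fP uP).
have nu : 0 < na u by rewrite (lt_le_trans cu)// (cf_le S).
rewrite (peZ S)// (snormZ aV); last exact: (V_pe S).
rewrite gtr0_norm ?invr_gt0// mulrC ler_wpM2l ?snorm_ge0//.
by rewrite lef_pV2 ?posrE// (cf_le S).
Qed.

Lemma solve_rest_small k f u : (0 < k)%N -> aligned f -> sol k f u ->
  na (pe ((na u)^-1 *: u)) <= 6^-1.
Proof.
move=> k0 fP uP; have [_ _ _ fk] := fP; apply: le_trans (solve_rest k0 fP uP) _.
have q10' := q10; rewrite ler_pdivrMr; last by lra.
have le0 : 0 <= lam * embed_norm by rewrite mulr_ge0// ltW.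
have := ler_wpM2l le0 fk; have := (small_kap P).2.
have := rel_err_small k0 fP; lra.
Qed.

Lemma solve_aligned k f u : (0 < k)%N -> aligned f -> sol k f u ->
  aligned ((na u)^-1 *: u).
Proof.
move=> k0 fP uP; have [Vf _ _ fk] := fP; have [Wu _] := uP.
have Vu := lev_sub L k0 Wu; have cu := solve_neq0 k0 fP uP.
have nu : 0 < na u by rewrite (lt_le_trans _ (cf_le S Vu))// normr_gt0.
have Vuu : V ((na u)^-1 *: u) by exact: subspaceZ.
have n1 : na ((na u)^-1 *: u) = 1.
  by rewrite (snormZ aV)// gtr0_norm ?invr_gt0// mulVf ?gt_eqF.
split=> //.
  apply: (unit_coef_ge S) => //; apply: le_trans (solve_rest_small k0 fP uP) _; lra.
rewrite (rel_restZ S)//; last by rewrite invr_eq0 gt_eqF.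
apply: le_trans (solve_rel k0 fP uP) _; apply: le_trans (small_kap_step P).
have rho0 : 0 <= lam / lam2 / (1 - q) by rewrite !divr_ge0 ?subr_ge0 ?ltW.
apply: lerD; first exact: ler_wpM2l.
have e0 := eps0; have := ler_wpM2l e0 (rel_err_small k0 fP); lra.
Qed.

Lemma rel_err_eta k f : (0 < k)%N -> V f -> 2^-1 <= `|cf f| ->
  rel_err k f <= 2 * Cup * eta k f.
Proof.
move=> k0 Vf cf2; apply: le_trans (div_coef_le cf2 (snorm_ge0 _ _)) _.
by rewrite -mulrA ler_pM2l// (lev_up L).
Qed.

Lemma rel_quasi_eta k f : (0 < k)%N -> V f -> 2^-1 <= `|cf f| ->
  rel_quasi k f <= 2 * Num.sqrt (Cup ^+ 2 + gam) * eta k f.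
Proof.
move=> k0 Vf cf2; apply: le_trans (div_coef_le cf2 (sqrtr_ge0 _)) _.
by rewrite -mulrA ler_pM2l//; exact: (quasi_err_eta L).
Qed.

Lemma rel_err_quasi k f : rel_err k f <= rel_quasi k f.
Proof. by rewrite ler_wpM2r ?invr_ge0//; exact: lev_err_quasi. Qed.

Local Notation sig := (tau / theta2 / sgam).

Lemma eta_rel_quasi k f : V f -> na f = 1 -> cf f != 0 ->
  tau / theta2 * eta k f <= sig * rel_quasi k f.
Proof.
move=> Vf f1 cf0; have cp : 0 < `|cf f| by rewrite normr_gt0.
rewrite -[leRHS]mulrA ler_wpM2l//; first by rewrite divr_ge0// ltW.
rewrite ler_pdivlMl//.
apply: le_trans (eta_quasi L gam_gt0 k f) _.
rewrite ler_pdivlMr// -[leRHS]mulr1 ler_wpM2l ?sqrtr_ge0//.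
by rewrite -f1; exact: (cf_le S).
Qed.

(** Scale f so that its coefficient on z equals that of g.  The difference
    then has no component on z, so it consists of the two rests, and its
    quasi-error is bounded by their L2 norms. *)
Lemma contraction_step k f g : (0 < k)%N -> W k.+1 f -> W k.+1 g ->
  cf f != 0 -> cf g != 0 -> Q k.+1 f <= ahat * Q k f ->
  rel f <= sig * rel_quasi k f -> rel g <= sig * rel_quasi k.+1 g ->
  rel_quasi k.+1 g <= alpha * rel_quasi k f.
Proof.
move=> k0 Wf Wg cf0 cg0 fQ frel grel.
have k1 : (0 < k.+1)%N by [].
have Vf := lev_sub L k1 Wf; have Vg := lev_sub L k1 Wg.
have cp : 0 < `|cf f| by rewrite normr_gt0.
have gp : 0 < `|cf g| by rewrite normr_gt0.
set c := cf g / cf f.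
have sW := lev_lin L k1.
have Wh : W k.+1 (g - c *: f) by apply: subspaceB => //; exact: subspaceZ.
have Vh := lev_sub L k1 Wh.
have hE : g - c *: f = pe g - c *: pe f.
  by rewrite /pe /eig_rest scalerBr scalerA divfK// opprB addrA subrK.
have nbh : nb (g - c *: f) <= nb (pe g) + `|c| * nb (pe f).
  have Vpf := V_pe S Vf; have Vpg := V_pe S Vg.
  rewrite hE -(snormZ bV)//; apply: (snormB bV) => //; exact: subspaceZ.
have CQ0 : 0 <= inv_const lam Clow Coa gam.
  by rewrite mulr_ge0 ?ltW// addr_gt0// mulr_gt0// divr_gt0// addr_gt0.
have : Q k.+1 g <= `|c| * (ahat * Q k f) +
    inv_const lam Clow Coa gam * (nb (pe g) + `|c| * nb (pe f)).
  have {1}-> : g = c *: f + (g - c *: f) by rewrite addrC subrK.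
  apply: le_trans (quasi_err_lin S L gam_gt0 k1 c Vf Vh) _.
  apply: lerD; first by rewrite ler_wpM2l.
  apply: le_trans (quasi_err_inv S L Clow_gt0 Coa_gt0 gam_gt0 k1 Wh) _.
  apply: ler_wpM2l => //; exact: CQ0.
have nc : `|c| = `|cf g| / `|cf f| by rewrite normrM normrV ?unitfE.
have -> : `|c| * (ahat * Q k f) + inv_const lam Clow Coa gam *
    (nb (pe g) + `|c| * nb (pe f)) = `|cf g| * (ahat * rel_quasi k f +
    inv_const lam Clow Coa gam * (rel g + rel f)).
  by rewrite nc /rel_quasi /rel_rest; field; rewrite !gt_eqF.
rewrite mulrC -ler_pdivrMr// -/(rel_quasi k.+1 g).
set x := rel_quasi k f; set y := rel_quasi k.+1 g => hy.
have x0 : 0 <= x by exact: rel_quasi_ge0.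
have y0 : 0 <= y by exact: rel_quasi_ge0.
have {}hy : y <= ahat * x + inv_const lam Clow Coa gam * sig * (y + x).
  apply: le_trans hy _; rewrite lerD2l -mulrA ler_wpM2l// mulrDr.
  exact: lerD.
have sP := small_contr P.
set s := inv_const lam Clow Coa gam * sig in hy sP.
have s0 : 0 <= s by rewrite mulr_ge0// !divr_ge0// ltW.
have s1 : s < 1.
  have /andP[a1 a2] := alpha_bnd; have /andP[a3 a4] := ahat_01.
  have : 0 <= s * alpha by rewrite mulr_ge0//; lra.
  lra.
suff : (1 - s) * y <= (1 - s) * (alpha * x) by rewrite ler_pM2l// subr_gt0.
have := ler_wpM2r x0 sP.
lra.
Qed.

Variables (fk Uk : nat -> X) (ff Ub : nat -> nat -> X) (J el : nat -> nat) (et : nat -> R).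
Hypothesis run : adaptive_run a b z K W Rk eta Cea eps del gam theta2 ahat
  fk Uk ff Ub J el et.

(** The quasi-error has decayed as claimed; the rest of the final data is
    small compared with it; and the data that start the next level have a rest
    of size at most tau times the estimator at the start of the current stage,
    which in turn dominates the quasi-error. *)
Definition run_inv k :=
  [/\ [/\ W k (fk k), aligned (fk k), rel (fk k) <= sig * rel_quasi k (fk k) &
      rel_quasi k (fk k) <= alpha ^+ k.-1 * rel_quasi 1 (fk 1%N)],
      [/\ W k (ff k.+1 0%N), aligned (ff k.+1 0%N) &
        rel (ff k.+1 0%N) <= tau * et (el k.+1)] &
      rel_quasi k (fk k) <= 2 * Num.sqrt (Cup ^+ 2 + gam) * et (el k.+1)].

Lemma et_ge0 k : run_inv k -> 0 <= et (el k.+1).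
Proof.
move=> [_ [_ _ r] _]; rewrite -(pmulr_rge0 _ tau0).
exact: le_trans (rel_ge0 _) r.
Qed.

Let out_bound k f u w (x : R) : (0 < k)%N -> V f -> 2^-1 <= `|cf f| -> sol k f u ->
  out k u w -> 0 <= x -> eta k f <= x -> rel f <= tau / theta2 * x ->
  rel w <= tau * x.
Proof.
move=> k0 Vf cf2 uP wP x0 fx frel.
have cf0 : cf f != 0 by rewrite -normr_gt0 (lt_le_trans _ cf2)// invr_gt0.
apply: le_trans (out_rel k0 Vf cf0 uP wP) _.
have c0 : 0 <= 2 * eps * Cea * lam by rewrite !mulr_ge0// ltW.
have : rel_err k f + embed_norm * rel f <= (2 * Cup + embed_norm * (tau / theta2)) * x.
  rewrite mulrDl; apply: lerD.
    by apply: le_trans (rel_err_eta k0 Vf cf2) _; rewrite ler_wpM2l// mulr_ge0// ltW.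
  by rewrite -mulrA ler_wpM2l// ltW.
move=> /(ler_wpM2l c0)/le_trans; apply.
rewrite [leLHS]mulrA; apply: ler_wpM2r => //; apply: le_trans (small_tau_out P) _.
have := tau0; lra.
Qed.

(** The first discrete eigenfunction solves its own source problem up to a
    factor, so the bound for an eigenvalue problem holds with the same
    function on both sides; since eps is small its rest can be absorbed. *)
Lemma run_inv1 : run_inv 1.
Proof.
have k0 : (0 < 1)%N by [].
have oP := run_first run; have uP := run_sol run k0.
have fP := out_unit k0 oP; have [Vf f1 cf2 _] := fP.
have [Wf _ _ _ _] := oP; have cf0 := aligned_coef fP.
have rel_eta : rel (fk 1%N) <= tau * eta 1%N (fk 1%N).
  have := out_rel k0 Vf cf0 uP oP.
  set c := 2 * eps * Cea * lam => h.
  have c0 : 0 <= c by rewrite !mulr_ge0// ltW.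
  have h1 : c * (2 * Cup) + c * embed_norm * (tau / theta2) <= tau / 2.
    by have := small_tau_out P; rewrite -/c; lra.
  have c2 : c * embed_norm <= 2^-1.
    have ttau : tau <= tau / theta2 by rewrite ler_pdivlMr// ler_piMr// ltW.
    have ce0 : 0 <= c * embed_norm by rewrite mulr_ge0// ltW.
    have := ler_wpM2l ce0 ttau.
    have : 0 <= c * (2 * Cup) by rewrite !mulr_ge0// ltW.
    move=> x1 x2; have : c * embed_norm * tau <= 2^-1 * tau by lra.
    by rewrite ler_pM2r.
  have h2 := rel_err_eta k0 Vf cf2.
  have h3 : c * (2 * Cup) <= tau / 2.
    have : 0 <= c * embed_norm * (tau / theta2) by rewrite !mulr_ge0 ?invr_ge0// ltW.
    lra.
  have h4 := ler_wpM2r (eta0 1%N (fk 1%N)) h3.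
  have h5 := ler_wpM2l c0 h2.
  have h6 := ler_wpM2r (rel_ge0 (fk 1%N)) c2.
  lra.
split.
- split=> //.
    apply: le_trans (eta_rel_quasi 1 Vf f1 cf0).
    apply: le_trans rel_eta _; apply: ler_wpM2r => //.
    by rewrite ler_pdivlMr// ler_piMr// ltW.
  by rewrite expr0 mul1r.
- by rewrite (run_ff2 run) (run_el2 run) (run_et1 run).
- by rewrite (run_el2 run) (run_et1 run); exact: rel_quasi_eta.
Qed.

(** Each inner eigenvalue problem is posed because the estimator has dropped
    by another factor theta2, and it makes the rest drop by the same factor.
    *)
Lemma inner_inv k j : (0 < k)%N -> run_inv k -> (j <= J k.+1)%N ->
  [/\ W k.+1 (ff k.+1 j), aligned (ff k.+1 j) &
      rel (ff k.+1 j) <= tau * (theta2 ^+ j * et (el k.+1))].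
Proof.
move=> k0 inv; have e0 := et_ge0 inv; have [_ [Wf fP frel] _] := inv.
elim: j => [_|j IH jJ].
  by rewrite expr0 mul1r; split=> //; exact: (lev_nested L).
have [Wj jP jrel] := IH (ltnW jJ).
have [jeta jout] := run_inner run (k0 : (1 < k.+1)%N) jJ.
have jsol := run_inner_sol run (k0 : (1 < k.+1)%N) (ltnW jJ).
have [Vj _ cj _] := jP.
split; [by case: jout|exact: out_unit jout|].
apply: (out_bound _ Vj cj jsol jout) => //; first by rewrite mulr_ge0// exprn_ge0// ltW.
apply: le_trans jrel _; rewrite exprS.
have -> : tau / theta2 * (theta2 * theta2 ^+ j * et (el k.+1)) =
  tau * (theta2 ^+ j * et (el k.+1)) by field; rewrite gt_eqF.
by [].
Qed.

Lemma run_invS k : (0 < k)%N -> run_inv k -> run_inv k.+1.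
Proof.
move=> k0 inv; have e0 := et_ge0 inv.
have k1 : (1 < k.+1)%N by [].
have kp : (0 < k.+1)%N by [].
have [exitJ fkE UkE] := run_exit run k1.
have [Wf fP frel] := inner_inv k0 inv (leqnn _).
rewrite -fkE in exitJ Wf fP frel.
have fsol := run_sol run kp.
have [Vf f1 cf2 _] := fP; have cf0 := aligned_coef fP.
(* The inner loop is left when the estimator exceeds theta2 ^ (J + 1) et,
   while the rest is at most tau theta2 ^ J et: one factor theta2 is lost. *)
have relf : rel (fk k.+1) <= tau / theta2 * eta k.+1 (fk k.+1).
  apply: le_trans frel _.
  have -> : tau * (theta2 ^+ J k.+1 * et (el k.+1)) =
    tau / theta2 * (theta2 ^+ (J k.+1).+1 * et (el k.+1)).
    by rewrite exprS; field; rewrite gt_eqF.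
  by apply: ler_wpM2l; [rewrite divr_ge0// ltW|exact: ltW].
have relfq := le_trans relf (eta_rel_quasi k.+1 Vf f1 cf0).
have [[Wf' fP' rel' quasi'] _ quasi_et] := inv.
have step : rel_quasi k.+1 (fk k.+1) <= alpha * rel_quasi k (fk k).
  apply: contraction_step => //; [exact: (lev_nested L)|exact: aligned_coef|].
  exact: (run_contr run).
split.
- split=> //; apply: le_trans step _.
  have -> : alpha ^+ k.+1.-1 = alpha * alpha ^+ k.-1 by rewrite -exprS prednK.
  by rewrite -mulrA; exact: ler_wpM2l.
- case: (posnP (J k.+1)) => J0.
    have [-> ->] := run_same run k1 J0.
    rewrite J0 expr0 mul1r in frel.
    have [WU _] := fsol; have VU := lev_sub L kp WU.
    have cU := solve_neq0 kp fP fsol.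
    have nU : 0 < na (Uk k.+1) by rewrite (lt_le_trans _ (cf_le S VU))// normr_gt0.
    split; [|exact: solve_aligned fsol|].
      by apply: subspaceZ => //; exact: (lev_lin L).
    rewrite (rel_restZ S)//; last by rewrite invr_eq0 gt_eqF.
    apply: le_trans (solve_rel kp fP fsol) _.
    have rho0 : 0 <= lam / lam2 / (1 - q) by rewrite !divr_ge0 ?subr_ge0 ?ltW.
    have h1 := ler_wpM2l rho0 frel.
    have le0 : 0 <= 2 * lam * eps by rewrite !mulr_ge0// ltW.
    have qe : rel_quasi k.+1 (fk k.+1) <= 2 * Num.sqrt (Cup ^+ 2 + gam) * et (el k.+1).
      apply: le_trans step (le_trans _ quasi_et).
      by rewrite ler_piMl// rel_quasi_ge0.
    have h2 := ler_wpM2l le0 (le_trans (rel_err_quasi k.+1 (fk k.+1)) qe).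
    have := ler_wpM2r e0 (small_tau_step P); lra.
  have [outP ->] := run_new run k1 J0.
  split; [by case: outP|exact: out_unit outP|].
  exact: (out_bound kp Vf cf2 fsol outP).
- case: (posnP (J k.+1)) => J0.
    have [_ ->] := run_same run k1 J0.
    apply: le_trans step (le_trans _ quasi_et).
    by rewrite ler_piMl// rel_quasi_ge0.
  have [_ ->] := run_new run k1 J0; exact: rel_quasi_eta.
Qed.

Lemma run_invP k : (0 < k)%N -> run_inv k.
Proof.
elim: k => // -[|k] IH _; first exact: run_inv1.
by apply: run_invS => //; exact: IH.
Qed.

Lemma first_solution_gt0 : 0 < na (K (fk 1%N)).
Proof.
have [[_ f1P _ _] _ _] := run_inv1; have [Vf1 _ _ _] := f1P.
apply: lt_le_trans (cf_le S (spec_sol S Vf1)).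
rewrite (cf_K S)// normr_gt0 mulf_neq0 ?(aligned_coef f1P)//.
by rewrite invr_eq0 gt_eqF.
Qed.

Lemma iterate_unit k : (0 < k)%N -> na ((na (Uk k))^-1 *: Uk k) = 1.
Proof.
move=> k0; have [[_ fP _ _] _ _] := run_invP k0.
by have [] := solve_aligned k0 fP (run_sol run k0).
Qed.

Lemma iterate_rest_small k : (0 < k)%N ->
  na (pe ((na (Uk k))^-1 *: Uk k)) <= 6^-1.
Proof.
move=> k0; have [[_ fP _ _] _ _] := run_invP k0.
exact: solve_rest_small (run_sol run k0).
Qed.

(** The two sides are normalized differently: the quasi-error of the first
    data is divided by their coefficient on z, while the claim divides it by
    the energy of K applied to them.  These agree up to the factor lam and a
    relative error of order kap. *)
Lemma iterate_rest_decay k : (0 < k)%N ->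
  na (pe ((na (Uk k))^-1 *: Uk k)) * na (K (fk 1%N)) <=
    3 / 2 * alpha ^+ k.-1 * Q 1 (fk 1%N).
Proof.
move=> k0; have [[Wf fP frel quasi] _ _] := run_invP k0.
have fsol := run_sol run k0.
have [[_ f1P _ _] _ _] := run_inv1; have [Vf1 _ _ f1kap] := f1P.
have c1 : 0 < `|cf (fk 1%N)| by rewrite normr_gt0; exact: aligned_coef.
have hK : lam * na (K (fk 1%N)) <= `|cf (fk 1%N)| * (21 / 20).
  have := na_K_le S Vf1 (aligned_coef f1P) => /(ler_wpM2l (ltW lam_gt0)).
  move/le_trans; apply; rewrite mulrCA; apply: ler_wpM2l => //.
  rewrite mulrDr divff ?gt_eqF// mulrA.
  have le0 : 0 <= lam * embed_norm by rewrite mulr_ge0// ltW.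
  have := ler_wpM2l le0 f1kap; have := (small_kap P).2; lra.
have alk0 : 0 <= alpha ^+ k.-1 by rewrite exprn_ge0.
have hq : `|cf (fk 1%N)| * rel_quasi k (fk k) <= alpha ^+ k.-1 * Q 1 (fk 1%N).
  have := ler_wpM2l (normr_ge0 (cf (fk 1%N))) quasi.
  suff -> : alpha ^+ k.-1 * Q 1 (fk 1%N) =
    `|cf (fk 1%N)| * (alpha ^+ k.-1 * rel_quasi 1 (fk 1%N)) by [].
  by rewrite mulrCA; congr (_ * _); rewrite /rel_quasi mulrC divfK// gt_eqF.
have hx : na (pe ((na (Uk k))^-1 *: Uk k)) <=
    lam * (5 / 4 * rel_quasi k (fk k)) * (10 / 9).
  apply: le_trans (solve_rest k0 fP fsol) _.
  have h1 := rel_err_quasi k (fk k).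
  have h2 : embed_norm * rel (fk k) <= 4^-1 * rel_quasi k (fk k).
    have := ler_wpM2l (ltW emb0) frel.
    have := ler_wpM2r (rel_quasi_ge0 k (fk k)) (small_final P); lra.
  have h3 : lam * (rel_err k (fk k) + embed_norm * rel (fk k)) <=
            lam * (5 / 4 * rel_quasi k (fk k)).
    by rewrite ler_pM2l//; lra.
  have i0 : 0 < 1 - q by rewrite subr_gt0.
  have i1 : (1 - q)^-1 <= 10 / 9.
    by have := q10; rewrite -[(1 - q)^-1]div1r ler_pdivrMr//; lra.
  have l0 : 0 <= lam * (rel_err k (fk k) + embed_norm * rel (fk k)).
    apply: mulr_ge0; first exact: ltW.
    apply: addr_ge0; first exact: rel_err_ge0.
    by apply: mulr_ge0; [exact: ltW|exact: rel_ge0].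
  by apply: ler_pM => //; rewrite invr_ge0 ltW.
have nK := snorm_ge0 a (K (fk 1%N)).
apply: le_trans (ler_wpM2r nK hx) _.
have rq := rel_quasi_ge0 k (fk k).
have rq' : 0 <= 5 / 4 * rel_quasi k (fk k) * (10 / 9) by lra.
have := ler_wpM2l rq' hK.
have : 0 <= alpha ^+ k.-1 * Q 1 (fk 1%N) by rewrite mulr_ge0// sqrtr_ge0.
lra.
Qed.

End run.

(** * Choice of the small parameters *)

(** The order of the choices matters: q comes from the ratio of the
    eigenvalues, tau from alpha - ahat, and only then eps and del, which must
    be small compared with tau. *)
Lemma small_parameters_exist (R : realType)
    (lam lam2 Cup Clow Coa Cea gam theta2 ahat alpha : R) :
  0 < lam -> lam < lam2 -> 0 < Cup -> 0 < Clow -> 0 < Coa -> 0 < Cea ->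
  0 < gam -> 0 < theta2 < 1 -> 0 < ahat < 1 -> ahat < alpha < 1 ->
  exists q kap tau e0 d0, [/\ 0 < e0, 0 < d0 & forall eps del,
    0 <= eps <= e0 -> 0 <= del <= d0 ->
    small_parameters lam lam2 Cup Clow Coa Cea gam theta2 ahat alpha eps del q kap tau].
Proof.
move=> l0 l12 Cup0 Clow0 Coa0 Cea0 gam0 /andP[t0 t1] /andP[ah0 ah1] /andP[al0 al1].
have l20 : 0 < lam2 by exact: lt_trans l12.
have em0 : 0 < embed_norm lam by rewrite invr_gt0 sqrtr_gt0.
have sg0 : 0 < Num.sqrt gam by rewrite sqrtr_gt0.
have sc0 : 0 < Num.sqrt (Cup ^+ 2 + gam) by rewrite sqrtr_gt0 addr_gt0// exprn_gt0.
have ic0 : 0 < inv_const lam Clow Coa gam.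
  by rewrite mulr_gt0// addr_gt0// mulr_gt0// divr_gt0// addr_gt0.
set rho := lam / lam2.
have rho0 : 0 < rho by rewrite divr_gt0.
have rho1 : rho < 1 by rewrite ltr_pdivrMr// mul1r.
set q := Num.min 10^-1 ((1 - rho) / 2).
have q0 : 0 < q by rewrite lt_min; apply/andP; split; lra.
have q10 : q <= 10^-1 by rewrite ge_min lexx.
have qrho : q <= (1 - rho) / 2 by rewrite ge_min lexx orbT.
have q1 : 0 < 1 - q by lra.
set rho' := rho / (1 - q).
have r1 : rho' < 1 by rewrite ltr_pdivrMr//; lra.
set kap := 20^-1 / (lam * embed_norm lam).
have kap0 : 0 < kap by rewrite divr_gt0// mulr_gt0.
set s := Num.min ((alpha - ahat) / (inv_const lam Clow Coa gam * (1 + alpha)))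
                 (4^-1 / embed_norm lam).
have ica0 : 0 < inv_const lam Clow Coa gam * (1 + alpha).
  by rewrite mulr_gt0//; lra.
have s0 : 0 < s by rewrite lt_min !divr_gt0 ?subr_gt0.
have s1 : s <= (alpha - ahat) / (inv_const lam Clow Coa gam * (1 + alpha)).
  by rewrite ge_min lexx.
have s2 : s <= 4^-1 / embed_norm lam by rewrite ge_min lexx orbT.
set tau := s * theta2 * Num.sqrt gam.
have tau0 : 0 < tau by rewrite !mulr_gt0.
have sE : tau / theta2 / Num.sqrt gam = s by rewrite /tau; field; rewrite !gt_eqF.
set c1 := 2 * lam * (2 * Num.sqrt (Cup ^+ 2 + gam)).
have c10 : 0 < c1 by rewrite !mulr_gt0.
set c2 := 2 * Cea * lam * (2 * Cup + embed_norm lam * (tau / theta2)).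
have c20 : 0 < c2 by rewrite !mulr_gt0// addr_gt0// !mulr_gt0// invr_gt0.
set e0 := Num.min (Num.min (q / (lam * embed_norm lam)) (Num.min ((1 - rho') * kap) kap))
  (Num.min ((1 - rho') * tau / c1) (tau / 2 / c2)).
have le0 : 0 < lam * embed_norm lam by rewrite mulr_gt0.
exists q, kap, tau, e0, (Num.min 20^-1 (2^-1 / Cea)); split.
- have r0 : 0 < 1 - rho' by rewrite subr_gt0.
  have h1 := divr_gt0 (mulr_gt0 r0 tau0) c10.
  have h2 : 0 < tau / 2 / c2 by rewrite !divr_gt0.
  by rewrite /e0 !lt_min (divr_gt0 q0 le0) kap0 (mulr_gt0 r0 kap0) h1 h2.
- by rewrite lt_min divr_gt0//; lra.
move=> eps del /andP[eps0]; rewrite !le_min.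
move=> /andP[/andP[e1 /andP[e2 e3]] /andP[e4 e5]] /andP[d0 /andP[d1 d2]].
rewrite !ler_pdivlMr// in e1 e4 e5 d2.
rewrite ler_pdivlMr// in s1; rewrite ler_pdivlMr// in s2.
split.
- exact: eps0.
- by rewrite d0.
- by rewrite q0.
- by split=> //; rewrite /kap mulrC divfK ?gt_eqF.
- exact: tau0.
- by rewrite mulrC.
- by rewrite mulrC.
- by rewrite -/rho -/rho'; lra.
- exact: e3.
- by rewrite -/rho -/rho'; move: e4; rewrite /c1; lra.
- by move: e5; rewrite /c2; lra.
- by rewrite sE; lra.
- by rewrite sE mulrC.
Qed.

(** * Measurable sets of row vectors *)

Section row_topology.
Variables (R : realType) (n : nat).
Local Notation vec := 'rV[R]_n.

Definition rat_box (p : 'rV[rat]_n * nat) : set vec :=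
  [set x | forall i, `|x 0 i - ratr (p.1 0 i)| < p.2.+1%:R^-1].

Lemma measurable_rat_box p : measurable (rat_box p).
Proof.
rewrite (_ : rat_box p = \bigcap_(i in [set: 'I_n])
  ((fun x : vec => x 0 i : measurableTypeR R) @^-1`
    [set t | `|t - ratr (p.1 0 i)| < p.2.+1%:R^-1])); last first.
  by apply/seteqP; split => x /= xi i => [_|]; exact: xi.
apply: fin_bigcap_measurable => // i _.
rewrite -[X in measurable X]setTI; apply: measurable_coord => //.
rewrite (_ : [set t | _] = ball (ratr (p.1 0 i) : R) p.2.+1%:R^-1).
  by apply: open_measurable; apply: ball_open; rewrite invr_gt0.
by apply/seteqP; split => t; rewrite /ball/= distrC.
Qed.

(** Boxes with rational centre and size 1 / (n + 1) are countably many, and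
    they form a base of the topology. *)
Lemma open_rat_boxes (A : set vec) : open A ->
  A = \bigcup_(p in [set p | rat_box p `<=` A]) rat_box p.
Proof.
move=> oA; apply/seteqP; split=> [x Ax|x [p pA] px]; last exact: pA.
have [e /= e0 eA] : exists2 e : R, 0 < e & ball x e `<=` A.
  by have /nbhs_ballP[e e0 eA] := open_nbhs_nbhs (conj oA Ax); exists e.
have [k] : exists k, 0 + k.+1%:R^-1 < e / 2 by apply: ltr_add_invr; rewrite divr_gt0.
rewrite add0r => ke.
have k0 : 0 < k.+1%:R^-1 :> R by rewrite invr_gt0.
set h : R := k.+1%:R^-1 in ke k0.
have /choice[c cP] : forall i : 'I_n, exists r : rat, `|x 0 i - ratr r| < h.
  move=> i; have : x 0 i < x 0 i + h by rewrite ltrDl.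
  move=> /rat_in_itvoo[r]; rewrite in_itv/= => /andP[xr rx].
  by exists r; rewrite distrC ltr_norml; apply/andP; split; lra.
exists (\row_i c i, k); last by move=> i; rewrite mxE; exact: cP.
move=> y yb; apply: eA; split=> // i j; rewrite ord1.
have := yb j; have := cP j; rewrite /= !mxE /ball/= -/h => h1 h2.
have -> : x 0 j - y 0 j = (x 0 j - ratr (c j)) - (y 0 j - ratr (c j)).
  by rewrite opprB addrA subrK.
apply: le_lt_trans (ler_normB _ _) _; lra.
Qed.

Lemma row_open_measurable (A : set vec) : open A -> measurable A.
Proof.
move=> /open_rat_boxes ->; rewrite bigcup_mkcond.
apply: countable_bigcupT_measurable; first exact: countableP.
by move=> p; case: ifPn => // _; exact: measurable_rat_box.
Qed.

Lemma row_closed_measurable (A : set vec) : closed A -> measurable A.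
Proof. by move/closed_openC/row_open_measurable/measurableC; rewrite setCK. Qed.

Lemma row_continuous_within_measurable (D : set vec) (f : vec -> R) :
  measurable D -> {within D, continuous f} -> measurable_fun D f.
Proof.
move=> mD /continuousP cf; apply: (measurability _ (RGenOpens.measurableE R)).
move=> _ [_ [a [b ->] <-]].
have oab : open `]a, b[%classic by exact: interval_open.
have /open_subspaceP [U oU UD] := cf _ oab.
rewrite setIC -UD; apply: measurableI => //; exact: row_open_measurable.
Qed.

Lemma row_continuous_measurable (D : set vec) (f : vec -> R) :
  measurable D -> continuous f -> measurable_fun D f.
Proof.
move=> mD cf; apply: row_continuous_within_measurable => //.
exact: continuous_subspaceT.
Qed.

Lemma compact_row_measurable (A : set vec) : compact A -> measurable A.
Proof.
by move=> /compact_closed cA; apply: row_closed_measurable; apply: cA; exact: norm_hausdorff.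
Qed.

Lemma row_bounded_finite (A : set vec) (r : R) : measurable A ->
  (forall x, A x -> forall i, `|x 0 i| <= r) -> (leb R n A < +oo)%E.
Proof.
move=> mA Ar; set B := [set x : vec | forall i, x 0 i \in
    `[(const_mx (- `|r|) : vec) 0 i, (const_mx `|r| : vec) 0 i]].
have mB : measurable B.
  rewrite (_ : B = \bigcap_(i in [set: 'I_n])
    ((fun x : vec => x 0 i : measurableTypeR R) @^-1`
      `[(const_mx (- `|r|) : vec) 0 i, (const_mx `|r| : vec) 0 i]%classic)).
    apply: fin_bigcap_measurable => // i _.
    by rewrite -[X in measurable X]setTI; exact: measurable_coord.
  by apply/seteqP; split => x /= xi i => [_|]; exact: xi.
have AB : A `<=` B.
  move=> x /Ar xr i; rewrite !mxE in_itv/= -ler_norml.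
  exact: le_trans (xr i) (ler_norm r).
have Bfin : (leb R n B < +oo)%E.
  rewrite [X in (X < _)%E](leb_box (a := const_mx (- `|r|)) (b := const_mx `|r|)) ?ltry//.
  by move=> i; rewrite !mxE lerNl (le_trans _ (normr_ge0 r))// oppr_le0.
by apply: le_lt_trans Bfin; apply: le_measure; rewrite ?inE.
Qed.

End row_topology.

(** * Square-integrable functions *)

Section square_integrable.
Variables (R : realType) (n : nat) (D : set 'rV[R]_n).
Hypothesis mD : measurable D.
Local Notation vec := 'rV[R]_n.
Local Notation mu := (leb R n).
Implicit Types f g h : vec -> R^o.
Local Notation itg f := (mu.-integrable D (EFin \o (f : vec -> R))).

Lemma itgD f g : itg f -> itg g -> itg (f \+ g).
Proof.
move=> fi gi; rewrite (_ : EFin \o _ = (EFin \o f) \+ (EFin \o g))%E//.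
exact: integrableD.
Qed.

Lemma itgZ (c : R) f : itg f -> itg (fun x => c * f x).
Proof. by move=> fi; exact: (integrableZl mD c fi). Qed.

Lemma itg_sum (I : Type) (s : seq I) (Q : pred I) (f : I -> vec -> R) :
  (forall i, Q i -> itg (f i)) -> itg (fun x => \sum_(i <- s | Q i) f i x).
Proof.
move=> fi; rewrite (_ : EFin \o _ = (fun x => \sum_(i <- s | Q i) (f i x)%:E)%E).
  exact: integrable_sum.
by apply/funext => x; rewrite /= sumEFin.
Qed.

(** The coefficients of the equation are bounded almost everywhere only, so
    domination is needed in this form. *)
Lemma integrable_ae_dom f g : measurable_fun D f -> itg g ->
  {ae mu, forall x, D x -> `|f x| <= `|g x|} -> itg f.
Proof.
move=> mf /integrableP[mg gi] fg; apply/integrableP; split.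
  exact/measurable_EFinP.
apply: le_lt_trans gi; apply: ae_ge0_le_integral => //.
- by apply: measurableT_comp => //; exact/measurable_EFinP.
- exact: measurableT_comp.
Qed.

Lemma L2_meas f : L2 D f -> measurable_fun D f. Proof. by case. Qed.

Lemma L2_mul f g : L2 D f -> L2 D g -> itg (fun x => f x * g x).
Proof.
move=> [mf fi] [mg gi]; apply: (@integrable_ae_dom _ (fun x => f x ^+ 2 + g x ^+ 2)).
- exact: measurable_funM.
- exact: itgD.
- apply: aeW => x _; rewrite normrM [leRHS]ger0_norm ?addr_ge0 ?sqr_ge0//.
  rewrite -(real_normK (num_real (f x))) -(real_normK (num_real (g x))).
  have : 0 <= (`|f x| - `|g x|) ^+ 2 by exact: sqr_ge0.
  have : 0 <= (`|f x| + `|g x|) ^+ 2 by exact: sqr_ge0.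
  rewrite sqrrB sqrrD; lra.
Qed.

Lemma L2_lin (c : R) f g : L2 D f -> L2 D g -> L2 D (c *: f + g).
Proof.
move=> fL gL; have [mf fi] := fL; have [mg gi] := gL; split.
  by apply: measurable_funD => //; exact: measurable_funM.
rewrite (_ : (fun x => _) = EFin \o ((fun x => c ^+ 2 * f x ^+ 2) \+
  ((fun x => (2 * c) * (f x * g x)) \+ (fun x => g x ^+ 2)))).
  apply: itgD; first exact: itgZ.
  by apply: itgD => //; apply: itgZ; exact: L2_mul.
apply/funext => x /=; congr EFin.
by rewrite -[(c *: f + g) x]/(c * f x + g x) /=; ring.
Qed.

Lemma L2_0 : L2 D (0 : vec -> R^o).
Proof.
split; first exact: measurable_cst.
rewrite (_ : (fun x => _) = cst 0%E); first exact: integrable0.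
by apply/funext => x /=; rewrite expr0n.
Qed.

Lemma L2_subspace : linear_subspace (L2 D : set (vec -> R^o)).
Proof. by split; [exact: L2_0|move=> c u v; exact: L2_lin]. Qed.

Lemma ip_semi_inner : semi_inner (L2 D : set (vec -> R^o)) (ip D).
Proof.
split; first exact: L2_subspace.
- move=> c u v w uL vL wL; rewrite /ip -RintegralZl//; last exact: L2_mul.
  rewrite -RintegralD//; [|exact/itgZ/L2_mul|exact: L2_mul].
  apply: eq_Rintegral => x _.
  by rewrite -[(c *: u + v) x]/(c * u x + v x) mulrDl mulrA.
- by move=> u v _ _; apply: eq_Rintegral => x _; rewrite mulrC.
- by move=> u _; apply: Rintegral_ge0 => x _; rewrite -expr2 sqr_ge0.
Qed.

Lemma norm2_snorm f : norm2 D f = snorm (ip D) f. Proof. by []. Qed.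

Lemma L2_ae_mul (M : R) f h : L2 D f -> measurable_fun D h ->
  {ae mu, forall x, D x -> `|h x| <= M} -> L2 D (fun x => h x * f x).
Proof.
move=> [mf fi] mh hM; split; first exact: measurable_funM.
apply: (@integrable_ae_dom (fun x => (h x * f x) ^+ 2) (fun x => M ^+ 2 * f x ^+ 2)).
- by apply: measurable_funX; exact: measurable_funM.
- exact: itgZ.
apply: filterS hM => x hM /hM {}hM.
have M0 : 0 <= M ^+ 2 * f x ^+ 2 by rewrite mulr_ge0// sqr_ge0.
rewrite (ger0_norm (sqr_ge0 _)) (ger0_norm M0) exprMn ler_wpM2r ?sqr_ge0//.
by rewrite -(real_normK (num_real (h x))) ler_sqr ?nnegrE// (le_trans _ hM).
Qed.

Lemma L2_cst (c : R) : (mu D < +oo)%E -> L2 D (cst c).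
Proof.
move=> Dfin; split; first exact: measurable_cst.
rewrite (_ : (fun x => _) = cst (c ^+ 2)%:E)//.
by apply/integrableP; split=> //=; rewrite integral_cst//= lte_mul_pinfty.
Qed.

Lemma L2_ae_bounded (M : R) h : (mu D < +oo)%E -> measurable_fun D h ->
  {ae mu, forall x, D x -> `|h x| <= M} -> L2 D h.
Proof.
move=> Dfin mh hM; have := L2_ae_mul (L2_cst 1 Dfin) mh hM.
by rewrite (_ : (fun x => _) = h)//; apply/funext => x /=; rewrite mulr1.
Qed.

Lemma L2_bounded (M : R) h : (mu D < +oo)%E -> measurable_fun D h ->
  (forall x, D x -> `|h x| <= M) -> L2 D h.
Proof. by move=> Df mh hM; apply: L2_ae_bounded Df mh (aeW _ hM). Qed.

Lemma L2_subset (D' : set vec) f : measurable D' -> D' `<=` D -> L2 D f -> L2 D' f.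
Proof.
move=> mD' DD [mf fi]; split; first exact: measurable_funS mf.
exact: integrableS fi.
Qed.

Lemma eq_L2 f g : {in D, f =1 g} -> L2 D f -> L2 D g.
Proof.
move=> fg [mf fi]; split; first exact: eq_measurable_fun mf.
by apply: eq_integrable fi => // x xD; rewrite /= fg.
Qed.

Lemma L2_sum (I : Type) (s : seq I) (F : I -> vec -> R) :
  (forall i, L2 D (F i)) -> L2 D (fun x => \sum_(i <- s) F i x).
Proof.
move=> FL; elim: s => [|i s IH].
  apply: eq_L2 L2_0 => x _; exact/esym/big_nil.
have := L2_lin 1 (FL i) IH; apply: eq_L2 => x _.
by rewrite scale1r [RHS]big_cons.
Qed.

End square_integrable.

(** * Polynomial functions and simplices *)

Section polynomial_functions.
Variables (R : realType) (d : nat).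
Local Notation vec := 'rV[R]_d.
Implicit Types (f g : vec -> R) (i : 'I_d).

(** Polynomial functions without a bound on the degree: stable under products
    and partial derivatives, and open to structural induction. *)
Inductive polyf : (vec -> R) -> Prop :=
| polyf_cst c : polyf (fun=> c)
| polyf_coord i : polyf (fun x => x 0 i)
| polyf_add f g : polyf f -> polyf g -> polyf (fun x => f x + g x)
| polyf_mul f g : polyf f -> polyf g -> polyf (fun x => f x * g x).

Lemma polyf_sum (I : Type) (s : seq I) (Q : pred I) (F : I -> vec -> R) :
  (forall i : I, polyf (F i)) -> polyf (fun x => \sum_(i <- s | Q i) F i x).
Proof.
move=> pF; elim: s => [|i s IH].
  by under eq_fun do rewrite big_nil; exact: polyf_cst.
under eq_fun do rewrite big_cons; case: (Q i) => //; exact: polyf_add.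
Qed.

Lemma polyf_prod (I : Type) (s : seq I) (Q : pred I) (F : I -> vec -> R) :
  (forall i : I, polyf (F i)) -> polyf (fun x => \prod_(i <- s | Q i) F i x).
Proof.
move=> pF; elim: s => [|i s IH].
  by under eq_fun do rewrite big_nil; exact: polyf_cst.
under eq_fun do rewrite big_cons; case: (Q i) => //; exact: polyf_mul.
Qed.

Lemma polyf_exp f k : polyf f -> polyf (fun x => f x ^+ k).
Proof.
move=> pf; elim: k => [|k IH]; first exact: polyf_cst.
by under eq_fun do rewrite exprS; exact: polyf_mul.
Qed.

Lemma poly_fun_polyf m f : poly_fun m f -> polyf f.
Proof.
move=> [c ->]; apply: polyf_sum => a; apply: polyf_mul; first exact: polyf_cst.
by apply: polyf_prod => i; apply: polyf_exp; exact: polyf_coord.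
Qed.

Lemma poly_fun_lin m (c : R) f g : poly_fun m f -> poly_fun m g ->
  poly_fun m (fun x => c * f x + g x).
Proof.
move=> [u ->] [v ->]; exists (fun a => c * u a + v a); apply/funext => x.
by rewrite mulr_sumr -big_split/=; apply: eq_bigr => a _; rewrite mulrDl mulrA.
Qed.

Lemma poly_fun_0 m : poly_fun m (fun _ : vec => 0).
Proof.
exists (fun=> 0); apply/funext => x; rewrite big1// => a _; exact: mul0r.
Qed.

Lemma polyf_lin (c : R) f g : polyf f -> polyf g -> polyf (fun x => c * f x + g x).
Proof.
by move=> pf pg; apply: polyf_add => //; apply: polyf_mul => //; exact: polyf_cst.
Qed.

Lemma polyf_continuous f : polyf f -> continuous f.
Proof.
elim=> [c|i|{}f g _ cf _ cg|{}f g _ cf _ cg] x.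
- exact: cst_continuous.
- exact: coord_continuous.
- exact: (cvgD (cf x) (cg x)).
- exact: (cvgM (cf x) (cg x)).
Qed.

(** On lines a polynomial function is a univariate polynomial, which gives its
    partial derivatives and its zeros. *)
Lemma polyf_line f (x v : vec) : polyf f ->
  exists q : {poly R}, forall t, f (x + t *: v) = q.[t].
Proof.
elim=> [c|i|{}f g _ [p pE] _ [q qE]|{}f g _ [p pE] _ [q qE]].
- by exists c%:P => t; rewrite hornerC.
- exists ((x 0 i)%:P + (v 0 i)%:P * 'X) => t.
  by rewrite !hornerE !mxE mulrC.
- by exists (p + q) => t; rewrite hornerD pE qE.
- by exists (p * q) => t; rewrite hornerM pE qE.
Qed.

Lemma partial_line i f x (q : {poly R}) :
  (forall t, f (x + t *: delta_mx 0 i) = q.[t]) -> partial i f x = q^`().[0].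
Proof.
move=> fq; rewrite /partial (_ : (fun t => _) = horner q); last exact/funext.
by rewrite -derivE.
Qed.

Lemma partial_polyfD i f g : polyf f -> polyf g ->
  partial i (fun x => f x + g x) = (fun x => partial i f x + partial i g x).
Proof.
move=> pf pg; apply/funext => x.
have [p pE] := polyf_line x (delta_mx 0 i) pf.
have [q qE] := polyf_line x (delta_mx 0 i) pg.
rewrite (partial_line pE) (partial_line qE).
rewrite (@partial_line _ _ _ (p + q)) ?derivD ?hornerD// => t.
by rewrite hornerD pE qE.
Qed.

Lemma partial_polyfM i f g : polyf f -> polyf g ->
  partial i (fun x => f x * g x) =
  (fun x => partial i f x * g x + f x * partial i g x).
Proof.
move=> pf pg; apply/funext => x.
have [p pE] := polyf_line x (delta_mx 0 i) pf.
have [q qE] := polyf_line x (delta_mx 0 i) pg.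
have p0 := pE 0; have q0 := qE 0; rewrite !scale0r !addr0 in p0 q0.
rewrite (partial_line pE) (partial_line qE) p0 q0.
rewrite (@partial_line _ _ _ (p * q)) ?derivM ?hornerE// => t.
by rewrite hornerM pE qE.
Qed.

Lemma partial_cst i (c : R) : partial i (fun _ : vec => c) = fun=> 0.
Proof.
by apply/funext => x; rewrite (@partial_line _ _ _ c%:P) ?derivC ?horner0// => t; rewrite hornerC.
Qed.

Lemma polyf_partial i f : polyf f -> polyf (partial i f).
Proof.
elim=> [c|j|{}f g pf pf' pg pg'|{}f g pf pf' pg pg'].
- by rewrite partial_cst; exact: polyf_cst.
- rewrite (_ : partial i _ = fun=> (i == j)%:R); first exact: polyf_cst.
  apply/funext => x; rewrite (@partial_line _ _ _ ((x 0 j)%:P + (i == j)%:R%:P * 'X)).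
    by rewrite derivD derivC add0r derivM derivC mul0r add0r derivX mulr1 hornerC.
  by move=> t; rewrite !hornerE !mxE eqxx/= mulrC eq_sym.
- by rewrite partial_polyfD//; exact: polyf_add.
- by rewrite partial_polyfM//; apply: polyf_add; exact: polyf_mul.
Qed.

Lemma partial_polyf_lin i (c : R) f g : polyf f -> polyf g ->
  partial i (fun x => c * f x + g x) =
  (fun x => c * partial i f x + partial i g x).
Proof.
move=> pf pg; rewrite (partial_polyfD i (polyf_mul (polyf_cst c) pf) pg).
apply/funext => x; rewrite (partial_polyfM i (polyf_cst c) pf) partial_cst.
by rewrite mul0r add0r.
Qed.

End polynomial_functions.

Section simplices.
Variables (R : realType) (d : nat).
Local Notation vec := 'rV[R]_d.
Local Notation conv := (@Defs.conv R d).
Implicit Types (S : simplex R d) (f : vec -> R).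

Lemma fset_sum_nth (M : nmodType) S k (F : vec -> M) : #|` S|%fset = k ->
  \sum_(v <- S) F v = \sum_(i < k) F (nth 0 S i).
Proof. by move=> <-; rewrite (big_nth 0) big_mkord. Qed.

(** The hull is the continuous image of the compact simplex of coefficients.
    *)
Lemma conv_compact S : compact (conv S).
Proof.
pose k := #|` S|%fset.
pose phi (t : 'rV[R]_k) : vec := \sum_(i < k) t 0 i *: nth 0 S i.
pose D : set 'rV[R]_k := [set t | (forall i, 0 <= t 0 i) /\ \sum_i t 0 i = 1].
have -> : conv S = phi @` D.
  apply/seteqP; split=> x.
    move=> [c [c0 c1 ->]]; exists (\row_i c (nth 0 S i)); first split.
    - by move=> i; rewrite mxE; apply: c0; rewrite mem_nth.
    - under eq_bigr do rewrite mxE.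
      by rewrite -(fset_sum_nth (k := k)).
    - rewrite /phi (fset_sum_nth (k := k))//.
      by apply: eq_bigr => i _; rewrite mxE.
  move=> [t [t0 t1] <-].
  pose c (v : vec) := \sum_(i < k | nth 0 (S : seq vec) i == v) t 0 i.
  have cE (i : 'I_k) : c (nth 0 (S : seq vec) i) = t 0 i.
    rewrite /c (big_pred1 i)// => j /=.
    by rewrite nth_uniq ?fset_uniq//.
  exists c; split.
  - by move=> v _; exact: sumr_ge0.
  - by rewrite (fset_sum_nth (k := k))// -[RHS]t1; apply: eq_bigr => i _; rewrite cE.
  - by rewrite (fset_sum_nth (k := k))//; apply: eq_bigr => i _; rewrite cE.
have cphi : continuous phi.
  move=> t; apply: (@cvg_big _ _ _ _ _ add_continuous _ _ _ _ _ (nbhs_filter t)) => i _; apply: cvgZ.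
    exact: coord_continuous.
  exact: cvg_cst.
have csum : continuous (fun t : 'rV[R]_k => \sum_i t 0 i).
  by move=> t; apply: (@cvg_big _ _ _ _ _ add_continuous _ _ _ _ _ (nbhs_filter t)) => i _; exact: coord_continuous.
apply: continuous_compact; first exact: continuous_subspaceT.
have cube : compact [set v : 'rV[R]_k | forall i, v ord0 i \in `[0, 1]].
  by apply: (@rV_compact R k (fun=> `[0, 1]%classic)) => _; exact: segment_compact.
apply: subclosed_compact cube _.
  rewrite (_ : D = (\bigcap_(i in [set: 'I_k]) (fun t : 'rV[R]_k => t 0 i) @^-1` [set r | 0 <= r])
      `&` (fun t : 'rV[R]_k => \sum_i t 0 i) @^-1` [set 1]); last first.
    apply/seteqP; split=> t /= [t0 t1]; split=> //; first by move=> i _; exact: t0.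
    by move=> i; exact: t0.
  apply: closedI; last by apply: preimage_closed; [move=> x _; exact: csum|exact: closed_eq].
  apply: closed_bigI => i _.
  by apply: preimage_closed; [move=> x _; exact: coord_continuous|exact: closed_ge].
move=> t [t0 t1] i /=; rewrite in_itv/= t0 -t1 (bigD1 i)//= lerDl.
by apply: sumr_ge0 => j _.
Qed.

(** The square matrix with rows (1, v), for v a vertex, is invertible: its
    left kernel consists of affine dependencies. *)
Lemma simplex_affine_span S (y : vec) : is_simplex S ->
  exists c : vec -> R, \sum_(v <- S) c v = 1 /\ \sum_(v <- S) c v *: v = y.
Proof.
move=> [S1 Saff].
pose M : 'M[R]_(d.+1, 1 + d) := \matrix_(i < d.+1) row_mx 1 (nth 0 (S : seq vec) i).
pose c (u : 'rV[R]_d.+1) (v : vec) := u 0 (inord (index v (S : seq vec))).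
have cE u (i : 'I_d.+1) : c u (nth 0 (S : seq vec) i) = u 0 i.
  by rewrite /c index_uniq ?fset_uniq ?S1// inord_val.
have sumE u : u *m M = row_mx (\sum_(v <- S) c u v)%:M (\sum_(v <- S) c u v *: v).
  rewrite mulmx_sum_row !(fset_sum_nth _ S1).
  under eq_bigr do rewrite rowK scale_row_mx -cE.
  have h (s : seq 'I_d.+1) : \sum_(i <- s) row_mx (c u (nth 0 (S : seq vec) i) *: 1)
        (c u (nth 0 (S : seq vec) i) *: nth 0 (S : seq vec) i) =
      row_mx (\sum_(i <- s) c u (nth 0 (S : seq vec) i))%:M
        (\sum_(i <- s) c u (nth 0 (S : seq vec) i) *: nth 0 (S : seq vec) i).
    elim: s => [|i s IH]; first by rewrite !big_nil raddf0 row_mx0.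
    by rewrite !big_cons IH add_row_mx raddfD/= scalemx1.
  exact: h.
have freeM : row_free M.
  rewrite -kermx_eq0; apply/eqP/row_matrixP => i; rewrite row0.
  have := mulmx_ker M => /(congr1 (row i)); rewrite row_mul row0.
  set u := row i (kermx M); rewrite sumE => /eqP.
  rewrite row_mx_eq0 => /andP[/eqP u1 /eqP u2].
  have {}u1 : \sum_(v <- S) c u v = 0.
    by have := congr1 (fun A : 'M[R]_1 => A 0 0) u1; rewrite !mxE eqxx mulr1n.
  apply/rowP => j; rewrite -cE mxE.
  by apply: (Saff (c u) u1 u2); rewrite mem_nth// S1.
have fullM : row_full M by rewrite /row_full; exact: freeM.
have /submxP[u uE] := submx_full (row_mx 1 y) fullM.
exists (c u); move: uE; rewrite sumE => /eq_row_mx[h1 h2]; split=> //.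
by have := congr1 (fun A : 'M[R]_1 => A 0 0) h1; rewrite !mxE eqxx mulr1n.
Qed.

(** The line from the barycentre to y starts inside the simplex, so the
    univariate polynomial obtained on it has infinitely many zeros. *)
Lemma polyf_eq0_simplex S f : is_simplex S -> polyf f ->
  (forall x, conv S x -> f x = 0) -> forall y, f y = 0.
Proof.
move=> Ssim pf f0 y; have [c [c1 cy]] := simplex_affine_span y Ssim.
have [S1 _] := Ssim.
pose N : R := d.+1%:R^-1.
have N0 : 0 < N by rewrite invr_gt0.
pose x0 : vec := \sum_(v <- S) N *: v.
have sumN : \sum_(v <- S) N = 1.
  by rewrite (fset_sum_nth _ S1) sumr_const card_ord -[N *+ _]mulr_natr mulVf.
pose B := 1 + \sum_(v <- S) `|c v|.
have B0 : 0 < B by rewrite ltr_pwDl// sumr_ge0.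
pose t0 := N / (N + B).
have t00 : 0 < t0 by rewrite divr_gt0// addr_gt0.
have inS t : 0 <= t <= t0 -> conv S (x0 + t *: (y - x0)).
  move=> /andP[tge tle]; exists (fun v => (1 - t) * N + t * c v); split.
  - move=> v vS.
    have cB : `|c v| <= B.
      rewrite /B (perm_big _ (perm_to_rem vS))/= big_cons addrCA lerDl.
      by rewrite addr_ge0// sumr_ge0.
    have : t * (N + B) <= N by rewrite -ler_pdivlMr// addr_gt0.
    have : t * - c v <= t * B.
      by apply: ler_wpM2l => //; rewrite (le_trans _ cB)// -normrN ler_norm.
    lra.
  - by rewrite big_split/= -!mulr_sumr sumN c1; ring.
  - under eq_bigr do rewrite scalerDl -!scalerA.
    rewrite big_split/= -!scaler_sumr cy -/x0 scalerBl scale1r scalerBr.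
    have -> : N *: \sum_(v <- S) v = x0 by rewrite /x0 scaler_sumr.
    by rewrite [LHS]addrA [RHS]addrAC.
have [q qE] := polyf_line x0 (y - x0) pf.
have q0 : q = 0.
  apply/eqP; apply: contraT => qn0.
  pose rs := [seq t0 / k.+1%:R | k <- iota 0 (size q)].
  have := @max_poly_roots _ q rs qn0; rewrite size_map size_iota ltnn; apply.
    apply/allP => _ /mapP[k _ ->]; rewrite /root -qE f0//; apply: inS.
    rewrite divr_ge0 ?(ltW t00)//= ler_pdivrMr// ler_peMr ?(ltW t00)//.
    by rewrite ler1n.
  rewrite map_inj_in_uniq ?iota_uniq// => k l _ _ /(mulfI (lt0r_neq0 t00))/invr_inj/eqP.
  by rewrite eqr_nat eqSS => /eqP.
by have := qE 1; rewrite q0 horner0 scale1r addrC subrK.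
Qed.

End simplices.

(** * The spectral gap *)

(** Approximate v by a finite combination of the eigenvectors.  As v is
    orthogonal to e 0, dropping the first coefficient improves the
    approximation, and on combinations of the others the inequality holds term
    by term. *)
Lemma spectral_gap (R : realType) (X : lmodType R) (V : set X)
    (a b : X -> X -> R) (C : R) (lam : nat -> R) (e : nat -> X) :
  semi_inner V a -> semi_inner V b ->
  (forall v, V v -> snorm b v <= C * snorm a v) ->
  (forall i, V (e i)) -> (forall i j, a (e i) (e j) = (i == j)%:R) ->
  (forall i v, V v -> a (e i) v = lam i * b (e i) v) ->
  0 < lam 1%N -> (forall i, lam 1%N <= lam i.+1) ->
  (forall v, V v -> forall eps, 0 < eps -> exists n (c : nat -> R),
     snorm a (v - \sum_(i < n) c i *: e i) < eps) ->
  forall v, V v -> a v (e 0%N) = 0 -> lam 1%N * b v v <= a v v.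
Proof.
move=> aV bV bC Ve eo elam l1 lamle edense v Vv v0.
have sV := semi_inner_sub aV.
have [l1s l1s0] : Num.sqrt (lam 1%N) ^+ 2 = lam 1%N /\ 0 < Num.sqrt (lam 1%N).
  by rewrite sqr_sqrtr ?ltW// sqrtr_gt0.
set s1 := Num.sqrt _ in l1s l1s0.
suff key : s1 * snorm b v <= snorm a v.
  rewrite -(snorm_sqr aV)// -(snorm_sqr bV)// -l1s -exprMn.
  by rewrite ler_sqr ?nnegrE ?mulr_ge0 ?snorm_ge0// ltW.
have C0 : 0 <= `|C| by [].
have bC' w : V w -> snorm b w <= `|C| * snorm a w.
  by move=> Vw; apply: le_trans (bC w Vw) _; rewrite ler_wpM2r ?snorm_ge0// ler_norm.
apply/ler_addgt0Pr => eps eps0.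
have k0 : 0 < 1 + s1 * `|C| by rewrite ltr_pwDl// mulr_ge0// ltW.
have [n [c cP]] := edense v Vv _ (divr_gt0 eps0 k0).
pose c' i := if i == 0%N then 0 else c i.
pose t := \sum_(i < n) c' i *: e i.
have Vsum (f : nat -> R) : V (\sum_(i < n) f i *: e i).
  by apply: subspace_sum => // i _; exact: subspaceZ.
have Vt : V t by exact: Vsum.
have Vvt := subspaceB sV Vv Vt.
have a_sum (f : nat -> R) w : V w ->
    a (\sum_(i < n) f i *: e i) w = \sum_(i < n) f i * a (e i) w.
  move=> Vw; elim: {c cP c' t Vsum Vt Vvt} n => [|n IH].
    by rewrite !big_ord0 (sip0l aV).
  rewrite !big_ord_recr/= (sipDl aV) ?IH ?(sipZl aV)//; last exact: subspaceZ.
  by apply: subspace_sum => // i _; exact: subspaceZ.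
have b_sum (f : nat -> R) w : V w ->
    b (\sum_(i < n) f i *: e i) w = \sum_(i < n) f i * b (e i) w.
  move=> Vw; elim: {c cP c' t Vsum Vt Vvt a_sum} n => [|n IH].
    by rewrite !big_ord0 (sip0l bV).
  rewrite !big_ord_recr/= (sipDl bV) ?IH ?(sipZl bV)//; last exact: subspaceZ.
  by apply: subspace_sum => // i _; exact: subspaceZ.
have ate (j : 'I_n) : a (e j) t = c' j.
  rewrite (semi_innerC aV)// a_sum// (bigD1 j)//= eo eqxx mulr1 big1 ?addr0// => i ij.
  by rewrite eo -val_eqE in ij *; rewrite (negPf ij) mulr0.
have att : a t t = \sum_(i < n) c' i ^+ 2.
  by rewrite {1}/t a_sum//; apply: eq_bigr => i _; rewrite ate.
have bte : lam 1%N * b t t <= a t t.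
  rewrite {1}/t b_sum// att mulr_sumr; apply: ler_sum => i _.
  have := elam i t Vt; rewrite ate.
  rewrite /c'; case: ifPn => [_|i0] h; first by rewrite mul0r mulr0 expr0n.
  have li : lam 1%N <= lam i by rewrite -(prednK (_ : 0 < i)%N) ?lt0n.
  have lp : 0 < lam i by exact: lt_le_trans li.
  have -> : b (e i) t = c i / lam i by rewrite h mulrAC divff ?mul1r// gt_eqF.
  have -> : lam 1%N * (c i * (c i / lam i)) = c i ^+ 2 * (lam 1%N / lam i) by ring.
  by rewrite ler_piMr ?sqr_ge0// ler_pdivrMr// mul1r.
have vt_small : snorm a (v - t) < eps / (1 + s1 * `|C|).
  apply: le_lt_trans cP.
  have vt0 : a (v - t) (e 0%N) = 0.
    rewrite (sipBl aV)// v0 sub0r a_sum// big1 ?oppr0// => i _.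
    by rewrite eo /c'; case: eqP => _; rewrite ?mul0r ?mulr0.
  case: (posnP n) => n0.
    have h (f : nat -> R) : \sum_(i < n) f i *: e i = 0 by rewrite big1// => i _; have := ltn_ord i; rewrite [X in (_ < X)%N]n0.
    by rewrite /t !h.
  have -> : v - \sum_(i < n) c i *: e i = (- c 0%N) *: e 0%N + (v - t).
    rewrite /t; case: n n0 {t Vsum Vt Vvt a_sum b_sum ate att bte vt0} => // n _.
    rewrite !big_ord_recl /c' /= scale0r add0r scaleNr [RHS]addrA [- _ + v]addrC opprD addrA.
    congr (_ - _).
  rewrite -ler_sqr ?nnegrE ?snorm_ge0// !(snorm_sqr aV)//; last first.
    by apply: subspaceD => //; exact: subspaceZ.
  rewrite (sip_sqrZD aV)// (semi_innerC aV (Ve 0%N) Vvt) vt0 mulr0 addr0 lerDr.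
  by rewrite eo mulr1 sqr_ge0.
have nbt : s1 * snorm b t <= snorm a t.
  rewrite -ler_sqr ?nnegrE ?mulr_ge0 ?snorm_ge0 ?(ltW l1s0)//.
  by rewrite exprMn l1s (snorm_sqr aV)// (snorm_sqr bV).
have nat' : snorm a t <= snorm a v + snorm a (v - t).
  have {1}-> : t = v - (v - t) by rewrite subKr.
  exact: (snormB aV Vv Vvt).
have nbv : snorm b v <= snorm b t + snorm b (v - t).
  have {1}-> : v = t + (v - t) by rewrite addrC subrK.
  exact: (snormD bV Vt Vvt).
have h1 := ler_wpM2l (ltW l1s0) nbv.
have h2 := ler_wpM2l (ltW l1s0) (bC' _ Vvt).
have : snorm a (v - t) * (1 + s1 * `|C|) <= eps by rewrite -ler_pdivlMr// ltW.
lra.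
Qed.

(** * The Sobolev space as a vector space *)

Section sobolev.
Variables (R : realType) (d : nat) (Om : set 'rV[R]_d).
Hypothesis mOm : measurable Om.
Hypothesis test_L2 : forall f, continuous (f : 'rV[R]_d -> R) -> L2 Om f.
Local Notation vec := 'rV[R]_d.
Local Notation sob := (sob R d).
Local Notation ipO := (ip_semi_inner mOm).
Implicit Types (u v w : sob) (f g : vec -> R).

(** Iterated partial derivatives need smoothness of both functions at every
    stage to be linear. *)
Lemma smooth_fold_lin (c : R) f g s : smooth f -> smooth g ->
  foldr (@Defs.partial R d) (fun x => c * f x + g x) s =
  (fun x => c * foldr (@Defs.partial R d) f s x + foldr (@Defs.partial R d) g s x).
Proof.
move=> fs gs; elim: s => //= i s ->; apply/funext => x.
have [_ /(_ i x) df] := fs s; have [_ /(_ i x) dg] := gs s.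
rewrite /Defs.partial !derive1E.
set F := (fun t : R => _) in df; set G := (fun t : R => _) in dg.
have -> : (fun t : R => c * foldr (@Defs.partial R d) f s (x + t *: delta_mx 0 i) +
  foldr (@Defs.partial R d) g s (x + t *: delta_mx 0 i)) = (c \*: F) + G by [].
by rewrite (deriveD (derivableZ df) dg) (deriveZ c df).
Qed.

Lemma smooth_lin (c : R) f g : smooth f -> smooth g ->
  smooth (fun x => c * f x + g x).
Proof.
move=> fs gs s; rewrite smooth_fold_lin//.
have [cf df] := fs s; have [cg dg] := gs s; split=> [x|i x].
  exact: (cvgD (cvgM (cvg_cst c) (cf x)) (cg x)).
exact: (derivableD (derivableZ (df i x)) (dg i x)).
Qed.

Lemma test_function_lin (c : R) f g : test_function Om f -> test_function Om g ->
  test_function Om (fun x => c * f x + g x).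
Proof.
move=> [fs cf fO] [gs cg gO].
have supp : closure [set x | c * f x + g x != 0] `<=`
    closure [set x | f x != 0] `|` closure [set x | g x != 0].
  rewrite -closureU; apply: closureS => x /=.
  have [->|] := eqVneq (f x) 0; last by left.
  by rewrite mulr0 add0r; right.
split; first exact: smooth_lin.
- apply: subclosed_compact supp; first exact: closed_closure.
  exact: compactU.
- by move=> x /supp[/fO|/gO].
Qed.

Lemma test_function_0 : test_function Om (fun=> 0).
Proof.
have p0 s : foldr (@Defs.partial R d) (fun=> 0) s = (fun=> 0).
  by elim: s => //= i s ->; exact: partial_cst.
have supp : closure [set x : vec | (0 : R) != 0] = set0.
  by rewrite (_ : [set x | _] = set0) ?closure0//; apply/seteqP; split=> x //=; rewrite eqxx.
split; last by rewrite supp.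
- move=> s; rewrite p0; split; first exact: cst_continuous.
  by move=> i x; exact: derivable_cst.
- by rewrite supp; exact: compact0.
Qed.

Lemma test_partial_L2 psi i : test_function Om psi -> L2 Om (Defs.partial i psi).
Proof. by move=> [/(_ [:: i])[c _] _ _]; exact: test_L2. Qed.

Lemma test_fun_L2 psi : test_function Om psi -> L2 Om psi.
Proof. by move=> [/(_ [::])[c _] _ _]; exact: test_L2. Qed.

Definition sob_L2 : set sob :=
  [set w : sob | L2 Om w.1 /\ forall i, L2 Om (fun x => w.2 x 0 i)].
Definition sob_ip u v : R := ip Om u.1 v.1 +
  \sum_i ip Om (fun x => u.2 x 0 i) (fun x => v.2 x 0 i).

Let fun_lin (c : R) (u v : vec -> vec) i :
  (fun x => (c *: u + v) x 0 i) =
  c *: ((fun x => u x 0 i) : vec -> R^o) + ((fun x => v x 0 i) : vec -> R^o).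
Proof. by apply/funext => x; rewrite !mxE. Qed.

Let sob0_L2 i : L2 Om (fun x => (0 : sob).2 x 0 i).
Proof.
have := @L2_0 R d Om; apply: eq_L2 => //= x _; exact/esym/mxE.
Qed.

Lemma sob_semi_inner : semi_inner sob_L2 sob_ip.
Proof.
split.
- split; first by split; [exact: L2_0|exact: sob0_L2].
  move=> c u v [u1 u2] [v1 v2]; split=> [|i]; first exact: L2_lin.
  by rewrite fun_lin; apply: L2_lin; [|exact: u2|exact: v2].
- move=> c u v w [u1 u2] [v1 v2] [w1 w2]; rewrite /sob_ip.
  rewrite [ip Om _ _](semi_inner_lin ipO)// mulrDr addrACA; congr (_ + _).
  rewrite mulr_sumr -big_split; apply: eq_bigr => i _ /=.
  by rewrite fun_lin [LHS](semi_inner_lin ipO).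
- move=> u v [u1 u2] [v1 v2]; rewrite /sob_ip (semi_innerC ipO)//; congr (_ + _).
  by apply: eq_bigr => i _; apply: (semi_innerC ipO); [exact: u2|exact: v2].
- move=> u [u1 u2]; rewrite addr_ge0 ?(semi_inner_ge0 ipO)//.
  by apply: sumr_ge0 => i _; apply: (semi_inner_ge0 ipO); exact: u2.
Qed.

Lemma norm1_snorm w : norm1 Om w = snorm sob_ip w. Proof. by []. Qed.

Lemma norm0_le_norm1 w : sob_L2 w -> norm2 Om w.1 <= norm1 Om w.
Proof.
move=> [w1 w2]; apply: ler_wsqrtr; rewrite lerDl.
by apply: sumr_ge0 => i _; apply: (semi_inner_ge0 ipO); exact: w2.
Qed.

Lemma H1_L2 w : H1 Om w -> sob_L2 w. Proof. by case. Qed.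

Lemma grad_test_L2 psi : test_function Om psi -> sob_L2 (psi, grad psi).
Proof.
move=> tpsi; split=> [|i /=]; first exact: test_fun_L2.
rewrite (_ : (fun x => _) = Defs.partial i psi); first exact: test_partial_L2.
by apply/funext => x; rewrite mxE.
Qed.

Lemma grad_test_lin (c : R) f g : test_function Om f -> test_function Om g ->
  ((fun x => c * f x + g x, grad (fun x => c * f x + g x)) : sob) =
  c *: (f, grad f) + (g, grad g).
Proof.
move=> [fs _ _] [gs _ _]; congr pair; apply/funext => x.
apply/rowP => i; rewrite !mxE.
by have /= -> := smooth_fold_lin c [:: i] fs gs.
Qed.

Lemma H1_lin (c : R) u v : H1 Om u -> H1 Om v -> H1 Om (c *: u + v).
Proof.
move=> [u1 u2 ug] [v1 v2 vg]; split.
- exact: L2_lin.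
- by move=> i; rewrite fun_lin; apply: L2_lin; [|exact: u2|exact: v2].
move=> psi tpsi i; have p1 := test_fun_L2 tpsi; have p2 := test_partial_L2 i tpsi.
have := semi_inner_lin ipO c u1 v1 p2; rewrite /ip => ->.
rewrite (ug psi tpsi i) (vg psi tpsi i).
have := semi_inner_lin ipO c (u2 i) (v2 i) p1; rewrite -fun_lin /ip => ->.
by rewrite opprD mulrN.
Qed.

Lemma H10_subspace : linear_subspace (H10 Om : set sob).
Proof.
have S := sob_semi_inner; have sL2 := semi_inner_sub S.
have H1_0 : H1 Om (0 : sob).
  split; [exact: L2_0|exact: sob0_L2|].
  move=> psi tpsi i.
  have h1 := sip0l ipO (test_partial_L2 i tpsi); rewrite /ip in h1.
  rewrite [LHS]h1; apply/esym/eqP; rewrite oppr_eq0; apply/eqP.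
  rewrite -[RHS](sip0l ipO (test_fun_L2 tpsi)); apply: eq_Rintegral => x _.
  by rewrite mxE.
split.
  split=> // e e0; exists (fun=> 0); first exact: test_function_0.
  have -> : (0 : sob) - (fun=> 0, grad (fun=> 0)) = 0.
    apply/eqP; rewrite subr_eq0 eq_sym; apply/eqP; congr pair; apply/funext => x.
    by apply/rowP => i; rewrite !mxE partial_cst.
  by rewrite norm1_snorm (snorm0 S).
move=> c u v [u1 ud] [v1 vd]; split; first exact: H1_lin.
move=> e e0; have c0 : 0 < 2 * (`|c| + 1) by rewrite mulr_gt0// ltr_wpDl.
have [f tf fe] := ud _ (divr_gt0 e0 c0).
have [g tg ge] := vd _ (divr_gt0 e0 (ltr0n R 2 : 0 < 2 :> R)).
exists (fun x => c * f x + g x); first exact: test_function_lin.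
rewrite grad_test_lin//.
have uL := H1_L2 u1; have vL := H1_L2 v1.
have fL := grad_test_L2 tf; have gL := grad_test_L2 tg.
have -> : c *: u + v - (c *: (f, grad f) + (g, grad g)) =
    c *: (u - (f, grad f)) + (v - (g, grad g)) :> sob.
  by rewrite opprD addrACA scalerBr.
have uf := subspaceB sL2 uL fL; have vg := subspaceB sL2 vL gL.
apply: le_lt_trans (snormD S (subspaceZ c sL2 uf) vg) _.
rewrite (snormZ S)//; move: fe ge; rewrite !norm1_snorm.
move: (snorm sob_ip (u - _)) (snorm sob_ip (v - _)) => A B Ae Be.
have c1 : 0 < `|c| + 1 by rewrite ltr_wpDl.
have := ler_wpM2l (normr_ge0 c) (ltW Ae).
have -> : `|c| * (e / (2 * (`|c| + 1))) = e / 2 * (`|c| / (`|c| + 1)).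
  by field; rewrite gt_eqF.
have : e / 2 * (`|c| / (`|c| + 1)) <= e / 2.
  rewrite ler_piMr ?divr_ge0 ?(ltW e0)//.
  by rewrite ler_pdivrMr// mul1r lerDl.
move: Be; set t := _ * (_ / _); lra.
Qed.

End sobolev.

(** * The energy form *)

Section problem_facts.
Variables (R : realType) (d : nat) (P : pde R d).
Hypothesis P_ok : pde_ok P.
Local Notation vec := 'rV[R]_d.
Local Notation sob := (sob R d).
Local Notation Om := (dom P).
Local Notation A := (coefA P).
Local Notation phi := (coefphi P).
Implicit Types (u v w : sob) (f g : vec -> R).

Lemma dom_measurable : measurable Om.
Proof. exact: row_open_measurable (dom_open P_ok). Qed.
Let mOm := dom_measurable.
Local Notation ipO := (ip_semi_inner mOm).

Lemma coord_le_enorm (x : vec) i : `|x 0 i| <= enorm x.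
Proof.
rewrite -sqrtr_sqr; apply: ler_wsqrtr; rewrite /dotv (bigD1 i)//= expr2 lerDl.
by apply: sumr_ge0 => j _; rewrite -expr2 sqr_ge0.
Qed.

Lemma dom_coord_bounded : exists r, forall x, Om x -> forall i, `|x 0 i| <= r.
Proof.
have [r rP] := dom_bounded P_ok; exists r => x Ox i.
exact: le_trans (coord_le_enorm x i) (rP x Ox).
Qed.

Lemma dom_finite : (leb R d Om < +oo)%E.
Proof. by have [r rP] := dom_coord_bounded; exact: row_bounded_finite rP. Qed.

Lemma closure_dom_compact : compact (closure Om).
Proof.
have [r rP] := dom_coord_bounded.
pose B : set vec := [set v | forall i, v ord0 i \in `[- r, r]].
have cB : compact B.
  by apply: (@rV_compact R d (fun=> `[- r, r]%classic)) => _; exact: segment_compact.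
apply: (subclosed_compact (@closed_closure _ _) cB).
have -> : B = closure B.
  apply/closure_id; move: cB => /compact_closed; apply; exact: norm_hausdorff.
by apply: closureS => x Ox i; rewrite in_itv/= -ler_norml; exact: rP.
Qed.

Lemma compact_continuous_bounded (C : set vec) f : compact C ->
  {within C, continuous f} -> exists M, forall x, C x -> `|f x| <= M.
Proof.
move=> cC cf; have [M [Mr MP]] := compact_bounded (continuous_compact cf cC).
by exists (M + 1) => x Cx; apply: MP; [rewrite ltrDl|exists x].
Qed.

Lemma dom_continuous_bounded f : continuous f ->
  exists M, forall x, closure Om x -> `|f x| <= M.
Proof.
move=> cf; apply: compact_continuous_bounded; first exact: closure_dom_compact.
exact: continuous_subspaceT.
Qed.

Lemma continuous_L2 f : continuous f -> L2 Om f.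
Proof.
move=> cf; have [M MP] := dom_continuous_bounded cf.
apply: (L2_bounded mOm dom_finite (M := M)); first exact: row_continuous_measurable.
by move=> x Ox; apply: MP; exact: subset_closure.
Qed.

Lemma V_subspace : linear_subspace (V P : set sob).
Proof. exact: H10_subspace mOm continuous_L2. Qed.

Lemma V_L2 w : V P w -> sob_L2 Om w.
Proof. by case=> /H1_L2. Qed.

Lemma V_L2_fun w : V P w -> L2 Om w.1.
Proof. by move=> /V_L2[]. Qed.

Lemma ip0_semi_inner : semi_inner (V P : set sob) (ip0 P).
Proof.
split; first exact: V_subspace.
- move=> c u v w /V_L2_fun u1 /V_L2_fun v1 /V_L2_fun w1.
  exact: (semi_inner_lin ipO).
- by move=> u v /V_L2_fun u1 /V_L2_fun v1; exact: (semi_innerC ipO).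
- by move=> u /V_L2_fun u1; exact: (semi_inner_ge0 ipO).
Qed.

Definition flux u i x : R := \sum_j A x i j * u.2 x 0 j.

Lemma flux_L2 u i : V P u -> L2 Om (flux u i).
Proof.
move=> /V_L2[_ u2]; apply: L2_sum => // j.
have [mA [M AM]] := A_bounded P_ok i j.
exact: (L2_ae_mul mOm (u2 j) mA AM).
Qed.

Lemma phi_L2 f : L2 Om f -> L2 Om (fun x => phi x * f x).
Proof.
by move=> fL; have [mp [M pM]] := phi_bounded P_ok; exact: (L2_ae_mul mOm fL mp pM).
Qed.

Lemma dotv_flux u v x : dotv (u.2 x *m (A x)^T) (v.2 x) =
  \sum_i flux u i x * v.2 x 0 i.
Proof.
apply: eq_bigr => i _; congr (_ * _); rewrite mxE; apply: eq_bigr => j _.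
by rewrite !mxE mulrC.
Qed.

Lemma itg_ip f g : L2 Om f -> L2 Om g ->
  (leb R d).-integrable Om (EFin \o (fun x => f x * g x)).
Proof. by move=> fL gL; exact: L2_mul. Qed.

Lemma ip_sum (s : seq 'I_d) (F G : 'I_d -> vec -> R) :
  (forall i, L2 Om (F i)) -> (forall i, L2 Om (G i)) ->
  \int[leb R d]_(x in Om) (\sum_(i <- s) F i x * G i x) =
  \sum_(i <- s) ip Om (F i) (G i).
Proof.
move=> FL GL; elim: s => [|i s IH].
  rewrite big_nil; under eq_Rintegral do rewrite big_nil.
  by rewrite Rintegral_cst// mul0r.
under eq_Rintegral do rewrite big_cons.
rewrite big_cons RintegralD//; [by rewrite IH|exact: itg_ip|].
by apply: itg_sum => // j _; exact: itg_ip.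
Qed.

Lemma formE u v : V P u -> V P v ->
  Defs.form P u v = \sum_i ip Om (flux u i) (fun x => v.2 x 0 i) +
    ip Om (fun x => phi x * u.1 x) v.1.
Proof.
move=> Vu Vv; have [u1 u2] := V_L2 Vu; have [v1 v2] := V_L2 Vv.
rewrite /Defs.form; under eq_Rintegral do rewrite dotv_flux.
rewrite RintegralD//.
- by rewrite ip_sum// => i; exact: flux_L2.
- by apply: itg_sum => // i _; apply: itg_ip => //; exact: flux_L2.
- by apply: itg_ip => //; exact: phi_L2.
Qed.

(** Used for the zeroth order coefficient, which is nonnegative almost
    everywhere only. *)
Lemma Rintegral_ae_ge0 f : measurable_fun Om f ->
  {ae leb R d, forall x, Om x -> 0 <= f x} ->
  0 <= \int[leb R d]_(x in Om) f x.
Proof.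
move=> mf f0.
rewrite (_ : \int[_]_(x in _) f x = \int[leb R d]_(x in Om) `|f x|).
  exact: Rintegral_ge0.
congr fine; apply: ae_eq_integral => //.
- exact/measurable_EFinP.
- by apply/measurable_EFinP; exact: measurableT_comp.
- by apply: filterS f0 => x f0 Ox; rewrite ger0_norm//; exact: f0.
Qed.

Lemma form_semi_inner : semi_inner (V P : set sob) (Defs.form P).
Proof.
have sV := V_subspace; split=> //.
- move=> c u v w Vu Vv Vw; have [_ sVl] := sV; have Vcuv := sVl c _ _ Vu Vv.
  have [u1 u2] := V_L2 Vu; have [v1 v2] := V_L2 Vv; have [w1 w2] := V_L2 Vw.
  rewrite !formE// mulrDr addrACA; congr (_ + _).
    rewrite mulr_sumr -big_split; apply: eq_bigr => i _ /=.
    have -> : flux (c *: u + v) i = c *: (flux u i : vec -> R^o) + flux v i.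
      apply/funext => x; rewrite -[RHS]/(c * flux u i x + flux v i x).
      rewrite mulr_sumr -big_split; apply: eq_bigr => j _ /=.
      by rewrite !mxE mulrDr mulrCA.
    by apply: (semi_inner_lin ipO) => //; exact: flux_L2.
  have -> : (fun x => phi x * (c *: u + v).1 x) =
      c *: ((fun x => phi x * u.1 x) : vec -> R^o) + (fun x => phi x * v.1 x).
    apply/funext => x; rewrite -[(c *: u + v).1 x]/(c * u.1 x + v.1 x).
    by rewrite -[RHS]/(c * (phi x * u.1 x) + phi x * v.1 x) mulrDr mulrCA.
  by apply: (semi_inner_lin ipO) => //; exact: phi_L2.
- move=> u v Vu Vv; apply: eq_Rintegral => x; rewrite inE => Ox.
  rewrite mulrAC; congr (_ + _); rewrite !dotv_flux.
  under eq_bigr do rewrite /flux mulr_suml.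
  rewrite exchange_big/=; apply: eq_bigr => i _; rewrite /flux mulr_suml.
  apply: eq_bigr => j _; have := A_sym P_ok Ox => /matrixP/(_ i j).
  by rewrite mxE => ->; rewrite mulrAC.
- move=> u Vu; have [u1 u2] := V_L2 Vu; rewrite formE//.
  rewrite -ip_sum//; last by move=> i; exact: flux_L2.
  apply: addr_ge0.
    apply: Rintegral_ge0 => x Ox; rewrite -dotv_flux A_sym//.
    have [->|u0] := eqVneq (u.2 x) 0.
      by rewrite mul0mx /dotv big1// => i _; rewrite !mxE mul0r.
    exact/ltW/(A_pos P_ok).
  apply: Rintegral_ae_ge0.
    apply: measurable_funM; last exact: L2_meas.
    apply: measurable_funM; last exact: L2_meas.
    by case: (phi_bounded P_ok).
  apply: filterS (phi_ge0 P_ok) => x h Ox.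
  by rewrite -mulrA -expr2 mulr_ge0 ?sqr_ge0//; exact: h.
Qed.

Lemma norm0_snorm w : norm0 P w = snorm (ip0 P) w. Proof. by []. Qed.
Lemma norma_snorm w : norma P w = snorm (Defs.form P) w. Proof. by []. Qed.

Section norm_equivalence.
Variables ca Ca : R.
Hypotheses (ca_gt0 : 0 < ca) (norm_equiv : forall w, V P w ->
     ca * norm1 Om w <= norma P w <= Ca * norm1 Om w).

Lemma norm0_le_norma w : V P w -> norm0 P w <= ca^-1 * norma P w.
Proof.
move=> Vw; rewrite ler_pdivlMl//; have /andP[h _] := norm_equiv Vw.
apply: le_trans h; rewrite ler_pM2l//; apply: norm0_le_norm1 => //; exact: V_L2.
Qed.

(** By continuity f stays away from 0 on a box around x inside the domain, and
    a box has positive measure. *)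
Lemma positive_ip f x : continuous f -> Om x -> f x != 0 -> 0 < ip Om f f.
Proof.
move=> cf Ox fx0.
have fx : 0 < `|f x| / 2 by rewrite divr_gt0// normr_gt0.
have : \forall y \near x, Om y /\ `|f x| / 2 <= `|f y|.
  near=> y; split.
    by near: y; apply: open_nbhs_nbhs; split=> //; exact: dom_open.
  have : `|f x - f y| < `|f x| / 2.
    by near: y; move/cvgrPdist_lt: (cf x); exact.
  have := ler_distD (f y) (f x) 0; rewrite !subr0; lra.
move=> /nbhs_ballP[e /= e0 eP].
pose a := x - const_mx (e / 2); pose b := x + const_mx (e / 2).
pose B := [set y : vec | forall i, y 0 i \in `[a 0 i, b 0 i]].
have ab i : a 0 i <= b 0 i.
  by rewrite !mxE lerD2l -subr_ge0 opprK addr_ge0// divr_ge0// ltW.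
have Bx : B `<=` ball x e.
  move=> y yB; split=> // i j; rewrite ord1 /ball/=.
  have := yB j; rewrite !mxE in_itv/= => /andP[h1 h2].
  rewrite ltr_norml; apply/andP; split; lra.
have mB : measurable B.
  rewrite (_ : B = \bigcap_(i in [set: 'I_d])
    ((fun x : vec => x 0 i : measurableTypeR R) @^-1` `[a 0 i, b 0 i]%classic)).
    apply: fin_bigcap_measurable => // i _.
    by rewrite -[X in measurable X]setTI; exact: measurable_coord.
  by apply/seteqP; split => y /= yi i => [_|]; exact: yi.
have BO : B `<=` Om by move=> y /Bx/eP[].
have fL := continuous_L2 cf.
pose g := (fun y => (`|f x| / 2) ^+ 2 * \1_B y : R).
have gE : \int[leb R d]_(y in Om) g y = (`|f x| / 2) ^+ 2 * \prod_(i < d) (b 0 i - a 0 i).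
  have iB : (leb R d).-integrable Om (EFin \o \1_B).
    apply: measurable_bounded_integrable => //; first exact: dom_finite.
    exists 1; split=> // M M1 y _ /=; rewrite indicE.
    by case: (_ \in _); rewrite ?normr1 ?normr0; apply: ltW => //; exact: lt_trans M1.
  rewrite RintegralZl//; congr (_ * _).
  have BE : leb R d B = (\prod_(i < d) (b 0 i - a 0 i))%:E by exact: leb_box.
  rewrite /Rintegral integral_indic// setIidl//; exact: (congr1 fine BE).
apply: (@lt_le_trans _ _ (\int[leb R d]_(y in Om) g y)).
  rewrite gE mulr_gt0 ?exprn_gt0//; apply: prodr_gt0 => i _.
  by rewrite !mxE subr_gt0 ltrD2l -subr_gt0 opprK addr_gt0 ?divr_gt0.
apply: le_Rintegral => //.
- apply: itgZ => //; apply: measurable_bounded_integrable => //; first exact: dom_finite.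
  exists 1; split=> // M M1 y _ /=; rewrite indicE.
  by case: (_ \in _); rewrite ?normr1 ?normr0; apply: ltW => //; exact: lt_trans M1.
- exact: itg_ip.
- move=> y Oy; rewrite /g indicE; case: (boolP (y \in B)) => [/set_mem/Bx/eP[_ h]|_].
    rewrite mulr1 -expr2 -[f y ^+ 2]real_normK ?num_real//.
    by rewrite ler_sqr ?nnegrE// ltW.
  by rewrite mulr0 -expr2 sqr_ge0.
Unshelve. all: by end_near.
Qed.

(** Zero energy gives zero L2 norm, continuity turns this into zero values on
    the domain, and outside the values are prescribed.  So the values of a
    finite element function, unlike its weak gradient, are determined by its
    class. *)
Lemma null_continuous_eq0 w : V P w -> continuous (w.1 : vec -> R) ->
  (forall x, ~ Om x -> w.1 x = 0) -> norma P w = 0 -> w.1 = 0.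
Proof.
move=> Vw cw w0 nw; apply/funext => x.
have [Ox|/w0//] := pselect (Om x).
apply/eqP; apply: contraT => wx.
have := positive_ip cw Ox wx.
have := norm0_le_norma Vw; rewrite nw mulr0 norm0_snorm => h.
have : snorm (ip0 P) w ^+ 2 = 0.
  by apply/eqP; rewrite sqrf_eq0 eq_le h snorm_ge0.
by rewrite (snorm_sqr ip0_semi_inner)// /ip0 => ->; rewrite ltxx.
Qed.

End norm_equivalence.

End problem_facts.

(** * Finite elements and the error estimator *)

Section convex_hulls.
Variables (R : realType) (d : nat).
Local Notation vec := 'rV[R]_d.
Local Notation conv := (@Defs.conv R d).
Implicit Types (S : simplex R d) (T : mesh R d).

Lemma conv_sub S S' : (forall u, u \in S' -> conv S u) -> conv S' `<=` conv S.
Proof.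
move=> S'S x [b [b0 b1 ->]].
have /choice[c cP] : forall u : vec, exists c : vec -> R, u \in S' ->
    [/\ forall v, v \in S -> 0 <= c v, \sum_(v <- S) c v = 1 &
     u = \sum_(v <- S) c v *: v].
  by move=> u; case: (boolP (u \in S')) => [/S'S[c cP]|_]; [exists c|exists (fun=> 0)].
exists (fun v => \sum_(u <- S') b u * c u v); split.
- move=> v vS; rewrite big_seq sumr_ge0// => u uS'.
  by rewrite mulr_ge0 ?b0//; have [h _ _] := cP u uS'; exact: h.
- rewrite exchange_big/= -[RHS]b1 big_seq [RHS]big_seq; apply: eq_bigr => u uS'.
  by rewrite -mulr_sumr; have [_ -> _] := cP u uS'; rewrite mulr1.
- under [RHS]eq_bigr do rewrite scaler_suml.
  rewrite exchange_big/= big_seq [RHS]big_seq; apply: eq_bigr => u uS'.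
  have [_ _ uE] := cP u uS'.
  transitivity (b u *: \sum_(v <- S) c u v *: v); first by rewrite -uE.
  by rewrite scaler_sumr; apply: eq_bigr => v _; rewrite scalerA.
Qed.

Lemma conv_segment S (v w : vec) (t : R) : v \in S -> w \in S -> 0 <= t <= 1 ->
  conv S ((1 - t) *: v + t *: w).
Proof.
move=> vS wS /andP[t0 t1].
have one u : u \in S -> \sum_(x <- S) (x == u)%:R = 1 :> R.
  move=> uS; rewrite (perm_big _ (perm_to_rem uS))/= big_cons eqxx big1_seq ?addr0//.
  move=> x /andP[_]; rewrite mem_rem_uniq ?fset_uniq// inE => /andP[xu _].
  by rewrite (negPf xu).
have oneZ u : u \in S -> \sum_(x <- S) (x == u)%:R *: x = u.
  move=> uS; rewrite (perm_big _ (perm_to_rem uS))/= big_cons eqxx scale1r.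
  rewrite big1_seq ?addr0// => x /andP[_].
  rewrite mem_rem_uniq ?fset_uniq// inE => /andP[xu _].
  by rewrite (negPf xu) scale0r.
exists (fun x => (1 - t) * (x == v)%:R + t * (x == w)%:R); split.
- by move=> x _; rewrite addr_ge0// mulr_ge0// subr_ge0.
- by rewrite big_split/= -!mulr_sumr !one// !mulr1 subrK.
- under eq_bigr do rewrite scalerDl -!scalerA.
  by rewrite big_split/= -!scaler_sumr !oneZ.
Qed.

Lemma conv_vertex S (v : vec) : v \in S -> conv S v.
Proof.
move=> vS; have := @conv_segment S v v 0 vS vS; rewrite lexx ler01 => /(_ isT).
by rewrite subr0 scale1r scale0r addr0.
Qed.

Lemma bisect_conv S S1 S2 : bisect S S1 S2 ->
  conv S1 `<=` conv S /\ conv S2 `<=` conv S.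
Proof.
move=> [v [w [vS wS vw -> ->]]].
have mid : conv S (2^-1 *: (v + w)).
  have := @conv_segment S v w 2^-1 vS wS; rewrite invr_ge0 ler0n invf_le1 ?ler1n//.
  move=> /(_ isT); have -> : 1 - 2^-1 = 2^-1 :> R by lra.
  by rewrite scalerDr.
by split; apply: conv_sub => u; rewrite !inE => /orP[/eqP->//|/andP[_]];
  exact: conv_vertex.
Qed.

Lemma bisections_nested T T' : bisections T T' -> nested T T'.
Proof.
elim=> [S ST|{}T' S S1 S2 TT' IH ST' bis]; first by exists S.
have [c1 c2] := bisect_conv bis; have [S0 S0T cS] := IH S ST'.
move=> S'; rewrite !inE => /or3P[/eqP->|/eqP->|/andP[_ /IH//]].
- by exists S0 => // x /c1/cS.
- by exists S0 => // x /c2/cS.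
Qed.

End convex_hulls.

Section finite_elements.
Variables (R : realType) (d : nat) (d_gt0 : (0 < d)%N) (P : pde R d).
Hypothesis P_ok : pde_ok P.
Variable m : nat.
Local Notation vec := 'rV[R]_d.
Local Notation sob := (sob R d).
Local Notation mesh := (mesh R d).
Local Notation simplex := (simplex R d).
Local Notation Om := (dom P).
Local Notation A := (coefA P).
Local Notation conv := (@Defs.conv R d).
Local Notation elt := (elt P).
Let mOm := dom_measurable P_ok.
Implicit Types (u v w : sob) (f g : vec -> R) (S : simplex) (T : mesh).

Definition poly_on S f := exists2 p, poly_fun m p & forall x, conv S x -> f x = p x.

Lemma fe_poly_on T w S : fe_space P m T w -> S \in T -> poly_on S w.1.
Proof. by move=> [_ _ _ h]; exact: h. Qed.

Lemma fe_V T : fe_space P m T `<=` V P.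
Proof. by move=> w []. Qed.

Lemma fe_subspace T : linear_subspace (fe_space P m T : set sob).
Proof.
have sV := V_subspace P_ok; split.
  split; [exact: sV.1|exact: cst_continuous|by []|].
  by move=> S _; exists (fun=> 0) => //; exact: poly_fun_0.
move=> c u v [Vu cu u0 uP] [Vv cv v0 vP]; split.
- exact: sV.2.
- by move=> x; exact: (cvgD (cvgM (cvg_cst c) (cu x)) (cv x)).
- move=> x Ox; rewrite -[LHS]/(c * u.1 x + v.1 x) u0// v0// mulr0 addr0//.
- move=> S ST; have [p pp pE] := uP S ST; have [q qp qE] := vP S ST.
  exists (fun x => c * p x + q x); first exact: poly_fun_lin.
  by move=> x Sx; rewrite -[LHS]/(c * u.1 x + v.1 x) pE// qE.
Qed.

Lemma fe_nested T T' : nested T T' -> fe_space P m T `<=` fe_space P m T'.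
Proof.
move=> TT' w [Vw cw w0 wP]; split=> // S' /TT'[S ST SS'].
by have [p pp pE] := wP S ST; exists p => // x /SS'/pE.
Qed.

Lemma local_polyP S f : poly_on S f ->
  poly_fun m (local_poly m f S) /\ forall x, conv S x -> f x = local_poly m f S x.
Proof.
by move=> [p pp pE]; apply: (@xgetPex _ (cst 0) [set p | poly_fun m p /\
  forall x, conv S x -> f x = p x]); exists p.
Qed.

Lemma local_poly_polyf S f : poly_on S f -> polyf (local_poly m f S).
Proof. by move=> /local_polyP[/poly_fun_polyf]. Qed.

(** A polynomial is determined by its values on the simplex, so the choice
    made in the definition is linear. *)
Lemma local_poly_lin S (c : R) f g : is_simplex S -> poly_on S f -> poly_on S g ->
  local_poly m (fun x => c * f x + g x) S =
  (fun x => c * local_poly m f S x + local_poly m g S x).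
Proof.
move=> Ssim fS gS; have [fp fE] := local_polyP fS; have [gp gE] := local_polyP gS.
have hS : poly_on S (fun x => c * f x + g x).
  exists (fun x => c * local_poly m f S x + local_poly m g S x).
    exact: poly_fun_lin.
  by move=> x Sx; rewrite fE// gE.
have [hp hE] := local_polyP hS; apply/funext => x; apply/eqP; rewrite -subr_eq0.
apply/eqP; set k := (X in X x - _).
pose D (y : vec) := (-1) * (c * local_poly m f S y + local_poly m g S y) + k y.
rewrite (_ : _ - _ = D x); last by rewrite /D mulN1r addrC.
apply: (polyf_eq0_simplex (S := S)) => //.
  apply: polyf_lin; last exact: poly_fun_polyf hp.
  by apply: polyf_lin; exact: local_poly_polyf.
by move=> y Sy; rewrite /D /k -hE// fE// gE// mulN1r addrC subrr.
Qed.

Lemma elt_measurable S : measurable (elt S).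
Proof. by apply: measurableI => //; apply: compact_row_measurable; exact: conv_compact. Qed.

Definition second_order (p : vec -> R) (x : vec) : R :=
  \sum_i \sum_j (coefdA P i j x 0 i * partial j p x +
                 A x i j * partial i (partial j p) x).

Lemma second_order_lin (c : R) f g x : polyf f -> polyf g ->
  second_order (fun y => c * f y + g y) x =
  c * second_order f x + second_order g x.
Proof.
move=> pf pg; rewrite /second_order mulr_sumr -big_split.
apply: eq_bigr => i _ /=; rewrite mulr_sumr -big_split; apply: eq_bigr => j _ /=.
rewrite (partial_polyf_lin j c pf pg).
rewrite (partial_polyf_lin i c (polyf_partial j pf) (polyf_partial j pg)).
move: (coefdA _ _ _ _ _ _) (A _ _ _) (Defs.partial i _ _) (Defs.partial i _ _).
by move: (Defs.partial j f x) (Defs.partial j g x) => *; ring.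
Qed.

Lemma residualE S f g x : residual P m f g S x =
  f x + second_order (local_poly m g S) x - coefphi P x * g x.
Proof. by rewrite /residual /Lelt -/(second_order _ x) opprD opprK addrA. Qed.

Lemma residual_lin S (c : R) f g v w : is_simplex S -> poly_on S v.1 -> poly_on S w.1 ->
  residual P m (fun x => c * f x + g x) (c *: v + w).1 S =
  (fun x => c * residual P m f v.1 S x + residual P m g w.1 S x).
Proof.
move=> Ssim vS wS; apply/funext => x; rewrite !residualE.
rewrite -[(c *: v + w).1]/(fun x => c * v.1 x + w.1 x).
rewrite (local_poly_lin c Ssim vS wS).
rewrite (second_order_lin c x (local_poly_polyf vS) (local_poly_polyf wS)).
move: (second_order _ _) (second_order _ _) (coefphi P x) => *.
by move: (v.1 x) (w.1 x) (f x) (g x) => *; ring.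
Qed.

Lemma residual_L2 S f v : L2 Om f -> V P v -> poly_on S v.1 ->
  L2 (elt S) (residual P m f v.1 S).
Proof.
move=> fL Vv vS; have mS := elt_measurable S.
have SO : elt S `<=` Om by move=> x [].
apply: (L2_subset mOm mS SO).
have vL := V_L2_fun Vv; have vp := local_poly_polyf vS.
have -> : residual P m f v.1 S = (f : vec -> R^o) +
  (1 *: (second_order (local_poly m v.1 S) : vec -> R^o) +
   ((-1) *: ((fun x => coefphi P x * v.1 x) : vec -> R^o) + 0)).
  apply/funext => x; rewrite residualE scale1r scaleN1r addr0 -addrA.
  by [].
have sL := L2_subspace mOm.
apply: (subspaceD sL) => //; apply: sL.2.
  apply: L2_sum => // i; apply: L2_sum => // j.
  apply: (subspaceD sL).
    have [mdA [M dAM]] := dA_bounded P_ok i j i.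
    apply: (L2_ae_mul mOm _ mdA dAM); apply: (continuous_L2 P_ok).
    by apply: polyf_continuous; exact: polyf_partial.
  have [mA [M AM]] := A_bounded P_ok i j.
  apply: (L2_ae_mul mOm _ mA AM); apply: (continuous_L2 P_ok).
  by apply: polyf_continuous; do 2!apply: polyf_partial.
apply: sL.2; last exact: L2_0.
exact: phi_L2.
Qed.

Lemma jump_lin S S' (c : R) v w x : is_simplex S -> is_simplex S' ->
  poly_on S v.1 -> poly_on S w.1 -> poly_on S' v.1 -> poly_on S' w.1 ->
  jump P m (c *: v + w).1 S S' x = c * jump P m v.1 S S' x + jump P m w.1 S S' x.
Proof.
move=> Ssim S'sim vS wS vS' wS'.
rewrite /jump -[(c *: v + w).1]/(fun x => c * v.1 x + w.1 x) !local_poly_lin//.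
have gl S0 : poly_on S0 v.1 -> poly_on S0 w.1 ->
  grad (fun y => c * local_poly m v.1 S0 y + local_poly m w.1 S0 y) x =
  c *: grad (local_poly m v.1 S0) x + grad (local_poly m w.1 S0) x.
  move=> vS0 wS0; apply/rowP => i; rewrite !mxE partial_polyf_lin//;
  exact: local_poly_polyf.
have dl (y z nu : vec) : dotv (c *: y + z) nu = c * dotv y nu + dotv z nu.
  rewrite /dotv mulr_sumr -big_split; apply: eq_bigr => i _ /=.
  by rewrite !mxE mulrDl mulrA.
rewrite !gl// !mulmxDl -!scalemxAl !dl.
by move: (dotv _ _) (dotv _ _) (dotv _ _) (dotv _ _) => *; ring.
Qed.

(** An algebra of functions whose members are square integrable on every set
    of finite measure. *)
Definition bounded_measurable (C : set vec) f :=
  measurable_fun C f /\ exists M, forall x, C x -> `|f x| <= M.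

Lemma bmD C f g : bounded_measurable C f -> bounded_measurable C g ->
  bounded_measurable C (fun x => f x + g x).
Proof.
move=> [mf [M fM]] [mg [N gN]]; split; first exact: measurable_funD.
by exists (M + N) => x Cx; apply: le_trans (ler_normD _ _) _; rewrite lerD ?fM ?gN.
Qed.

Lemma bmM C f g : bounded_measurable C f -> bounded_measurable C g ->
  bounded_measurable C (fun x => f x * g x).
Proof.
move=> [mf [M fM]] [mg [N gN]]; split; first exact: measurable_funM.
by exists (M * N) => x Cx; rewrite normrM ler_pM ?fM ?gN.
Qed.

Lemma bm_cst C (c : R) : bounded_measurable C (fun=> c).
Proof. by split; [exact: measurable_cst|exists `|c|]. Qed.

Lemma bm_sum (I : Type) (s : seq I) C (F : I -> vec -> R) :
  (forall i, bounded_measurable C (F i)) ->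
  bounded_measurable C (fun x => \sum_(i <- s) F i x).
Proof.
move=> h; elim: s => [|i s IH].
  by under eq_fun do rewrite big_nil; exact: bm_cst.
by under eq_fun do rewrite big_cons; exact: bmD.
Qed.

Let C := closure Om.
Let mC : measurable C.
Proof. by apply: row_closed_measurable; exact: closed_closure. Qed.

Lemma jump_bounded_measurable S S' v : poly_on S v.1 -> poly_on S' v.1 ->
  bounded_measurable C (jump P m v.1 S S').
Proof.
move=> vS vS'.
have flux_bm p (nu : vec) : polyf p ->
    bounded_measurable C (fun x => - dotv (grad p x *m (A x)^T) nu).
  move=> pp; under eq_fun do rewrite -mulN1r.
  apply: bmM; first exact: bm_cst.
  apply: bm_sum => i; apply: bmM; last exact: bm_cst.
  under eq_fun do rewrite mxE.
  apply: bm_sum => j; under eq_fun do rewrite !mxE; apply: bmM.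
    have cp : continuous (partial j p) by apply: polyf_continuous; exact: polyf_partial.
    split; first exact: row_continuous_measurable.
    exact: (dom_continuous_bounded P_ok cp).
  split.
    apply: row_continuous_within_measurable => //; exact: (A_continuous P_ok).
  apply: compact_continuous_bounded; first exact: (closure_dom_compact P_ok).
  exact: (A_continuous P_ok).
by apply: bmD; apply: flux_bm; exact: local_poly_polyf.
Qed.

Definition face_point (F : simplex) (t : 'rV[R]_d.-1) : vec :=
  nth 0 (F : seq vec) 0 + t *m
  (\matrix_(i < d.-1) (nth 0 (F : seq vec) i.+1 - nth 0 (F : seq vec) 0) : 'M[R]_(d.-1, d)).

Definition face_weight (F : simplex) : R :=
  let G : 'M[R]_(d.-1, d) :=
    \matrix_(i < d.-1) (nth 0 (F : seq vec) i.+1 - nth 0 (F : seq vec) 0) in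
  Num.sqrt (\det (G *m G^T)).

Local Notation U := (@unit_simplex R d.-1).

Lemma face_integralE F f : face_integral F (fun x => f x ^+ 2) =
  face_weight F * norm2 U (f \o face_point F) ^+ 2.
Proof.
rewrite /face_integral -/(face_weight F); congr (_ * _).
rewrite /norm2 sqr_sqrtr; last by apply: Rintegral_ge0 => x _; rewrite -expr2 sqr_ge0.
by apply: eq_Rintegral => t _; rewrite expr2.
Qed.

Lemma unit_simplex_measurable : measurable U.
Proof.
have -> : U = (\bigcap_(i in [set: 'I_d.-1])
    ((fun x : 'rV[R]_d.-1 => x 0 i : measurableTypeR R) @^-1` `[0, +oo[%classic)) `&`
    ((fun t : 'rV[R]_d.-1 => \sum_i t 0 i : measurableTypeR R) @^-1` `]-oo, 1]%classic).
  apply/seteqP; split => t /= [t0 t1]; split.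
  - by move=> i _; rewrite /= in_itv/= t0.
  - by rewrite /= in_itv.
  - by move=> i; have := t0 i I; rewrite /= in_itv/= andbT.
  - by move: t1; rewrite /= in_itv.
apply: measurableI.
  apply: fin_bigcap_measurable => // i _.
  by rewrite -[X in measurable X]setTI; exact: measurable_coord.
rewrite -[X in measurable X]setTI.
have : measurable_fun setT (fun t : 'rV[R]_d.-1 => \sum_i t 0 i : R).
  by apply: measurable_sum => i; exact: measurable_coord.
by apply.
Qed.

Lemma unit_simplex_finite : (leb R d.-1 U < +oo)%E.
Proof.
apply: (@row_bounded_finite _ _ _ 1); first exact: unit_simplex_measurable.
move=> t [t0 t1] i; rewrite ger0_norm// (le_trans _ t1)//.
by rewrite (bigD1 i)//= lerDl sumr_ge0.
Qed.

Lemma face_point_measurable F : measurable_fun setT (face_point F).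
Proof.
apply: measurable_fun_coord => i.
apply: (row_continuous_measurable measurableT).
apply: polyf_continuous.
rewrite (_ : _ \o _ = (fun t : 'rV[R]_d.-1 => nth 0 (F : seq vec) 0 0 i +
  \sum_(k < d.-1) t 0 k * (nth 0 (F : seq vec) k.+1 - nth 0 (F : seq vec) 0) 0 i)).
  apply: polyf_add; first exact: polyf_cst.
  by apply: polyf_sum => k; apply: polyf_mul; [exact: polyf_coord|exact: polyf_cst].
apply/funext => t /=; rewrite /face_point mxE; congr (_ + _).
by rewrite mxE; apply: eq_bigr => k _; rewrite !mxE.
Qed.

(** The coordinates of t are barycentric coordinates for all vertices but the
    first. *)
Lemma face_point_conv F t : #|` F|%fset = d -> U t -> conv F (face_point F t).
Proof.
move=> Fd [t0 t1].
have d1 : d = d.-1.+1 by rewrite prednK.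
pose c (v : vec) : R := let k := index v (F : seq vec) in
  if k is k'.+1 then (if insub k' is Some i then t 0 (i : 'I_d.-1) else 0)
  else 1 - \sum_i t 0 i.
have c0 : c (nth 0 (F : seq vec) 0) = 1 - \sum_i t 0 i.
  by rewrite /c index_uniq ?fset_uniq// Fd.
have cS (i : 'I_d.-1) : c (nth 0 (F : seq vec) i.+1) = t 0 i.
  rewrite /c index_uniq ?fset_uniq// ?valK//.
  by rewrite Fd [X in (_ < X)%N]d1 ltnS.
have Fd' : #|` F|%fset = d.-1.+1 by rewrite Fd.
have sumE (M : nmodType) (h : vec -> M) : \sum_(v <- F) h v =
    h (nth 0 (F : seq vec) 0) + \sum_(i < d.-1) h (nth 0 (F : seq vec) i.+1).
  by rewrite (fset_sum_nth h Fd') big_ord_recl.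
exists c; split.
- move=> v vF; rewrite /c; case: (index _ _) => [|k]; first by rewrite subr_ge0.
  by case: insub => //= i; exact: t0.
- by rewrite (sumE _ c) c0 (eq_bigr _ (fun i _ => cS i)) subrK.
- rewrite (sumE _ (fun x : vec => c x *: x)) c0.
  rewrite (eq_bigr _ (fun i _ => congr1 (fun r => r *: _) (cS i))).
  rewrite /face_point mulmx_sum_row.
  rewrite (eq_bigr (fun i => t 0 i *: nth 0 (F : seq vec) i.+1 -
    t 0 i *: nth 0 (F : seq vec) 0)); last by move=> i _; rewrite rowK scalerBr.
  rewrite sumrB -scaler_suml scalerBl scale1r addrA [in RHS]addrAC.
  by rewrite addrAC.
Qed.

(** The face lies in the closure of the domain, where the coefficients and the
    derivatives of polynomials are continuous, hence bounded. *)
Lemma jump_face_L2 T S S' v : conforming_mesh Om T -> S \in T -> S' \in T ->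
  Defs.adjacent S S' -> poly_on S v.1 -> poly_on S' v.1 ->
  L2 U (jump P m v.1 S S' \o face_point (S `&` S')%fset).
Proof.
move=> [_ Tconf Tcov] ST S'T /andP[_ /eqP Fd] vS vS'.
have [mj [M jM]] := jump_bounded_measurable vS vS'.
have UC : [set face_point (S `&` S')%fset x | x in U] `<=` C.
  move=> _ [t Ut <-]; rewrite /C Tcov; exists S => //.
  by have := face_point_conv Fd Ut; rewrite -(Tconf S S')// => -[].
apply: (L2_bounded unit_simplex_measurable unit_simplex_finite (M := M)).
  apply: (measurable_comp mC UC mj).
  exact: measurable_funTS (face_point_measurable _).
by move=> t Ut /=; apply: jM; apply: UC; exists t.
Qed.

Lemma norm2_young n (D : set 'rV[R]_n) (c : R) (f g h : 'rV[R]_n -> R) :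
  measurable D -> L2 D f -> L2 D g -> h = (fun x => c * f x + g x) ->
  young (c ^+ 2 * norm2 D f ^+ 2) (norm2 D g ^+ 2) (norm2 D h ^+ 2).
Proof.
move=> mD fL gL ->; have S := ip_semi_inner mD.
have := snormD S (subspaceZ c (semi_inner_sub S) fL) gL.
rewrite (snormZ S)// => h'.
rewrite -(real_normK (num_real c)) -exprMn; apply: young_sqr.
by rewrite sqrtr_ge0.
Qed.

Lemma hS_ge0 S : 0 <= hS S.
Proof.
rewrite /hS /diam; set X := [set _ | _ in _].
have [hX|hX] := pselect (has_sup X); last by rewrite sup_out.
have [[x Xx] Xub] := hX.
apply: (@le_trans _ _ x); first by case: Xx => p _ <-; exact: sqrtr_ge0.
exact: ub_le_sup.
Qed.

Lemma indicator2_ge0 T f g S : 0 <= indicator2 P m T f g S.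
Proof.
apply: addr_ge0; first by rewrite mulr_ge0 ?sqr_ge0.
apply: sumr_ge0 => S' _; rewrite face_integralE; apply: mulr_ge0; first exact: hS_ge0.
by apply: mulr_ge0; [exact: sqrtr_ge0|exact: sqr_ge0].
Qed.

Lemma indicator2_young T (c : R) f g v w S : conforming_mesh Om T ->
  S \in T -> L2 Om f -> L2 Om g -> fe_space P m T v -> fe_space P m T w ->
  young (c ^+ 2 * indicator2 P m T f v.1 S) (indicator2 P m T g w.1 S)
    (indicator2 P m T (fun x => c * f x + g x) (c *: v + w).1 S).
Proof.
move=> Tok ST fL gL vT wT; have [Tsim _ _] := Tok.
have vS := fe_poly_on vT ST; have wS := fe_poly_on wT ST.
rewrite /indicator2 mulrDr; apply: youngD.
  rewrite mulrCA; apply: youngM; first exact: sqr_ge0.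
  apply: norm2_young; [exact: elt_measurable|exact: (residual_L2 fL (fe_V vT) vS)|
    exact: (residual_L2 gL (fe_V wT) wS)|].
  exact: (residual_lin c f g (Tsim _ ST) vS wS).
rewrite mulr_sumr; apply: young_sum => S' S'T adj.
have vS' := fe_poly_on vT S'T; have wS' := fe_poly_on wT S'T.
rewrite !face_integralE mulrCA; apply: youngM; first exact: hS_ge0.
rewrite mulrCA; apply: youngM; first exact: sqrtr_ge0.
apply: norm2_young; [exact: unit_simplex_measurable|exact: (jump_face_L2 Tok ST S'T adj vS vS')|
  exact: (jump_face_L2 Tok ST S'T adj wS wS')|].
apply/funext => t /=; exact: (jump_lin c _ (Tsim _ ST) (Tsim _ S'T) vS wS vS' wS').
Qed.

(** The squared estimator is a weighted sum of squared L2 norms of functions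
    that depend linearly on f and v: the residuals on the elements and the
    jumps on the faces, pulled back to the unit simplex. *)
Lemma estimator_lin T (c : R) f g v w : conforming_mesh Om T ->
  L2 Om f -> L2 Om g -> fe_space P m T v -> fe_space P m T w ->
  estimator P m T T (fun x => c * f x + g x) (c *: v + w).1 <=
  `|c| * estimator P m T T f v.1 + estimator P m T T g w.1.
Proof.
move=> Tok fL gL vT wT; rewrite /estimator.
rewrite -sqrtr_sqr -sqrtrM ?sqr_ge0// mulr_sumr; apply: young_sqrt.
- by apply: sumr_ge0 => S _; rewrite mulr_ge0 ?sqr_ge0 ?indicator2_ge0.
- by apply: sumr_ge0 => S _; exact: indicator2_ge0.
- by apply: young_sum => S ST _; exact: indicator2_young.
Qed.

End finite_elements.

(** * The approximation constants of a space *)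

Section approximation_constants.
Variables (R : realType) (d : nat) (P : pde R d).
Hypothesis P_ok : pde_ok P.
Local Notation sob := (sob R d).
Local Notation vec := 'rV[R]_d.
Local Notation Om := (dom P).
Local Notation V := (V P : set sob).
Variables ca Ca : R.
Hypotheses (ca_gt0 : 0 < ca) (norm_equiv : forall w, V w ->
     ca * norm1 Om w <= norma P w <= Ca * norm1 Om w).
Let aV := form_semi_inner P_ok.
Let bV := ip0_semi_inner P_ok.
Let mOm := dom_measurable P_ok.
Implicit Types (W : set sob) (u v w : sob).

Definition dist_to W u : R := inf [set norma P (u - w) | w in W].

Lemma dist_to_le W u w : W w -> dist_to W u <= norma P (u - w).
Proof.
move=> Ww; apply: ge_inf; last by exists w.
by exists 0 => _ [v _ <-]; exact: sqrtr_ge0.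
Qed.

Lemma dist_to_anti W W' u : W !=set0 -> W `<=` W' -> dist_to W' u <= dist_to W u.
Proof.
move=> [w0 Ww0] WW'; apply: lb_le_inf; first by exists (norma P (u - w0)), w0.
by move=> _ [w Ww <-]; apply: dist_to_le; exact: WW'.
Qed.

Lemma dist_to_lt W u (e : R) : W !=set0 -> dist_to W u < e ->
  exists2 w, W w & norma P (u - w) < e.
Proof.
move=> [w0 Ww0] /inf_lt[|_ [w Ww <-] we]; last by exists w.
by exists (norma P (u - w0)), w0.
Qed.

(** The bound M ensures that the right-hand side is a true supremum and not a
    default value. *)
Lemma sup_dist_anti (T : Type) (A : set T) (F : T -> sob) W W' (M : R) :
  W !=set0 -> W `<=` W' -> (forall x, A x -> dist_to W (F x) <= M) ->
  sup [set dist_to W' (F x) | x in A] <= sup [set dist_to W (F x) | x in A].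
Proof.
move=> W0 WW' AM; have [->|/set0P[x0 Ax0]] := eqVneq A set0.
  by rewrite !image_set0.
apply: ge_sup; first by exists (dist_to W' (F x0)), x0.
move=> _ [x Ax <-]; apply: le_trans (dist_to_anti _ W0 WW') _.
by apply: ub_le_sup; [exists M => _ [y Ay <-]; exact: AM|exists x].
Qed.

Variables (K : (vec -> R) -> sob) (K_sol : solution_operator P K).

Lemma norma_K_le f : L2 Om f -> norm2 Om f = 1 -> norma P (K f) <= ca^-1.
Proof.
move=> fL f1; have [VK KE] := K_sol fL.
have [->|n0] := eqVneq (norma P (K f)) 0; first by rewrite invr_ge0 ltW.
have np : 0 < norma P (K f) by rewrite lt0r n0 sqrtr_ge0.
rewrite -(ler_pM2r np) -expr2 norma_snorm (snorm_sqr aV)// KE//.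
apply: le_trans (ler_norm _) _.
apply: le_trans (sip_cauchy_schwarz (ip_semi_inner mOm) fL (V_L2_fun VK)) _.
rewrite -!norm2_snorm f1 mul1r; exact: (norm0_le_norma P_ok ca_gt0 norm_equiv).
Qed.

Lemma eta_a_anti W W' : W 0 -> W `<=` W' -> eta_a P K W' <= eta_a P K W.
Proof.
move=> W0 WW'; apply: (sup_dist_anti (M := ca^-1)) => //; first by exists 0.
move=> f [fL f1]; apply: le_trans (dist_to_le _ W0) _.
by rewrite subr0; exact: norma_K_le.
Qed.

Lemma eta_a_ge0 W : W 0 -> 0 <= eta_a P K W.
Proof.
move=> W0.
rewrite /eta_a; set X := [set _ | _ in _].
have [hX|hX] := pselect (has_sup X); last by rewrite sup_out.
have [[x Xx] _] := hX; apply: (@le_trans _ _ x); last exact: ub_le_sup hX.2 _ Xx.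
case: Xx => f _ <-.
apply: lb_le_inf; first by exists (norma P (K f - 0)), 0.
by move=> _ [w _ <-]; exact: sqrtr_ge0.
Qed.

Variables (lam : nat -> R) (uh : nat -> sob).
Hypothesis eigenpairs : eigensystem P lam uh.
Local Notation z := (uh 0%N).

Lemma K_spectral : spectral_setting V (Defs.form P) (ip0 P) z (lam 0%N) (lam 1%N)
  (fun w => K w.1).
Proof.
have L2V w : V w -> L2 Om w.1 by move=> /V_L2_fun.
have lam1 : 0 < lam 1%N := lt_trans (lam_gt0 eigenpairs) (lam_simple eigenpairs).
split.
- exact: aV.
- exact: bV.
- exact: (uh_V eigenpairs).
- by rewrite (uh_orthonormal eigenpairs) eqxx.
- exact: (uh_eigen eigenpairs).
- exact: (lam_gt0 eigenpairs).
- exact: (lam_simple eigenpairs).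
- apply: (spectral_gap aV bV (C := ca^-1) (e := uh)).
  + exact: (norm0_le_norma P_ok ca_gt0 norm_equiv).
  + exact: (uh_V eigenpairs).
  + exact: (uh_orthonormal eigenpairs).
  + exact: (uh_eigen eigenpairs).
  + exact: lam1.
  + elim=> // i IH; exact: le_trans IH (lam_nondecreasing eigenpairs i).
  + exact: (uh_complete eigenpairs).
- by move=> f /L2V/K_sol[].
- by move=> f v /L2V/K_sol[_ h] Vv; exact: h.
Qed.
Let S := K_spectral.

Lemma delta_anti W W' : W 0 -> W `<=` W' ->
  delta P (lam 0%N) W' <= delta P (lam 0%N) W.
Proof.
move=> W0 WW'; apply: (sup_dist_anti (M := 1)) => //; first by exists 0.
by move=> v [_ v1]; apply: le_trans (dist_to_le _ W0) _; rewrite subr0 v1.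
Qed.

Let z_unit : eigenspace_of P (lam 0%N) z /\ norma P z = 1.
Proof.
split; first by split; [exact: (uh_V eigenpairs)|exact: (uh_eigen eigenpairs)].
by rewrite /norma (uh_orthonormal eigenpairs) eqxx sqrtr1.
Qed.

Lemma delta_dense W (e : R) : W 0 -> delta P (lam 0%N) W < e ->
  exists2 w, W w & norma P (z - w) < e.
Proof.
move=> W0 We; apply: dist_to_lt; first by exists 0.
apply: le_lt_trans We; apply: ub_le_sup; last by exists z.
exists 1 => _ [v [_ v1] <-].
by apply: le_trans (dist_to_le _ W0) _; rewrite subr0 v1.
Qed.

(** Up to a null vector a unit eigenvector is c z with |c| = 1, so it is
    approximated by c w as well as z is by w. *)
Lemma delta_le W (w : sob) : linear_subspace W -> W `<=` V -> W w ->
  delta P (lam 0%N) W <= norma P (z - w).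
Proof.
move=> sW WV Ww; apply: ge_sup; first by exists (dist_to W z), z.
move=> _ [v [[Vv vE] v1] <-].
have Vz := uh_V eigenpairs 0%N; have Vw := WV _ Ww.
have sV := V_subspace P_ok.
have v0 : Defs.form P (v - v) z = 0 by rewrite subrr (sip0l aV).
have [nv0 _] := eig_projection S Vv vE Vv v0.
have nv : snorm (Defs.form P) (v - eig_coef (Defs.form P) z v *: z) = 0.
  by rewrite -[LHS]nv0 subrr (snorm0 aV).
set c := eig_coef _ _ v in nv.
have c1 : `|c| = 1.
  have := na_split S Vv; rewrite -norma_snorm v1 [snorm _ (eig_rest _ _ _)]nv.
  rewrite expr0n/= addr0 expr1n => c2.
  by apply/eqP; rewrite -(@eqrXn2 _ 2)// expr1n real_normK ?num_real// -c2.
apply: le_trans (dist_to_le _ (subspaceZ c sW Ww)) _.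
have -> : v - c *: w = c *: (z - w) + (v - c *: z).
  by rewrite scalerBr [RHS]addrC addrA subrK.
have Vzw := subspaceB sV Vz Vw; have Vczw := subspaceZ c sV Vzw.
have Vvz := subspaceB sV Vv (subspaceZ c sV Vz).
by rewrite norma_snorm (snorm_add_null aV Vczw Vvz nv) (snormZ aV)// c1 mul1r.
Qed.

End approximation_constants.

(** * Runs of the algorithm *)

Section algorithm_run.
Variables (R : realType) (d : nat) (d_gt0 : (0 < d)%N) (P : pde R d).
Hypothesis P_ok : pde_ok P.
Local Notation sob := (sob R d).
Local Notation vec := 'rV[R]_d.
Local Notation mesh := (mesh R d).
Local Notation Om := (dom P).
Local Notation V := (V P : set sob).
Variables ca Ca : R.
Hypotheses (ca_gt0 : 0 < ca) (norm_equiv : forall w, V w ->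
     ca * norm1 Om w <= norma P w <= Ca * norm1 Om w).
Variables (lam : nat -> R) (uh : nat -> sob).
Hypothesis eigenpairs : eigensystem P lam uh.
Variable E : sob -> sob.
Hypothesis E_proj : eigen_projection P (lam 0%N) E.
Variables (K : (vec -> R) -> sob) (K_sol : solution_operator P K).
Variables (m : nat) (gs : R) (G : mesh -> sob -> sob).
Hypothesis G_galerkin : forall T, admissible P gs T -> galerkin P m G T.
Variable q : nat.
Hypothesis osc_data : forall T, admissible P gs T -> forall f v,
     fe_space P m T f -> fe_space P m T v ->
     osc P q T (residual P m f.1 v.1) = osc P q T (Lelt P m v.1).
Variables (theta1 theta2 : R) (REFINE : mesh -> mesh -> mesh -> Prop).
Hypothesis REFINE_ok : refine_spec P gs REFINE.
Variables Cea Ce0 Can Cup Clow Coa gam ahat : R.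
Hypotheses (Cea_gt0 : 0 < Cea) (Ce0_gt0 : 0 < Ce0) (Can_gt0 : 0 < Can).
Hypotheses (gam_gt0 : 0 < gam) (ahat_01 : 0 < ahat < 1).
Hypothesis Can_spec : forall T, admissible P gs T -> forall v, V v ->
     norm0 P (v - G T v) <=
       Can * eta_a P K (fe_space P m T) * norma P (v - G T v).
Hypothesis Cup_spec : forall T, admissible P gs T -> forall f, L2 Om f ->
     norma P (K f - G T (K f)) <= Cup * estimator P m T T f (G T (K f)).1.
Hypothesis Clow_spec : forall T, admissible P gs T -> forall f, L2 Om f ->
     Clow * estimator P m T T f (G T (K f)).1 <=
       norma P (K f - G T (K f)) + osc P q T (residual P m f (G T (K f)).1).
Hypothesis Coa_spec : forall T, admissible P gs T -> forall v, fe_space P m T v ->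
     osc P q T (Lelt P m v.1) <= Coa * norma P v.
Local Notation z := (uh 0%N).
Local Notation form := (Defs.form P).
Let Ks (w : sob) : sob := K w.1.
Let S := K_spectral P_ok ca_gt0 norm_equiv K_sol eigenpairs.
Let aV := form_semi_inner P_ok.
Let bV := ip0_semi_inner P_ok.
Let sV := V_subspace P_ok.
Local Notation pe := (eig_rest form z).
Local Notation cf := (eig_coef form z).

Lemma E_rest v : V v -> norma P (v - E v) = snorm form (pe v) /\
  norm0 P (v - E v) = snorm (ip0 P) (pe v).
Proof.
move=> Vv; have [[VE EE] Eorth] := E_proj Vv.
apply: (eig_projection S VE EE Vv).
by apply: Eorth; split; [exact: (uh_V eigenpairs)|exact: (uh_eigen eigenpairs)].
Qed.

Lemma galerkin_solG T f : admissible P gs T -> V f ->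
  galerkin_sol form (ip0 P) (fe_space P m T) f (G T (Ks f)).
Proof.
move=> Tad Vf; have VK : V (Ks f) := spec_sol S Vf.
have [GT Gorth] := G_galerkin Tad VK; split=> // v Tv.
have Vv := fe_V Tv; have VG := fe_V GT.
have := Gorth v Tv; rewrite (sipBl aV)// => /eqP; rewrite subr_eq0 => /eqP <-.
exact: (spec_solE S Vf Vv).
Qed.

(** The estimator depends on a discrete solution through its values, so it may
    be evaluated at any Galerkin solution. *)
Lemma galerkin_fun_unique T f u v :
  galerkin_sol form (ip0 P) (fe_space P m T) f u ->
  galerkin_sol form (ip0 P) (fe_space P m T) f v -> u.1 = v.1.
Proof.
move=> [Tu uE] [Tv vE]; have sT := fe_subspace P_ok m T.
have Tw := subspaceB sT Tu Tv; have [Vw cw w0 _] := Tw.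
have Vu := fe_V Tu; have Vv := fe_V Tv.
have nw : norma P (u - v) = 0.
  by rewrite /norma (sipBl aV)// uE// vE// subrr sqrtr0.
have := null_continuous_eq0 P_ok ca_gt0 norm_equiv Vw cw w0 nw.
by move=> /eqP; rewrite subr_eq0 => /eqP.
Qed.

Definition lev_eta (T : nat -> mesh) k (f : sob) : R :=
  estimator P m (T k) (T k) f.1 (G (T k) (Ks f)).1.

Lemma estimator_sol T k f u : admissible P gs (T k) -> V f ->
  galerkin_sol form (ip0 P) (fe_space P m (T k)) f u ->
  estimator P m (T k) (T k) f.1 u.1 = lev_eta T k f.
Proof.
move=> Tad Vf uP; congr estimator.
exact: galerkin_fun_unique uP (galerkin_solG Tad Vf).
Qed.

Variable r : run R d.
Hypothesis rP : algorithmC P m gs theta1 theta2 REFINE r.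
Local Notation VH := (fe_space P m (meshH r)).
Local Notation Vk k := (fe_space P m (Tk r k)).
Local Notation eta := (lev_eta (Tk r)).

Lemma VH_sub1 : VH `<=` Vk 1.
Proof. by apply: fe_nested; exact: (alg_T1 rP). Qed.

Lemma Vk_nested k : (0 < k)%N -> Vk k `<=` Vk k.+1.
Proof.
move=> k0; apply: fe_nested; apply: bisections_nested.
have [M _ _] := alg_mark rP (k0 : (1 < k.+1)%N).
by have [] := REFINE_ok (alg_mesh rP k0) M (alg_refine rP (k0 : (1 < k.+1)%N)).
Qed.

Lemma VH_sub k : (0 < k)%N -> VH `<=` Vk k.
Proof.
elim: k => // -[_ _|k IH _]; first exact: VH_sub1.
by apply: subset_trans (Vk_nested _) => //; exact: IH.
Qed.

Let sH := fe_subspace P_ok m (meshH r).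
Let sk k : linear_subspace (Vk k) := fe_subspace P_ok m (Tk r k).
Variables eps del : R.
Hypotheses (Can_eps : Can * eta_a P K VH <= eps) (Ce0_eps : Ce0 * eta_a P K VH <= eps).
Hypothesis delta_del : delta P (lam 0%N) VH < del.

Lemma run_levels : level_setting V form (ip0 P) z Ks (fun k => Vk k)
  (fun k f => G (Tk r k) (Ks f)) eta Cup Clow Coa eps del.
Proof.
have ad k : (0 < k)%N -> admissible P gs (Tk r k) by exact: (alg_mesh rP).
split.
- by move=> k _; exact: fe_V.
- by move=> k _; exact: sk.
- exact: Vk_nested.
- by move=> k f k0; apply: galerkin_solG; exact: ad.
- move=> k f k0 Vf; have VK : V (Ks f) := spec_sol S Vf.
  apply: le_trans (Can_spec (ad k k0) VK) _.
  apply: ler_wpM2r; first exact: sqrtr_ge0.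
  apply: le_trans Can_eps; apply: ler_wpM2l; first exact: ltW.
  exact: (eta_a_anti P_ok ca_gt0 norm_equiv K_sol sH.1 (VH_sub k0)).
- move=> k k0.
  have [w Hw zw] := delta_dense eigenpairs sH.1 delta_del.
  by exists w; [exact: (VH_sub k0)|exact: ltW].
- by move=> k f; exact: sqrtr_ge0.
- move=> k c f g k0 Vf Vg; have kad := ad k k0; have [_ sVl] := sV.
  have Vfg := sVl c _ _ Vf Vg.
  have fP := galerkin_solG kad Vf; have gP := galerkin_solG kad Vg.
  have fgP : galerkin_sol form (ip0 P) (Vk k) (c *: f + g)
      (c *: G (Tk r k) (Ks f) + G (Tk r k) (Ks g)).
    case: fP gP => [Tf fE] [Tg gE]; split=> [|v Tv]; first exact: (sk k).2.
    have Vv := fe_V Tv; have Vf' := fe_V Tf; have Vg' := fe_V Tg.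
    by rewrite (semi_inner_lin aV)// (semi_inner_lin bV)// fE// gE.
  rewrite -(estimator_sol kad Vfg fgP).
  exact: (estimator_lin d_gt0 P_ok c kad.1 (V_L2_fun Vf) (V_L2_fun Vg) fP.1 gP.1).
- by move=> k f k0 Vf; exact: (Cup_spec (ad k k0) (V_L2_fun Vf)).
- move=> k f k0 Wf; have Vf := fe_V Wf; have kad := ad k k0.
  apply: le_trans (Clow_spec kad (V_L2_fun Vf)) _.
  have [GW _] := galerkin_solG kad Vf.
  rewrite lerD2l (osc_data kad Wf GW); exact: Coa_spec.
Qed.

Hypothesis Cea_spec : forall W mu w, esolve_space P m r W -> esolve P W mu w ->
  norma P (w - E w) <= Cea * delta P (lam 0%N) W.
Hypothesis Ce0_spec : forall W mu w, esolve_space P m r W -> esolve P W mu w ->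
  norm0 P (w - E w) <= Ce0 * eta_a P K W * norma P (w - E w).

Lemma esolve_output k W mu w u : (0 < k)%N -> esolve_space P m r W ->
  esolve P W mu w -> linear_subspace W -> VH `<=` W -> W `<=` Vk k ->
  (forall c, exists2 v, W v & norma P (z - v) <= norma P (z - c *: u)) ->
  eig_output form (ip0 P) z (fun k => Vk k) Cea eps del k u w.
Proof.
move=> k0 rW wP sW HW Wk Wu; have [Ww w1 _ _] := wP.
have WV : W `<=` V by apply: subset_trans Wk _ => v; exact: fe_V.
have [Ea E0] := E_rest (WV _ Ww).
have := Cea_spec rW wP; have := Ce0_spec rW wP; rewrite Ea E0 => h0 ha.
split.
- exact: Wk.
- exact: w1.
- apply: le_trans ha _; rewrite ler_pM2l//; apply: ltW; apply: le_lt_trans delta_del.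
  exact: delta_anti sH.1 HW.
- move=> c; apply: le_trans ha _; rewrite ler_pM2l//.
  have [v Wv vle] := Wu c; apply: le_trans vle.
  exact: (delta_le P_ok ca_gt0 norm_equiv K_sol eigenpairs sW WV Wv).
- apply: le_trans h0 _; apply: ler_wpM2r; first exact: sqrtr_ge0.
  apply: le_trans Ce0_eps; apply: ler_wpM2l; first exact: ltW.
  exact: (eta_a_anti P_ok ca_gt0 norm_equiv K_sol sH.1 HW).
Qed.

Lemma add_span_subspace (W : set sob) u : linear_subspace W ->
  linear_subspace (add_span W u).
Proof.
move=> sW; split; first by exists 0; [exact: sW.1|exists 0; rewrite scale0r addr0].
move=> c _ _ [v Wv [s ->]] [w Ww [t ->]].
exists (c *: v + w); first exact: sW.2.
by exists (c * s + t); rewrite scalerDr addrACA scalerA scalerDl.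
Qed.

(** The subspace is spanned by the normalized iterate.  It contains every
    multiple of u, unless the energy of u vanishes, and then 0 is as close to
    z as any multiple of u. *)
Lemma span_output k mu w u : (0 < k)%N -> Vk k u ->
  esolve_space P m r (add_span VH ((norma P u)^-1 *: u)) ->
  esolve P (add_span VH ((norma P u)^-1 *: u)) mu w ->
  eig_output form (ip0 P) z (fun k => Vk k) Cea eps del k u w.
Proof.
move=> k0 ku rW wP; set u' := (norma P u)^-1 *: u in rW wP.
have HW : VH `<=` add_span VH u'.
  by move=> v Hv; exists v => //; exists 0; rewrite scale0r addr0.
apply: (esolve_output k0 rW wP) => //; first exact: add_span_subspace.
  move=> _ [v Hv [c ->]]; apply: (subspaceD (sk k)); first exact: (VH_sub k0).
  by apply: (subspaceZ _ (sk k)); exact: (subspaceZ _ (sk k)).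
move=> c; have [n0|n0] := eqVneq (norma P u) 0.
  exists 0; first by exists 0; [exact: sH.1|exists 0; rewrite scale0r addr0].
  have Vu := fe_V ku; have Vcu := subspaceZ (- c) sV Vu.
  have Vz := uh_V eigenpairs 0%N.
  have nu : snorm form ((- c) *: u) = 0 by rewrite (snormZ aV)// [snorm _ _]n0 mulr0.
  by rewrite subr0 -scaleNr !norma_snorm (snorm_add_null aV Vz Vcu nu).
exists (c *: u) => //; exists 0; first exact: sH.1.
by exists (c * norma P u); rewrite add0r /u' scalerA mulfK.
Qed.

Hypothesis contraction : forall k, (1 <= k)%N ->
  let f := (fk r k).1 in
  norma P (K f - G (Tk r k.+1) (K f)) ^+ 2
    + gam * estimator P m (Tk r k.+1) (Tk r k.+1) f (G (Tk r k.+1) (K f)).1 ^+ 2 <=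
  ahat ^+ 2 * (norma P (K f - G (Tk r k) (K f)) ^+ 2
    + gam * estimator P m (Tk r k) (Tk r k) f (G (Tk r k) (K f)).1 ^+ 2).

Lemma first_rayleigh : lamk r 1 * ip0 P (uk r 1) (uk r 1) = 1.
Proof.
have [W1 n1 uE _] := alg_u1 rP; rewrite -uE//.
by rewrite -(snorm_sqr aV (fe_V W1)) [snorm _ _]n1 expr1n.
Qed.

Lemma lamk1_gt0 : 0 < lamk r 1.
Proof.
have [W1 _ _ _] := alg_u1 rP; have h := first_rayleigh.
have b0 := semi_inner_ge0 bV (fe_V W1).
have : 0 < lamk r 1 * ip0 P (uk r 1) (uk r 1) by rewrite h.
by rewrite pmulr_lgt0// lt0r b0 andbT; apply: contraTneq (oner_neq0 R) => b1;
   rewrite -h b1 mulr0 eqxx.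
Qed.

(** At level 1 the iterate is an eigenfunction, and the multiple ubark r 1 of
    it has energy norm 1 / lamk r 1. *)
Lemma uk_normalized k : (0 < k)%N -> uk r k = (norma P (ubark r k))^-1 *: ubark r k.
Proof.
case: k => // -[_|k _].
  have [W1 n1 _ _] := alg_u1 rP; have l1 := lamk1_gt0.
  rewrite (alg_ubar1 rP) norma_snorm (snormZ aV _ (fe_V W1)) [snorm _ _]n1 mulr1.
  by rewrite gtr0_norm ?invr_gt0// invrK scalerA divff ?scale1r// gt_eqF.
have [_ -> -> _] := alg_level rP (isT : (1 < k.+2)%N).
by have [_ -> _] := alg_lsolve rP (isT : (1 < k.+2)%N) (leqnn (Jk r k.+2)).
Qed.

Lemma run_adaptive : adaptive_run form (ip0 P) z Ks (fun k => Vk k)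
  (fun k f => G (Tk r k) (Ks f)) eta Cea eps del gam theta2 ahat
  (fk r) (ubark r) (fj r) (ubarj r) (Jk r) (ell r) (etal r).
Proof.
have ad k : (0 < k)%N -> admissible P gs (Tk r k) by exact: (alg_mesh rP).
have [W1 n1 uE umin] := alg_u1 rP.
have inner_sol k j : (1 < k)%N -> (j <= Jk r k)%N ->
    galerkin_sol form (ip0 P) (Vk k) (fj r k j) (ubarj r k j).
  by move=> k1 jJ; have [] := alg_lsolve rP k1 jJ.
have sol k : (0 < k)%N -> galerkin_sol form (ip0 P) (Vk k) (fk r k) (ubark r k).
  case: k => // -[_|k _]; last first.
    have [-> -> _ _] := alg_level rP (isT : (1 < k.+2)%N).
    exact: inner_sol.
  rewrite (alg_f1 rP) (alg_ubar1 rP); split=> [|v Wv].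
    exact: (subspaceZ _ (sk 1)).
  rewrite (sipZl aV _ (fe_V W1) (fe_V Wv)) uE// mulrA mulVf ?mul1r//.
  by rewrite gt_eqF// lamk1_gt0.
have first : eig_output form (ip0 P) z (fun k => Vk k) Cea eps del 1 (ubark r 1) (fk r 1).
  rewrite (alg_f1 rP).
  apply: (esolve_output (W := Vk 1) (mu := lamk r 1)) => //.
  - by constructor 1.
  - exact: VH_sub1.
  - move=> c; exists (c *: ubark r 1) => //.
    by apply: (subspaceZ _ (sk 1)); case: (sol 1%N).
have new_output k : (1 < k)%N -> (0 < Jk r k)%N ->
    eig_output form (ip0 P) z (fun k => Vk k) Cea eps del k (ubark r k) (fj r k.+1 0).
  move=> k1 J0; have k0 := ltnW k1; have [oP -> _ _ _] := alg_new_stage rP k1 J0.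
  rewrite (uk_normalized k0) in oP.
  apply: (span_output k0 _ _ oP); first by case: (sol k k0).
  by constructor 3; exists k; rewrite (uk_normalized k0).
have inner_output k j : (1 < k)%N -> (j < Jk r k)%N ->
    eig_output form (ip0 P) z (fun k => Vk k) Cea eps del k (ubarj r k j) (fj r k j.+1).
  move=> k1 jJ; have k0 := ltnW k1; have [_ oP ->] := alg_continue rP k1 jJ.
  have [_ ujE _] := alg_lsolve rP k1 (ltnW jJ).
  have rW : esolve_space P m r (add_span VH (uj r k j)) by constructor 2; exists k, j.
  rewrite ujE in oP rW.
  by apply: (span_output k0 _ rW oP); case: (inner_sol k j k1 (ltnW jJ)).
have fkV k j : (1 < k)%N -> (j <= Jk r k)%N -> V (fj r k j).
  elim: k j => // k IH j k1 jJ.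
  case: j jJ => [_|j jJ]; last by case: (inner_output _ _ k1 jJ) => Wj *; exact: fe_V Wj.
  case: k k1 IH => // -[_ _|k k1 IH]; first by rewrite (alg_f2 rP); exact: fe_V W1.
  have [J0|J0] := posnP (Jk r k.+2).
    have [-> _] := alg_same_stage rP (isT : (1 < k.+2)%N) J0.
    rewrite uk_normalized//; apply: (subspaceZ _ sV).
    by have [Wu _] := sol k.+2 isT; exact: fe_V Wu.
  by case: (new_output k.+2 isT J0) => Wj *; exact: fe_V Wj.
have etaE k j : (1 < k)%N -> (j <= Jk r k)%N ->
    estimator P m (Tk r k) (Tk r k) (fj r k j).1 (ubarj r k j).1 = eta k (fj r k j).
  move=> k1 jJ; apply: (estimator_sol (ad k (ltnW k1))) (inner_sol k j k1 jJ).
  exact: fkV.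
split.
- exact: sol.
- exact: first.
- exact: (alg_ell2 rP).
- rewrite (alg_eta1 rP); apply: (estimator_sol (ad 1%N isT)) (sol 1%N isT).
  by case: first => Wf *; exact: fe_V Wf.
- by rewrite (alg_f2 rP) (alg_f1 rP).
- exact: inner_sol.
- move=> k j k1 jJ; split; last exact: inner_output.
  by have [h _ _] := alg_continue rP k1 jJ; rewrite -etaE// ltnW.
- move=> k k1; have [fE uE' _ _] := alg_level rP k1; split=> //.
  by rewrite -etaE//; exact: (alg_exit rP).
- move=> k k1 J0; split; first exact: new_output.
  have [_ _ -> _ ->] := alg_new_stage rP k1 J0.
  have [-> -> _ _] := alg_level rP k1; exact: etaE.
- move=> k k1 J0; have [-> ->] := alg_same_stage rP k1 J0.
  by rewrite uk_normalized// ltnW.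
- move=> k k0; have /andP[a0 _] := ahat_01.
  have c := contraction k0.
  rewrite -ler_sqr ?nnegrE ?mulr_ge0 ?sqrtr_ge0 ?(ltW a0)// exprMn.
  have e i := quasi_err_sqr form Ks (fun k f => G (Tk r k) (Ks f)) eta gam_gt0 i (fk r k).
  have tr (x y x' y' : R) : x = x' -> y = y' -> x' <= ahat ^+ 2 * y' ->
    x <= ahat ^+ 2 * y by move=> -> ->.
  exact: (tr _ _ _ _ (e k.+1) (e k) c).
Qed.

Lemma uk_rayleigh k : (0 < k)%N -> norma P (uk r k) = 1 ->
  0 < ip0 P (uk r k) (uk r k) -> lamk r k * ip0 P (uk r k) (uk r k) = 1.
Proof.
case: k => // -[_ _ _|k _ n1 b0]; first exact: first_rayleigh.
have Vu : V (uk r k.+2).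
  rewrite uk_normalized//; apply: (subspaceZ _ sV).
  have [_ -> _ _] := alg_level rP (isT : (1 < k.+2)%N).
  have [[Wu _] _ _] := alg_lsolve rP (isT : (1 < k.+2)%N) (leqnn (Jk r k.+2)).
  exact: fe_V Wu.
have [_ _ ukE ->] := alg_level rP (isT : (1 < k.+2)%N).
have [_ _ ->] := alg_lsolve rP (isT : (1 < k.+2)%N) (leqnn (Jk r k.+2)).
rewrite -ukE divfK ?gt_eqF//.
by rewrite -(snorm_sqr aV Vu) [snorm _ _]n1 expr1n.
Qed.

End algorithm_run.

(** * Convergence *)

(** The constant 3 leaves room for the square of 3 / 2. *)
Lemma square_decay (R : realType) (x nK p y ak : R) :
  0 < nK -> 0 <= x -> 0 <= ak -> 0 <= y -> x * nK <= 3 / 2 * ak * p ->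
  p <= nK * y -> x ^+ 2 <= 3 * y ^+ 2 * ak ^+ 2.
Proof.
move=> n0 x0 a0 y0 h1 h2.
have ay : 0 <= ak * y by rewrite mulr_ge0.
have xle : x <= 3 / 2 * (ak * y).
  rewrite -(ler_pM2r n0); apply: le_trans h1 _.
  have := ler_wpM2l a0 h2; lra.
have h3 : x ^+ 2 <= (3 / 2 * (ak * y)) ^+ 2 by rewrite ler_sqr ?nnegrE//; lra.
have := sqr_ge0 (ak * y); move: h3; rewrite !exprMn; lra.
Qed.

Lemma le_scale_null (R : realType) (c p p' p0 i n : R) :
  p <= c * p' + p0 -> p0 <= i * n -> n = 0 -> p <= c * p'.
Proof. by move=> h1 h2 n0; move: h2; rewrite n0 mulr0; lra. Qed.

Lemma split_le (R : realType) (s t x e : R) :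
  0 <= s -> 0 <= t -> x * s + x * t < e -> 0 <= x -> s * x <= e /\ t * x <= e.
Proof.
move=> s0 t0 h x0; have := mulr_ge0 x0 s0; have := mulr_ge0 x0 t0; split; lra.
Qed.

Unset Implicit Arguments.
Set Strict Implicit.
Set Printing Implicit Defensive.

Theorem theorem3p2 (R : realType) (d : nat) (d_gt0 : (0 < d)%N)
  (P : pde R d) (P_ok : pde_ok P)
  (ca Ca : R) (ca_gt0 : 0 < ca) (Ca_gt0 : 0 < Ca)
  (norm_equiv : forall w, V P w ->
     ca * norm1 (dom P) w <= norma P w <= Ca * norm1 (dom P) w)
  (* eigenpairs, a-orthogonal projection onto the first eigenspace, and K *)
  (lam : nat -> R) (uh : nat -> sob R d) (eigenpairs : eigensystem P lam uh)
  (uh1_not_poly : ~ piecewise_polynomial P (uh 0%N).1)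
  (E : sob R d -> sob R d) (E_proj : eigen_projection P (lam 0%N) E)
  (K : ('rV[R]_d -> R) -> sob R d) (K_sol : solution_operator P K)
  (* finite elements of degree m on gs-shape regular meshes *)
  (m : nat) (m_gt0 : (1 <= m)%N) (gs : R)
  (G : mesh R d -> sob R d -> sob R d)
  (G_galerkin : forall T, admissible P gs T -> galerkin P m G T)
  (q : nat)
  (osc_data : forall T, admissible P gs T -> forall f v,
     fe_space P m T f -> fe_space P m T v ->
     osc P q T (residual P m f.1 v.1) = osc P q T (Lelt P m v.1))
  (* parameters and refinement procedure of the algorithm *)
  (theta1 theta2 thetastar : R)
  (theta1_01 : 0 < theta1 < 1) (theta2_01 : 0 < theta2 < 1)
  (thetastar_spec : forall (T Ts : mesh R d) (f : 'rV[R]_d -> R) (xi2 : R),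
     admissible P gs T -> admissible P gs Ts -> bisections T Ts ->
     L2 (dom P) f -> 0 < xi2 < 2^-1 ->
     norma P (K f - G Ts (K f)) ^+ 2
       + osc P q Ts (residual P m f (G Ts (K f)).1) ^+ 2 <=
     xi2 * (norma P (K f - G T (K f)) ^+ 2
       + osc P q T (residual P m f (G T (K f)).1) ^+ 2) ->
     estimator P m T (T `\` (Ts `&` T))%fset f (G T (K f)).1 ^+ 2 >=
     thetastar ^+ 2 * (1 - 2 * xi2) *
       estimator P m T T f (G T (K f)).1 ^+ 2)
  (theta1_star : theta1 < thetastar)
  (REFINE : mesh R d -> mesh R d -> mesh R d -> Prop)
  (REFINE_ok : refine_spec P gs REFINE)
  (* approximation of V by V_H as H tends to 0 *)
  (eta_a_cvg : forall e : R, 0 < e -> exists2 H : R, 0 < H &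
     forall T, admissible P gs T -> mesh_size T <= H ->
       eta_a P K (fe_space P m T) < e)
  (delta_cvg : forall e : R, 0 < e -> exists2 H : R, 0 < H &
     forall T, admissible P gs T -> mesh_size T <= H ->
       delta P (lam 0%N) (fe_space P m T) < e)
  (* the known mesh-independent constants *)
  (Cea Ce0 Can Cup Clow Coa gam ahat : R)
  (Cea_gt0 : 0 < Cea) (Ce0_gt0 : 0 < Ce0) (Can_gt0 : 0 < Can)
  (Cup_gt0 : 0 < Cup) (Clow_gt0 : 0 < Clow) (Coa_gt0 : 0 < Coa)
  (gam_gt0 : 0 < gam) (ahat_01 : 0 < ahat < 1)
  (Cea_spec : forall r, algorithmC P m gs theta1 theta2 REFINE r ->
     forall W mu w, esolve_space P m r W -> esolve P W mu w ->
       norma P (w - E w) <= Cea * delta P (lam 0%N) W)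
  (Ce0_spec : forall r, algorithmC P m gs theta1 theta2 REFINE r ->
     forall W mu w, esolve_space P m r W -> esolve P W mu w ->
       norm0 P (w - E w) <= Ce0 * eta_a P K W * norma P (w - E w))
  (Can_spec : forall T, admissible P gs T -> forall v, V P v ->
     norm0 P (v - G T v) <=
       Can * eta_a P K (fe_space P m T) * norma P (v - G T v))
  (Cup_spec : forall T, admissible P gs T -> forall f, L2 (dom P) f ->
     norma P (K f - G T (K f)) <= Cup * estimator P m T T f (G T (K f)).1)
  (Clow_spec : forall T, admissible P gs T -> forall f, L2 (dom P) f ->
     Clow * estimator P m T T f (G T (K f)).1 <=
       norma P (K f - G T (K f)) + osc P q T (residual P m f (G T (K f)).1))
  (Coa_spec : forall T, admissible P gs T -> forall v, fe_space P m T v ->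
     osc P q T (Lelt P m v.1) <= Coa * norma P v)
  (contraction : forall r, algorithmC P m gs theta1 theta2 REFINE r ->
     forall k, (1 <= k)%N ->
     let f := (fk r k).1 in
     norma P (K f - G (Tk r k.+1) (K f)) ^+ 2
       + gam * estimator P m (Tk r k.+1) (Tk r k.+1) f
                 (G (Tk r k.+1) (K f)).1 ^+ 2 <=
     ahat ^+ 2 * (norma P (K f - G (Tk r k) (K f)) ^+ 2
       + gam * estimator P m (Tk r k) (Tk r k) f (G (Tk r k) (K f)).1 ^+ 2))
  (alpha : R) (alpha_bnd : ahat < alpha < 1) :
  exists2 H0 : R, 0 < H0 &
    forall r, algorithmC P m gs theta1 theta2 REFINE r ->
    mesh_size (meshH r) <= H0 ->
    let f1 : 'rV[R]_d -> R :=
      fun x => (norma P (K (fk r 1).1))^-1 * (fk r 1).1 x in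
    let w1 := K f1 in
    let Cu := 3 * (norma P (w1 - G (Tk r 1) w1) ^+ 2
                + gam * estimator P m (Tk r 1) (Tk r 1) f1
                          (G (Tk r 1) (K f1)).1 ^+ 2) in
    let Clam := 8 * lam 0%N * Cu in
    forall k, (1 <= k)%N ->
      norma P (uk r k - E (uk r k)) ^+ 2 <= Cu * alpha ^+ (2 * (k - 1)) /\
      `|lamk r k - lam 0%N| <= Clam * alpha ^+ (2 * (k - 1)).
Proof.
have l0 := lam_gt0 eigenpairs; have l12 := lam_simple eigenpairs.
have [qq [kap [tau [e0 [d0 [e0p d0p params]]]]]] :=
  small_parameters_exist l0 l12 Cup_gt0 Clow_gt0 Coa_gt0 Cea_gt0 gam_gt0
    theta2_01 ahat_01 alpha_bnd.
(* The same eps has to serve the duality estimates of the Galerkin and of the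
   eigenvalue problems, which have the constants Can and Ce0. *)
have C0 : 0 < Can + Ce0 by rewrite addr_gt0.
have [H1 H1p H1P] := eta_a_cvg _ (divr_gt0 e0p C0).
have [H2 H2p H2P] := delta_cvg _ d0p.
exists (Num.min H1 H2); first by rewrite lt_min H1p.
move=> r rP; rewrite le_min => /andP[le1 le2] f1 w1 Cu Clam k k0.
have Had := alg_meshH rP.
have etaH := H1P _ Had le1; have deltaH := H2P _ Had le2.
rewrite ltr_pdivlMr// mulrDr in etaH.
have eta0 : 0 <= eta_a P K (fe_space P m (meshH r)).
  by apply: eta_a_ge0; exact: (fe_subspace P_ok m (meshH r)).1.
have [can_le ce_le] := split_le (ltW Can_gt0) (ltW Ce0_gt0) etaH eta0.
have pP : small_parameters (lam 0%N) (lam 1%N) Cup Clow Coa Cea gam theta2 ahat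
    alpha e0 d0 qq kap tau.
  by apply: params; rewrite lexx ltW.
have S := K_spectral P_ok ca_gt0 norm_equiv K_sol eigenpairs.
have L := run_levels d_gt0 P_ok ca_gt0 norm_equiv eigenpairs K_sol G_galerkin
  osc_data REFINE_ok Can_gt0 Can_spec Cup_spec Clow_spec Coa_spec rP can_le deltaH.
have A := run_adaptive P_ok ca_gt0 norm_equiv eigenpairs E_proj K_sol G_galerkin
  REFINE_ok Cea_gt0 Ce0_gt0 gam_gt0 ahat_01 rP ce_le deltaH (Cea_spec r rP)
  (Ce0_spec r rP) (contraction r rP).
have unit := iterate_unit S L Cup_gt0 Clow_gt0 Coa_gt0 Cea_gt0 gam_gt0 theta2_01
  ahat_01 alpha_bnd pP A k0.
have small := iterate_rest_small S L Cup_gt0 Clow_gt0 Coa_gt0 Cea_gt0 gam_gt0 theta2_01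
  ahat_01 alpha_bnd pP A k0.
have decay := iterate_rest_decay S L Cup_gt0 Clow_gt0 Coa_gt0 Cea_gt0 gam_gt0 theta2_01
  ahat_01 alpha_bnd pP A k0.
have K1 := first_solution_gt0 S L Cup_gt0 Cea_gt0 gam_gt0 theta2_01 pP A.

have ukE := uk_normalized P_ok rP k0.
rewrite norma_snorm in ukE; rewrite -ukE in unit small decay.
have V1 : V P (fk r 1) by rewrite (alg_f1 rP); have [/fe_V] := alg_u1 rP.
have Vu : V P (uk r k).
  rewrite ukE; apply: (subspaceZ _ (V_subspace P_ok)).
  by have [/fe_V] := run_sol A k0.
have [xE _] := E_rest P_ok ca_gt0 norm_equiv eigenpairs E_proj K_sol Vu.
have sV := V_subspace P_ok.
set nK := snorm _ _ in K1 decay.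
have c0 : nK^-1 != 0 by rewrite invr_eq0 gt_eqF.
pose Q := quasi_err (Defs.form P) (fun w => K w.1)
  (fun k f => G (Tk r k) (K f.1)) (lev_eta P K m G (Tk r)) gam 1.
have CuE : Cu = 3 * Q (nK^-1 *: fk r 1) ^+ 2.
  have e := quasi_err_sqr (Defs.form P) (fun w => K w.1)
    (fun k f => G (Tk r k) (K f.1)) (lev_eta P K m G (Tk r)) gam_gt0 1
    (nK^-1 *: fk r 1).
  exact: (congr1 ( *%R 3) (esym e)).
have Qle : Q (fk r 1) <= nK * Q (nK^-1 *: fk r 1).
  have V0 : V P (0 : sob R d) := sV.1.
  have W0 : fe_space P m (Tk r 1) (0 : sob R d) := (lev_lin L (ltn0Sn 0)).1.
  have qf := quasi_err_lin S L gam_gt0 (ltn0Sn 0) nK (subspaceZ nK^-1 sV V1) V0.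
  have q0 := quasi_err_inv S L Clow_gt0 Coa_gt0 gam_gt0 (ltn0Sn 0) W0.
  have n0 : snorm (ip0 P) (0 : sob R d) = 0 := snorm0 (ip0_semi_inner P_ok).
  have fE : nK *: (nK^-1 *: fk r 1) + 0 = fk r 1.
    by rewrite addr0 scalerA divff ?scale1r ?gt_eqF.
  rewrite fE (gtr0_norm K1) in qf.
  exact: (le_scale_null qf q0 n0).
have al0 : 0 <= alpha.
  have /andP[a1 _] := ahat_01; have /andP[a2 _] := alpha_bnd.
  exact: le_trans (ltW a1) (ltW a2).
have ak0 : 0 <= alpha ^+ k.-1 by exact: exprn_ge0.
set x := snorm _ _ in xE small decay.
have x0 : 0 <= x by exact: sqrtr_ge0.
have Q0 : 0 <= Q (nK^-1 *: fk r 1) by exact: sqrtr_ge0.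
have akE : alpha ^+ (2 * (k - 1)) = (alpha ^+ k.-1) ^+ 2.
  by rewrite -exprM subn1 mulnC.
have x2 : x ^+ 2 <= Cu * alpha ^+ (2 * (k - 1)).
  rewrite CuE akE; exact: (square_decay K1 x0 ak0 Q0 decay Qle).
split; first by rewrite xE.
have cf0 := unit_mass_gt0 S Vu unit small.
have muE := uk_rayleigh P_ok rP k0 unit cf0.
have /andP[r0 r8] := rayleigh_error S Vu unit small muE.
rewrite (ger0_norm r0); apply: le_trans r8 _.
have l8 : 0 <= 8 * lam 0%N by rewrite mulr_ge0// ltW.
rewrite /Clam -[leRHS]mulrA; exact: (ler_wpM2l l8 x2).
Qed.
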